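(* Let $X$ be a complex Banach space and let $f\in L^p(\mathbb R_+,X)$, where $1\le p\le\infty$. Assume that the Laplace transform $\widehat f$ admits an analytic extension to a neighbourhood of $0$ in $\mathbb C$, and let $$g(t)=\widehat f(0)-\int_0^t f(s)\,ds,\qquad t\ge0.$$ Then $g\in L^p(\mathbb R_+,X)$. If $p<\infty$, then $g\in C_0(\mathbb R_+,X)$ and $g\in L^r(\mathbb R_+,X)$ whenever $p\le r\le\infty$.
   Context: $\mathbb R_+=[0,\infty)$. $\widehat f(\lambda)=\int_0^\infty e^{-\lambda t}f(t)\,dt$, holomorphic on $\{\operatorname{Re}\lambda>0\}$; the same symbol denotes its holomorphic extension to a larger connected open set. $C_0(\mathbb R_+,X)$ is the space of continuous functions $\mathbb R_+\to X$ tending to $0$ at infinity. *)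

(* Defs.v *)
From HB Require Import structures.
From mathcomp Require Import all_boot all_order all_algebra.
From mathcomp Require Import all_classical all_reals all_analysis.
From mathcomp Require Import complex.

Set Implicit Arguments.
Unset Strict Implicit.
Unset Printing Implicit Defensive.
Import Order.TTheory GRing.Theory Num.Theory.
Import numFieldNormedType.Exports.

Local Open Scope classical_set_scope.
Local Open Scope ring_scope.
Local Open Scope complex_scope.

(* The norm of a normed module over R[i] takes its values in R[i]; these values
   are nonnegative reals, so that taking the real part loses nothing. *)
Definition rnorm (R : realType) (X : normedModType R[i]) (x : X) : R :=
  complex.Re `|x|.

Section Bochner.
Context {d : measure_display} {T : measurableType d} {R : realType}
  {X : normedModType R[i]}.
Variables (mu : {measure set T -> \bar R}) (D : set T).

Definition simple_on (s : T -> X) : Prop :=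
  [/\ finite_set (s @` D),
      (forall x, measurable (D `&` s @^-1` [set x])) &
      (forall x, x != 0 -> (mu (D `&` s @^-1` [set x]) < +oo)%E)].

(* The value 0 may be taken on a set of infinite measure; its term vanishes. *)
Definition simple_integral (s : T -> X) : X :=
  \sum_(x \in s @` D) (fine (mu (D `&` s @^-1` [set x])))%:C *: x.

Definition strongly_measurable (f : T -> X) : Prop :=
  exists s : nat -> T -> X,
    (forall n, simple_on (s n)) /\
    {ae mu, forall t, D t -> s n t @[n --> \oo] --> f t}.

Definition is_bochner (f : T -> X) (v : X) : Prop :=
  exists s : nat -> T -> X,
    [/\ (forall n, simple_on (s n)),
        {ae mu, forall t, D t -> s n t @[n --> \oo] --> f t},
        (\int[mu]_(t in D) (rnorm (f t - s n t))%:E @[n --> \oo] --> 0)%E &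
        simple_integral (s n) @[n --> \oo] --> v].

(* Equal to 0 by convention when f is not Bochner integrable on D. *)
Definition bochner (f : T -> X) : X := xget 0 [set v | is_bochner f v].

(* Membership of (the class of) f in L^p(D, X). *)
Definition memLp (p : \bar R) (f : T -> X) : Prop :=
  strongly_measurable f /\
  ('N[mu]_p[patch (fun=> 0%E) D (fun t => (rnorm (f t))%:E)] < +oo)%E.

End Bochner.

Section HalfLine.
Context {R : realType}.

Definition Rplus : set R := `[0, +oo[.

(* R[i]^o is R[i] seen as a normed module over itself; this is the type that
   carries the topology of the complex plane. *)
Definition right_half_plane : set R[i]^o := [set z | 0 < complex.Re z].

Definition cexp (z : R[i]) : R[i] :=
  (expR (complex.Re z))%:C *
  (cos (complex.Im z) +i* sin (complex.Im z)).

Context {X : normedModType R[i]}.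

Definition laplace (f : R -> X) (z : R[i]) : X :=
  bochner (@lebesgue_measure R) Rplus (fun t => cexp (- (z * t%:C)) *: f t).

Definition holomorphic_on (U : set R[i]^o) (F : R[i]^o -> X) : Prop :=
  forall z, U z -> derivable F z 1.

(* F, restricted to U, is the holomorphic extension to the connected open set U
   of the Laplace transform of f; the values of F outside U are irrelevant. *)
Definition laplace_extension (f : R -> X) (U : set R[i]^o) (F : R[i]^o -> X)
  : Prop :=
  [/\ open U, connected U, right_half_plane `<=` U, holomorphic_on U F &
      (forall z, right_half_plane z -> F z = laplace f z)].

Definition C0 (g : R -> X) : Prop :=
  {within Rplus, continuous g} /\ g t @[t --> +oo] --> (0 : X).

End HalfLine.

(* Main.v *)
Require Import Defs.
From HB Require Import structures.
From mathcomp Require Import all_boot all_order all_algebra finmap.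
From mathcomp Require Import all_classical all_reals all_analysis.
From mathcomp Require Import complex measurable_realfun ess_sup_inf.
From mathcomp Require Import ring lra.

Set Implicit Arguments.
Unset Strict Implicit.
Unset Printing Implicit Defensive.
Import Order.TTheory GRing.Theory Num.Theory.
Import numFieldNormedType.Exports.

Local Open Scope classical_set_scope.
Local Open Scope ring_scope.
Local Open Scope complex_scope.

(** Why the theorem holds. Let [F_t (z)] be the integral of [e^(- z s) f (s)] over
    [0 <= s <= t], an entire function of [z] with [g t = F 0 - F_t 0]. Newman's
    contour method evaluates [H z = (F z - F_t z) e^(t z) (1 + z^2 / r^2)] at the
    origin, where it is [g t], through its values on the boundary of a small square
    [|x|, |y| <= r] near which [F] is differentiable. To the right of the imaginary
    axis the norm of [(F - F_t) e^(t z)] is at most the integral over [s > t] of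
    [e^(- x (s - t)) |f (s)|]; to the left, that of [F_t e^(t z)] is at most the
    integral over [s < t] of [e^(- |x| (t - s)) |f (s)|], and [F e^(t z)] is
    [O (e^(- |x| t))]. On the horizontal edges the last factor of [H] is [O (|x|)],
    and the integral of [x e^(- x d)] over [0 <= x <= r] is [O (1 / (1 + d^2))];
    exchanging the two integrations gives [newman_estimate]: with a constant [C]
    that does not depend on [t],

      [|g t| <= C (int_s |f (s)| / (1 + (s - t)^2) ds + 1 / (1 + t^2))].

    The kernel [1 / (1 + d^2)] is bounded, integrable and vanishes at infinity.
    Hence the average on the right is bounded when [f] is; and when [|f|^p] is
    integrable for a finite [p], it is bounded, tends to 0 and has an integrable
    [p]-th power. The last three facts come from one pointwise inequality,
    [y <= e + e (y / e)^p] for [y >= 0] and [e > 0], averaged with a suitable [e]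
    ([fine_average_young]). A bounded function in [L^p] is in [L^r] for [r >= p].

    Vector-valued integrals and Cauchy's theorem are handled by testing with
    real-linear functionals of norm at most 1, of which there is one that attains
    the norm of a given vector ([norming_functional], the Hahn-Banach theorem).
    Such a functional turns the Bochner integral into a Lebesgue integral
    ([bochner_rfun]), and [q (z) dz], for a complex differentiable [q], into a real
    form that satisfies the Cauchy-Riemann equations, to which Goursat's argument
    applies ([goursat], [circulation_punctured]). With the functional that norms
    [i H 0], the difference quotient [q z = (H z - H 0) / z] yields the estimate
    of [H 0] by the boundary values of [H] ([cauchy_estimate]). *)

(** * Norming functionals *)

Section RealNorm.
Context {R : realType} {X : normedModType R[i]}.
Implicit Types x y : X.

Lemma rnormE x : `|x| = (rnorm x)%:C.
Proof. by rewrite /rnorm RRe_real// normr_real. Qed.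

Lemma rnorm_ge0 x : 0 <= rnorm x.
Proof. by rewrite -lecR -rnormE normr_ge0. Qed.

Lemma ler_rnormD x y : rnorm (x + y) <= rnorm x + rnorm y.
Proof. by rewrite -lecR rmorphD /= -!rnormE ler_normD. Qed.

Lemma rnormN x : rnorm (- x) = rnorm x.
Proof. by rewrite /rnorm normrN. Qed.

Lemma ler_rnormB x y : rnorm (x - y) <= rnorm x + rnorm y.
Proof. by rewrite (le_trans (ler_rnormD _ _))// rnormN. Qed.

Lemma rnorm_distC x y : rnorm (x - y) = rnorm (y - x).
Proof. by rewrite -rnormN opprB. Qed.

Lemma rnorm0 : rnorm (0 : X) = 0.
Proof. by rewrite /rnorm normr0. Qed.

Lemma rnorm_eq0 x : rnorm x = 0 -> x = 0.
Proof. by move=> x0; apply: normr0_eq0; rewrite rnormE x0. Qed.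

Lemma rnormZ (c : R[i]) x : rnorm (c *: x) = rnorm (c : R[i]^o) * rnorm x.
Proof.
apply: complexI; rewrite rmorphM /= -!rnormE.
by rewrite normrZ; congr (_ * _); exact: rnormE.
Qed.

Lemma rnormZr (a : R) x : rnorm (a%:C *: x) = `|a| * rnorm x.
Proof. by rewrite rnormZ {1}/rnorm normc_def /= expr0n addr0 sqrtr_sqr. Qed.

End RealNorm.

Section RealFunctional.
Context {R : realType} {X : normedModType R[i]}.
Implicit Types (x y v : X) (u q : X -> R).

Definition real_functional u :=
  [/\ forall x y, u (x + y) = u x + u y,
      forall (a : R) x, u (a%:C *: x) = a * u x &
      forall x, `|u x| <= rnorm x].

Definition sublinear q :=
  [/\ forall x y, q (x + y) <= q x + q y,
      forall (a : R) x, 0 < a -> q (a%:C *: x) <= a * q x &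
      forall x, q x <= rnorm x].

Lemma sublinear0 q : sublinear q -> q 0 = 0.
Proof.
move=> [_ qZ _]; have h := qZ 2 0; have h' := qZ 2^-1 0.
rewrite !scaler0 in h h'.
have := h (ltr0Sn _ 1); have : 0 < 2^-1 :> R by [].
by move=> /h' ? ?; apply/eqP; rewrite eq_le; apply/andP; split; lra.
Qed.

Lemma sublinear_ge q x : sublinear q -> - rnorm x <= q x.
Proof.
move=> sq; have [qD _ qle] := sq; have := qD x (- x).
rewrite subrr (sublinear0 sq); have := qle (- x); rewrite rnormN; lra.
Qed.

Lemma sublinearZ q (a : R) x : sublinear q -> 0 <= a -> q (a%:C *: x) = a * q x.
Proof.
move=> sq; rewrite le_eqVlt => /predU1P[<-|a0].
  by rewrite scale0r mul0r sublinear0.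
have [_ qZ _] := sq; apply/eqP; rewrite eq_le qZ//=.
have a'0 : 0 < a^-1 by rewrite invr_gt0.
have := qZ a^-1 (a%:C *: x) a'0.
rewrite scalerA -rmorphM /= mulVf ?gt_eqF// scale1r => h.
by rewrite -(ler_pM2l a'0) mulrA mulVf ?gt_eqF// mul1r.
Qed.

(** Lower envelopes of families that are, up to decrease, closed under sums and
    dilations are sublinear; this covers both infima of chains and the
    one-dimensional modification used against a minimal element. *)
Lemma sublinear_inf (I : Type) (A : set I) (a : I -> X -> R) :
    A !=set0 ->
    (forall i x, A i -> - rnorm x <= a i x) ->
    (forall i j x y, A i -> A j ->
      exists2 k, A k & a k (x + y) <= a i x + a j y) ->
    (forall i (c : R) x, A i -> 0 < c ->
      exists2 k, A k & a k (c%:C *: x) <= c * a i x) ->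
    (exists2 i, A i & forall x, a i x <= rnorm x) ->
  let m x := inf [set a i x | i in A] in
  sublinear m /\ forall i x, A i -> m x <= a i x.
Proof.
move=> [i0 Ai0] alow aD aZ [i1 Ai1 ale] m.
have mle i x : A i -> m x <= a i x.
  move=> Ai; apply: ge_inf; last by exists i.
  by exists (- rnorm x) => _ [j Aj <-]; exact: alow.
have minf x : has_inf [set a i x | i in A].
  split; first by exists (a i0 x), i0.
  by exists (- rnorm x) => _ [j Aj <-]; exact: alow.
split=> //; split.
- move=> x y; rewrite -lerBlDr; apply: lb_le_inf; first by exists (a i0 x), i0.
  move=> _ [i Ai <-]; rewrite lerBlDr -lerBlDl.
  apply: lb_le_inf; first by exists (a i0 y), i0.
  move=> _ [j Aj <-]; rewrite lerBlDl.
  by have [k Ak] := aD i j x y Ai Aj; apply: le_trans; exact: mle.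
- move=> c x c0; rewrite -ler_pdivrMl//.
  apply: lb_le_inf; first by exists (a i0 x), i0.
  move=> _ [i Ai <-]; rewrite ler_pdivrMl//.
  by have [k Ak] := aZ i c x Ai c0; apply: le_trans; exact: mle.
- by move=> x; rewrite (le_trans _ (ale x))// mle.
Qed.

(** Replacing [q x] by the infimum of [q (x + t y) - t q y] over [t >= 0] makes
    [q] additive in the direction [y] as soon as nothing has decreased. *)
Lemma sublinear_lower q y : sublinear q ->
  exists q', [/\ sublinear q', forall x, q' x <= q x &
                 forall x, q' x <= q (x + y) - q y].
Proof.
move=> sq; have [qD qZ qle] := sq.
pose a (t : R) x := q (x + t%:C *: y) - t * q y.
have [| | | | |sm mle] := @sublinear_inf R [set t | 0 <= t] a.
- by exists 0 => /=.
- move=> t x /= t0; rewrite /a lerBrDr -(sublinearZ _ sq t0).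
  have := qD (x + t%:C *: y) (- x); rewrite addrAC subrr add0r.
  have := qle (- x); rewrite rnormN; lra.
- move=> s t x z /= s0 t0; exists (s + t); first exact: addr_ge0.
  rewrite /a rmorphD /= scalerDl addrACA.
  have := qD (x + s%:C *: y) (z + t%:C *: y); lra.
- move=> t c x /= t0 c0; exists (c * t); first by rewrite mulr_ge0// ltW.
  rewrite /a rmorphM /= -scalerA -scalerDr.
  have := qZ c (x + t%:C *: y) c0; lra.
- by exists 0 => //= x; rewrite /a scale0r addr0 mul0r subr0.
exists (fun x => inf [set a t x | t in [set t | 0 <= t]]); split=> // x.
- by apply: le_trans (mle 0 x _) _ => //=; rewrite /a scale0r addr0 mul0r subr0.
- by apply: le_trans (mle 1 x _) _ => //=; rewrite /a scale1r mul1r.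
Qed.

(** A minimal sublinear functional is additive, by minimality against
    [sublinear_lower]. Below [rnorm] itself one first passes to a functional
    whose value at [- v] is [- rnorm v]; minimization can only keep this. *)
Theorem norming_functional v :
  exists2 u, real_functional u & u v = rnorm v.
Proof.
have sn : sublinear (@rnorm R X).
  split=> [x y|a x a0|x]; [exact: ler_rnormD| |exact: lexx].
  by rewrite rnormZr gtr0_norm.
have [p0 [sp0 p0le p0v]] := sublinear_lower v sn.
pose T := {q : X -> R | sublinear q /\ forall x, q x <= p0 x}.
pose r (s t : T) := `[< forall x, sval t x <= sval s x >].
have [||A Atot|[q [sq qle]] qmin] := @ZL_preorder T (exist _ p0 (conj sp0 (fun=> lexx _))) r.
- by move=> t; apply/asboolP.
- move=> s t w /asboolP st /asboolP tw; apply/asboolP => x.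
  exact: le_trans (tw x) (st x).
- have [A0|/set0P[t0 At0]] := eqVneq A set0.
    by exists (exist _ p0 (conj sp0 (fun=> lexx _))) => s; rewrite A0.
  have [| | | | |sm mle] := @sublinear_inf T A (fun t => sval t).
  + by exists t0.
  + by move=> [q [sq ?]] x _ /=; exact: sublinear_ge.
  + move=> s t x y As At; have [/asboolP st|/asboolP ts] := Atot s t As At.
    * exists t => //; case: t st {At} => q [[qD _ _] _] /= st.
      by rewrite (le_trans (qD _ _))// lerD2r.
    * exists s => //; case: s ts {As} => q [[qD _ _] _] /= ts.
      by rewrite (le_trans (qD _ _))// lerD2l.
  + move=> t c x At c0; exists t => //; case: t {At} => q [[_ qZ _] _] /=.
    exact: qZ.
  + by exists t0 => // x; case: t0 {At0} => q [[_ _ ?] _] /=.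
  set m := (fun x => inf _) in sm mle.
  have mp0 x : m x <= p0 x.
    apply: le_trans (mle t0 x At0) _.
    by case: t0 {At0} => q [? ?] /=.
  exists (exist _ m (conj sm mp0)) => s As; apply/asboolP => x /=.
  exact: mle.
have [qD qZ qn] := sq.
have qA x y : q (x + y) = q x + q y.
  have [q' [sq' q'le q'D]] := sublinear_lower y sq.
  have q'p0 z : q' z <= p0 z by exact: le_trans (q'le z) (qle z).
  have /asboolP/(_ x)/= := qmin (exist _ q' (conj sq' q'p0)) ltac:(exact/asboolP).
  have := q'D x; have := qD x y; lra.
have qN x : q (- x) = - q x.
  by have := qA x (- x); rewrite subrr (sublinear0 sq); lra.
have ql x : `|q x| <= rnorm x.
  by rewrite ler_norml (sublinear_ge _ sq)//=.
exists q; [split=> // a x | apply/eqP; rewrite eq_le qn /=].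
  have [a0|/ltW a0] := leP 0 a; first exact: sublinearZ.
  have := @sublinearZ q (- a) x sq; rewrite oppr_ge0 => /(_ a0).
  by rewrite rmorphN scaleNr qN; lra.
have := qle (- v); have := p0v (- v); rewrite addNr rnorm0 qN; lra.
Qed.

End RealFunctional.

(** * Simple functions and their integrals *)

Section FiniteValued.
Context {d : measure_display} {T : measurableType d} {R : realType}.
Variables (mu : {measure set T -> \bar R}) (D : set T).

Definition fin_valued (Y : choiceType) (s : T -> Y) :=
  finite_set (s @` D) /\ forall y, measurable (D `&` s @^-1` [set y]).

Lemma fin_valued_pair (Y Z : choiceType) (s : T -> Y) (r : T -> Z) :
  fin_valued s -> fin_valued r -> fin_valued (fun t => (s t, r t)).
Proof.
move=> [fs ms] [fr mr]; split.
  apply: (@sub_finite_set _ _ ((s @` D) `*` (r @` D))).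
    by move=> _ [t Dt <-]; split; exists t.
  exact: finite_setX.
move=> [y z]; rewrite (_ : _ `&` _ =
    (D `&` s @^-1` [set y]) `&` (D `&` r @^-1` [set z])).
  exact: measurableI.
apply/seteqP; split=> [t [Dt [/= -> ->]]//|t [[Dt /= ->] [_ /= ->]]//].
Qed.

Lemma fin_valued_comp (Y Z : choiceType) (s : T -> Y) (k : Y -> Z) :
  fin_valued s -> fin_valued (k \o s).
Proof.
move=> [fs ms]; split; first by rewrite -image_comp; exact: finite_image.
move=> z; rewrite (_ : _ `&` _ =
    \bigcup_(y in s @` D `&` k @^-1` [set z]) (D `&` s @^-1` [set y])).
  apply: fin_bigcup_measurable; first exact: finite_setIl.
  by move=> y _; exact: ms.
apply/seteqP; split=> [t [Dt /= kt]|t [y [_ /= ky] [Dt /= sy]]].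
  by exists (s t) => //; split=> //; exists t.
by split=> //=; rewrite sy.
Qed.

Lemma fin_valued_measurable (s : T -> R) : fin_valued s -> measurable_fun D s.
Proof.
move=> [fs ms] mD B mB; rewrite (_ : _ `&` _ =
    \bigcup_(y in s @` D `&` B) (D `&` s @^-1` [set y])).
  apply: fin_bigcup_measurable; first exact: finite_setIl.
  by move=> y _; exact: ms.
apply/seteqP; split=> [t [Dt /= Bt]|t [y [_ By] [Dt /= sy]]].
  by exists (s t) => //; split=> //; exists t.
by split=> //=; rewrite sy.
Qed.

End FiniteValued.

Section Simple.
Context {d : measure_display} {T : measurableType d} {R : realType}
  {X : normedModType R[i]}.
Variables (mu : {measure set T -> \bar R}).
Implicit Types (D : set T) (s : T -> X).

Lemma simple_fin_valued D s : simple_on mu D s -> fin_valued D s.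
Proof. by case. Qed.

Lemma simple_support D s : measurable D -> simple_on mu D s ->
  (mu (D `&` [set t | (s t != 0)%R]) < +oo)%E.
Proof.
move=> mD ss; have [fs ms fin] := ss.
pose F x := if x == 0 then set0 else D `&` s @^-1` [set x].
have mF x : measurable (F x) by rewrite /F; case: ifP.
have mA : measurable (D `&` [set t | s t != 0]).
  rewrite (_ : _ `&` _ = D `&` (fun t => s t != 0) @^-1` [set true])//.
  by have [] := fin_valued_comp (fun x => x != 0) (simple_fin_valued ss).
apply: (le_lt_trans (content_sub_fsum mu fs (fun x _ => mF x) mA _)) => //.
  move=> t [Dt /= st]; exists (s t); first by exists t.
  by rewrite /F (negbTE st).
rewrite fsbig_finite//=; apply: lte_sum_pinfty => x _.
by rewrite /F; case: eqP => [_|/eqP/fin//]; rewrite measure0 ltry.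
Qed.

Lemma fin_valued_simple D s : measurable D -> fin_valued D s ->
  (mu (D `&` [set t | (s t != 0)%R]) < +oo)%E -> simple_on mu D s.
Proof.
move=> mD [fs ms] fin; split=> // x x0.
apply: le_lt_trans fin; apply: le_measure; rewrite ?inE//; last first.
  by move=> t [Dt /= ->].
rewrite (_ : _ `&` _ = D `&` (fun t => s t != 0) @^-1` [set true])//.
by have [] := @fin_valued_comp _ _ D _ _ s (fun x => x != 0) (conj fs ms).
Qed.

Lemma simple_restrict D E s : measurable E -> E `<=` D -> measurable D ->
  simple_on mu D s -> simple_on mu E s.
Proof.
move=> mE ED mD [fs ms fin].
have EE x : E `&` s @^-1` [set x] = E `&` (D `&` s @^-1` [set x]).
  by rewrite setIA (setIidl ED).
split; first by apply: sub_finite_set fs; exact: image_subset.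
  by move=> x; rewrite EE; exact: measurableI.
move=> x /fin; apply: le_lt_trans; apply: le_measure; rewrite ?inE//.
  by rewrite EE; exact: measurableI.
by apply: setSI.
Qed.

(** The support can only shrink when [k y 0 = 0], and finiteness of its measure is
    the only condition that a finitely valued function may fail. *)
Lemma simple_image D s (Y : choiceType) (r : T -> Y) (k : Y -> X -> X) :
  measurable D -> simple_on mu D s -> fin_valued D r -> (forall y, k y 0 = 0) ->
  simple_on mu D (fun t => k (r t) (s t)).
Proof.
move=> mD ss fr k0; have fk : fin_valued D (fun t => k (r t) (s t)).
  exact: (@fin_valued_comp _ _ D _ _ _ (fun p => k p.1 p.2)
    (fin_valued_pair fr (simple_fin_valued ss))).
apply: fin_valued_simple => //; apply: le_lt_trans (simple_support mD ss).
have m (Y' : normedModType R[i]) (r' : T -> Y') : fin_valued D r' ->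
    measurable (D `&` [set t | r' t != 0]).
  move=> fr'; rewrite (_ : _ `&` _ = D `&` (fun t => r' t != 0) @^-1` [set true])//.
  by have [] := @fin_valued_comp _ _ D _ _ r' (fun x => x != 0) fr'.
apply: le_measure; rewrite ?inE//; first exact: m.
  by apply: m; exact: simple_fin_valued.
move=> t [Dt /= kt]; split=> //=; apply: contraNneq kt => ->; exact/eqP.
Qed.

Lemma integrable_indic_lty D A : measurable D -> measurable A ->
  (mu (A `&` D) < +oo)%E -> mu.-integrable D (fun t => (\1_A t)%:E).
Proof.
move=> mD mA fA; apply/integrableP; split; first exact/measurable_EFinP.
rewrite (eq_integral (fun t => (\1_A t)%:E)) ?integral_indic// => t _.
by rewrite gee0_abs// lee_fin.
Qed.

Lemma integral_simple D s (k : X -> R) : measurable D -> simple_on mu D s ->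
    k 0 = 0 ->
  mu.-integrable D (EFin \o (k \o s)) /\
  \int[mu]_(t in D) k (s t) =
    \sum_(x \in s @` D) fine (mu (D `&` s @^-1` [set x])) * k x.
Proof.
move=> mD ss k0; have [fs ms fin] := ss.
pose A x := D `&` s @^-1` [set x].
have mA x : measurable (A x) by exact: ms.
pose g x t := ((k x)%:E * (\1_(A x) t)%:E)%E.
have ig x : mu.-integrable D (g x).
  have [->|x0] := eqVneq x 0.
    by rewrite (_ : g 0 = cst 0%E) ?integrable0//; apply/funext=> t; rewrite /g k0 mul0e.
  rewrite /g; apply: integrableZl => //; apply: integrable_indic_lty => //.
  by rewrite (setIidl _)//; [exact: fin|move=> t []].
have gE t : D t -> (k (s t))%:E = (\sum_(x <- fset_set (s @` D)) g x t)%E.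
  move=> Dt; have sD : s t \in fset_set (s @` D).
    by rewrite in_fset_set// inE; exists t.
  rewrite (big_fsetD1 (s t))//= big_seq big1 => [|x]; last first.
    rewrite !inE => /andP[xs _]; rewrite /g indicE memNset ?mule0//.
    by move=> [_ /= /esym /eqP]; apply/negP.
  by rewrite adde0 /g indicE mem_set ?mule1.
have gE' : {in D, EFin \o (k \o s) =1 fun t => (\sum_(x <- fset_set (s @` D)) g x t)%E}.
  by move=> t; rewrite inE => /gE.
split.
  apply: (eq_integrable mD (fun t => (\sum_(x <- fset_set (s @` D)) g x t)%E)).
    by move=> t /gE' ->.
  exact: integrable_sum.
rewrite /Rintegral (eq_integral _ _ gE') integral_sum//.
rewrite fsbig_finite//= -sum_fine//; last by move=> x _; exact: integrable_fin_num.
apply: eq_bigr => x _; rewrite /g.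
have [->|x0] := eqVneq x 0.
  under eq_integral do rewrite k0 mul0e.
  by rewrite integral0 k0 mulr0.
rewrite integralZl//; last first.
  apply: integrable_indic_lty => //.
  by rewrite (setIidl _)//; [exact: fin|move=> t []].
rewrite integral_indic// (setIidl _); last by move=> t [].
rewrite fineM// 1?mulrC// ge0_fin_numE//; exact: fin.
Qed.

End Simple.

(** * Limits of simple functions *)

Section RealFunctionalTheory.
Context {R : realType} {X : normedModType R[i]}.
Implicit Types (x y v : X) (u : X -> R).

Lemma rfunD u x y : real_functional u -> u (x + y) = u x + u y.
Proof. by case. Qed.

Lemma rfunZ u (a : R) x : real_functional u -> u (a%:C *: x) = a * u x.
Proof. by case. Qed.

Lemma rfun_le u x : real_functional u -> `|u x| <= rnorm x.
Proof. by case. Qed.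

Lemma rfun0 u : real_functional u -> u 0 = 0.
Proof. by move=> hu; have := rfunZ 0 0 hu; rewrite scale0r mul0r. Qed.

Lemma rfunN u x : real_functional u -> u (- x) = - u x.
Proof.
by move=> hu; have := rfunZ (-1) x hu; rewrite rmorphN scaleN1r mulN1r.
Qed.

Lemma rfunB u x y : real_functional u -> u (x - y) = u x - u y.
Proof. by move=> hu; rewrite rfunD// rfunN. Qed.

Lemma rfun_sum u (I : Type) (r : seq I) (F : I -> X) : real_functional u ->
  u (\sum_(i <- r) F i) = \sum_(i <- r) u (F i).
Proof.
move=> hu; elim: r => [|i r ih]; first by rewrite !big_nil rfun0.
by rewrite !big_cons rfunD// ih.
Qed.

Lemma rnorm_le_rfun x (c : R) : (forall u, real_functional u -> u x <= c) ->
  rnorm x <= c.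
Proof. by move=> h; have [u hu <-] := norming_functional x; exact: h. Qed.

Lemma rfun_sep x y : (forall u, real_functional u -> u x = u y) -> x = y.
Proof.
move=> h; apply/eqP; rewrite -subr_eq0; apply/eqP/rnorm_eq0/eqP.
rewrite eq_le rnorm_ge0 andbT; apply: rnorm_le_rfun => u hu.
by rewrite rfunB// h// subrr.
Qed.

Lemma cvg_rnormP (I : Type) (F : set_system I) (FF : Filter F) (f : I -> X) x :
  f i @[i --> F] --> x <->
  forall e : R, 0 < e -> \forall i \near F, rnorm (x - f i) < e.
Proof.
split=> [/cvgrPdist_lt h e e0|h].
  have : 0 < e%:C by rewrite ltcR.
  by move=> /h; apply: filterS => i; rewrite rnormE ltcR.
apply/cvgrPdist_lt => e; rewrite ltcE /= => /andP[/eqP e0 eR].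
have := h _ eR; apply: filterS => i; rewrite rnormE ltcE /=.
by rewrite e0 eqxx.
Qed.

Lemma cvg_rfun (I : Type) (F : set_system I) (FF : Filter F) (f : I -> X) x u :
  real_functional u -> f i @[i --> F] --> x -> u (f i) @[i --> F] --> u x.
Proof.
move=> hu /cvg_rnormP h; apply/cvgrPdist_lt => e /h; apply: filterS => i.
by rewrite -rfunB//; apply: le_lt_trans; exact: rfun_le.
Qed.

Lemma cvg_rnorm (I : Type) (F : set_system I) (FF : Filter F) (f : I -> X) x :
  f i @[i --> F] --> x -> rnorm (f i) @[i --> F] --> rnorm x.
Proof.
move=> /cvg_rnormP h; apply/cvgrPdist_lt => e /h; apply: filterS => i.
apply: le_lt_trans; rewrite ler_norml; apply/andP; split.
  by rewrite lerNl opprB lerBlDr rnorm_distC (le_trans _ (ler_rnormD _ _))// subrK.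
by rewrite lerBlDr (le_trans _ (ler_rnormD _ _))// subrK.
Qed.

End RealFunctionalTheory.

Section BochnerTheory.
Context {d : measure_display} {T : measurableType d} {R : realType}
  {X : normedModType R[i]}.
Variables (mu : {measure set T -> \bar R}).
Implicit Types (D N : set T) (f h : T -> X) (s : T -> X) (u : X -> R).

(** Limits at every point of [D]: a function that is such a limit only almost
    everywhere need not have a measurable norm. *)
Definition simple_limit D h := exists s : nat -> T -> X,
  (forall n, simple_on mu D (s n)) /\
  forall t, D t -> s n t @[n --> \oo] --> h t.

Lemma simple_measurable D s (k : X -> R) :
  simple_on mu D s -> measurable_fun D (k \o s).
Proof.
by move=> /simple_fin_valued/(fin_valued_comp k)/fin_valued_measurable.
Qed.

Lemma simple_limit_dist_measurable D h s : simple_limit D h ->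
  simple_on mu D s -> measurable_fun D (fun t => rnorm (h t - s t)).
Proof.
move=> [s_ [ss sh]] hs.
apply: (@measurable_fun_cvg _ _ _ D (fun n t => rnorm (s_ n t - s t))) => [n|t Dt].
  apply: fin_valued_measurable.
  exact: (@fin_valued_comp _ _ D _ _ _ (fun p => rnorm (p.1 - p.2))
    (fin_valued_pair (simple_fin_valued (ss n)) (simple_fin_valued hs))).
by apply: cvg_rnorm; apply: cvgB; [exact: sh|exact: cvg_cst].
Qed.

Lemma simple_dist_measurable D s r : simple_on mu D s -> simple_on mu D r ->
  measurable_fun D (fun t => rnorm (s t - r t)).
Proof.
move=> hs hr; apply: simple_limit_dist_measurable hr; exists (fun=> s).
by split=> // t _; exact: cvg_cst.
Qed.

Lemma simple_limit_rnorm D h : simple_limit D h ->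
  measurable_fun D (fun t => rnorm (h t)).
Proof.
move=> [s_ [ss sh]].
apply: (@measurable_fun_cvg _ _ _ D (fun n t => rnorm (s_ n t))) => [n|t Dt].
  exact: simple_measurable.
by apply: cvg_rnorm; exact: sh.
Qed.

Lemma simple_limit_rfun D h u : simple_limit D h -> real_functional u ->
  measurable_fun D (u \o h).
Proof.
move=> [s_ [ss sh]] hu.
apply: (@measurable_fun_cvg _ _ _ D (fun n t => u (s_ n t))) => [n|t Dt].
  exact: (simple_measurable u).
by apply: cvg_rfun => //; exact: sh.
Qed.

Lemma simple_limit_restrict D E h : measurable D -> measurable E -> E `<=` D ->
  simple_limit D h -> simple_limit E h.
Proof.
move=> mD mE ED [s [ss sh]]; exists s; split=> [n|t /ED]; last exact: sh.
exact: simple_restrict (ss n).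
Qed.

Lemma rfun_simple_integral D s u : measurable D -> simple_on mu D s ->
  real_functional u -> u (simple_integral mu D s) = \int[mu]_(t in D) u (s t).
Proof.
move=> mD ss hu; have [_ ->] := integral_simple mD ss (rfun0 hu).
have [fs _ _] := ss; rewrite /simple_integral !fsbig_finite//= rfun_sum//.
by apply: eq_bigr => x _; rewrite rfunZ.
Qed.

(** Testing the difference of the integrals with a norming functional leaves an
    inequality between real integrals. *)
Lemma simple_integral_dist D s r : measurable D ->
  simple_on mu D s -> simple_on mu D r ->
  ((rnorm (simple_integral mu D s - simple_integral mu D r))%:E <=
   \int[mu]_(t in D) (rnorm (s t - r t))%:E)%E.
Proof.
move=> mD hs hr; set v := _ - _; have [u hu <-] := norming_functional v.
have [is_ _] := integral_simple mD hs (rfun0 hu).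
have [ir _] := integral_simple mD hr (rfun0 hu).
rewrite /v rfunB// !rfun_simple_integral// -RintegralB//.
rewrite /Rintegral fineK; last first.
  exact: integrable_fin_num (integrableB mD is_ ir).
apply: (@le_trans _ _ (\int[mu]_(t in D) `|(u (s t) - u (r t))%:E|)%E).
  apply: le_trans (le_abse_integral mu mD _); first exact: lee_abs.
  by have /measurable_int := integrableB mD is_ ir.
apply: ge0_le_integral => //.
- by apply: measurableT_comp => //; have /measurable_int := integrableB mD is_ ir.
- by apply/measurable_EFinP; exact: simple_dist_measurable.
- by move=> t _; rewrite lee_fin -rfunB// rfun_le.
Qed.

End BochnerTheory.

(** * Bochner integrals tested by real functionals *)

Section BochnerExistence.
Context {d : measure_display} {T : measurableType d} {R : realType}
  {X : completeNormedModType R[i]}.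
Variables (mu : {measure set T -> \bar R}).
Implicit Types (D N : set T) (f h : T -> X) (s : T -> X) (u : X -> R).

Import HBNNSimple.

(** The integral of a nonmeasurable function is a supremum over the simple
    functions below it, and cutting those off on a null set costs nothing. *)
Lemma ge0_le_integral_off_null D N (F G : T -> \bar R) :
    measurable N -> mu N = 0%E ->
    (forall t, 0 <= F t)%E -> (forall t, 0 <= G t)%E ->
    (forall t, D t -> ~ N t -> (F t <= G t)%E) ->
  (\int[mu]_(t in D) F t <= \int[mu]_(t in D) G t)%E.
Proof.
move=> mN N0 F0 G0 FG; rewrite integral_mkcond [leRHS]integral_mkcond.
have pF t : (0 <= (F \_ D) t)%E by rewrite /patch; case: ifP.
have pG t : (0 <= (G \_ D) t)%E by rewrite /patch; case: ifP.
rewrite ge0_integralTE// ge0_integralTE//; apply: ge_ereal_sup => _ [k kF <-].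
have mCN : measurable (~` N) by exact: measurableC.
pose k' := mul_nnsfun k (indic_nnsfun R mCN).
have intE (q : {nnsfun T >-> R}) : sintegral mu q = (\int[mu]_t (q t)%:E)%E.
  by rewrite integral_nnsfun// patch_setT.
apply: (@le_trans _ _ (sintegral mu k')).
  rewrite !intE (ge0_ae_eq_integral (g := fun t => (k' t)%:E))//.
  - by apply/measurable_EFinP.
  - by apply/measurable_EFinP.
  - by move=> t _; rewrite lee_fin.
  - by move=> t _; rewrite lee_fin.
  exists N; split=> // t /= kt; apply: contrapT => Nt; apply: kt => _.
  by rewrite /k' /= mindicE mem_set// mulr1.
apply: ereal_sup_ubound; exists k' => //= t.
rewrite /k' /= mindicE; have [Nt|Nt] := pselect (N t).
  by rewrite memNset//= mulr0; exact: pG.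
rewrite mem_set// mulr1; apply: (le_trans (kF t)).
by rewrite /patch; case: ifP => // /set_mem Dt; exact: FG.
Qed.

Lemma ge0_eq_integral_off_null D N (F G : T -> \bar R) :
    measurable N -> mu N = 0%E ->
    (forall t, 0 <= F t)%E -> (forall t, 0 <= G t)%E ->
    (forall t, D t -> ~ N t -> F t = G t) ->
  (\int[mu]_(t in D) F t = \int[mu]_(t in D) G t)%E.
Proof.
move=> mN N0 F0 G0 FG; apply/eqP; rewrite eq_le.
by apply/andP; split; apply: (ge0_le_integral_off_null mN) => // t Dt Nt;
  rewrite FG.
Qed.

(** Both sides are limits of the integrals of the same approximating simple
    functions, on which a functional and the integral commute. *)
Lemma is_bochner_rfun D N f h v u :
    measurable D -> measurable N -> mu N = 0%E ->
    (forall t, D t -> ~ N t -> f t = h t) -> simple_limit mu D h ->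
    mu.-integrable D (fun t => (rnorm (h t))%:E) ->
    is_bochner mu D f v -> real_functional u ->
  u v = \int[mu]_(t in D) u (h t).
Proof.
move=> mD mN N0 fh hl ih [s [ss _ i0 iv]] hu.
have iu : mu.-integrable D (EFin \o (fun t => u (h t))).
  apply: le_integrable ih => //.
    by apply/measurable_EFinP; exact: (simple_limit_rfun hl hu).
  by move=> t _ /=; rewrite lee_fin (ger0_norm (rnorm_ge0 _)) rfun_le.
have is_ n : mu.-integrable D (EFin \o (fun t => u (s n t))).
  by have [] := integral_simple mD (ss n) (rfun0 hu).
have dist n : (`| (\int[mu]_(t in D) u (h t) - u (simple_integral mu D (s n)))%:E | <=
    \int[mu]_(t in D) (rnorm (f t - s n t))%:E)%E.
  rewrite (ge0_eq_integral_off_null mN N0 (F := fun t => (rnorm (f t - s n t))%:E)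
    (G := fun t => (rnorm (h t - s n t))%:E)); last 3 first.
    - by move=> t; rewrite lee_fin rnorm_ge0.
    - by move=> t; rewrite lee_fin rnorm_ge0.
    - by move=> t Dt Nt; rewrite fh.
  rewrite rfun_simple_integral// -RintegralB//.
  have iB := integrableB mD iu (is_ n).
  rewrite /Rintegral fineK; last exact: integrable_fin_num iB.
  apply: (@le_trans _ _ (\int[mu]_(t in D) `|(u (h t) - u (s n t))%:E|)%E).
    by apply: le_abse_integral => //; have /measurable_int := iB.
  apply: ge0_le_integral => //.
  - by apply: measurableT_comp => //; have /measurable_int := iB.
  - by apply/measurable_EFinP; exact: (simple_limit_dist_measurable hl (ss n)).
  - by move=> t _; rewrite lee_fin -rfunB// rfun_le.
have uv : u (simple_integral mu D (s n)) @[n --> \oo] --> u v by exact: cvg_rfun.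
apply: (cvg_unique _ uv); first exact: Rhausdorff.
apply/cvgrPdist_lt => e e0.
have /fine_cvgP[] : (\int[mu]_(t in D) (rnorm (f t - s n t))%:E)%E @[n --> \oo] --> 0%:E by [].
move=> Fi /cvgrPdist_lt/(_ _ e0); apply: filterS2 Fi => n fin.
rewrite sub0r normrN; apply: le_lt_trans.
rewrite -lee_fin; apply: le_trans (dist n) _.
by rewrite -[leLHS]fineK// lee_fin ler_norm.
Qed.

(** Truncated approximating simple functions converge to [h] in mean by dominated
    convergence, so that [simple_integral_dist] makes their integrals a Cauchy
    sequence. *)
Lemma is_bochner_ex D N f h :
    measurable D -> measurable N -> mu N = 0%E ->
    (forall t, D t -> ~ N t -> f t = h t) -> simple_limit mu D h ->
    mu.-integrable D (fun t => (rnorm (h t))%:E) ->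
  exists v, is_bochner mu D f v.
Proof.
move=> mD mN N0 fh hl ih; have [s [ss sh]] := hl.
(* dropping the values of norm above twice that of the limit, so that the
   distances to the limit are dominated by 3 times the norm of [h] *)
pose b n t := rnorm (s n t) <= 2 * rnorm (h t).
pose r n t := if b n t then s n t else 0.
have mb n : measurable_fun D (b n).
  apply: measurable_fun_ler; first exact: (simple_measurable (@rnorm R X) (ss n)).
  apply: measurable_funM; first exact: measurable_cst.
  exact: (simple_limit_rnorm hl).
have rs n : simple_on mu D (r n).
  apply: (@simple_image _ _ _ _ _ D (s n) _ (b n) (fun b x => if b then x else 0)) => //.
    by split=> [|c]; [exact: finite_finset|exact: mb].
  by move=> c; exact: if_same.
have rh t : D t -> r n t @[n --> \oo] --> h t.
  move=> Dt; have st := sh t Dt; have [h0|h0] := eqVneq (h t) 0.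
    apply/cvg_rnormP => e /((cvg_rnormP _ _ _).1 st); apply: filterS => n.
    rewrite /r /b h0 rnorm0 mulr0 !sub0r !rnormN; case: ifP => //.
    by move=> _ /(le_lt_trans (rnorm_ge0 _)); rewrite rnorm0.
  have hp : 0 < rnorm (h t).
    rewrite lt0r rnorm_ge0 andbT; apply: contra_neq h0; exact: rnorm_eq0.
  apply: cvg_trans st; apply: near_eq_cvg.
  near=> n; have : rnorm (h t - s n t) < rnorm (h t).
    by near: n; exact: ((cvg_rnormP _ _ _).1 (sh t Dt) _ hp).
  rewrite rnorm_distC => hn; rewrite /r ifT// /b.
  rewrite -[s n t](subrK (h t)) (le_trans (ler_rnormD _ _))// mulr_natl mulr2n.
  by rewrite lerD2r ltW.
have rl n t : rnorm (h t - r n t) <= 3 * rnorm (h t).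
  have : rnorm (r n t) <= 2 * rnorm (h t).
    rewrite /r; case: ifPn => // _.
    by rewrite rnorm0 mulr_ge0// rnorm_ge0.
  by have := ler_rnormB (h t) (r n t); lra.
have i3 : mu.-integrable D (fun t => (3 * rnorm (h t))%:E).
  exact: (integrableZl mD 3 ih).
have [| | | | |_ _ lim_int] := @dominated_convergence _ _ _ mu D mD
  (fun n t => (rnorm (h t - r n t))%:E) (cst 0%E)
  (fun t => (3 * rnorm (h t))%:E).
- move=> n; apply/measurable_EFinP.
  by exact: (simple_limit_dist_measurable hl (rs n)).
- exact: measurable_cst.
- apply/aeW => t Dt; apply: cvg_EFin; first by near=> n.
  rewrite -(@rnorm0 _ X) -(subrr (h t)); apply: cvg_rnorm.
  by apply: cvgB; [exact: cvg_cst|exact: rh].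
- exact: i3.
- apply/aeW => t n Dt; rewrite gee0_abs ?lee_fin ?rnorm_ge0//.
have lim0 : (\int[mu]_(t in D) (rnorm (h t - r n t))%:E)%E @[n --> \oo] --> 0%E.
  by move: lim_int; rewrite integral0.
have cau : cvg (simple_integral mu D (r n) @[n --> \oo]).
  apply: cauchy_cvg; apply: cauchy_exP => e; rewrite ltcE /= => /andP[/eqP e0 eR].
  have /fine_cvgP[] : (\int[mu]_(t in D) (rnorm (h t - r n t))%:E)%E @[n --> \oo] --> 0%:E by [].
  have e2 : 0 < complex.Re e / 2 by rewrite divr_gt0.
  move=> Fi /cvgrPdist_lt/(_ _ e2) Fe.
  have [n0 _ Hn] : \forall n \near \oo, (\int[mu]_(t in D) (rnorm (h t - r n t))%:E < (complex.Re e / 2)%:E)%E.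
    apply: filterS2 Fi Fe => n fin; rewrite sub0r normrN => le.
    by rewrite -[ltLHS]fineK// lte_fin; apply: le_lt_trans le; exact: ler_norm.
  exists (simple_integral mu D (r n0)); exists n0 => // n n0n.
  rewrite -ball_normE /ball_ /= rnormE ltcE /= e0 eqxx /=.
  rewrite -lte_fin; apply: le_lt_trans (simple_integral_dist mD (rs n0) (rs n)) _.
  apply: (@le_lt_trans _ _ (\int[mu]_(t in D) ((rnorm (h t - r n0 t))%:E + (rnorm (h t - r n t))%:E))%E).
    apply: ge0_le_integral => //.
    - by move=> t _; rewrite lee_fin rnorm_ge0.
    - by apply/measurable_EFinP; exact: (simple_dist_measurable (rs n0) (rs n)).
    - by apply: emeasurable_funD; apply/measurable_EFinP; exact: (simple_limit_dist_measurable hl (rs _)).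
    - move=> t _; rewrite -EFinD lee_fin (rnorm_distC (h t) (r n0 t)).
      by rewrite (le_trans _ (ler_rnormD _ _))// subrKA.
  rewrite ge0_integralD//; last 4 first.
  - by move=> t _; rewrite lee_fin rnorm_ge0.
  - by apply/measurable_EFinP; exact: (simple_limit_dist_measurable hl (rs _)).
  - by move=> t _; rewrite lee_fin rnorm_ge0.
  - by apply/measurable_EFinP; exact: (simple_limit_dist_measurable hl (rs _)).
  rewrite [complex.Re e]splitr EFinD; apply: lteD; apply: Hn => //=.
exists (lim (simple_integral mu D (r n) @[n --> \oo])).
exists r; split=> //.
  exists N; split=> // t /= /not_implyP[Dt rt]; apply: contrapT => Nt; apply: rt.
  by rewrite fh//; exact: rh.
rewrite (_ : (fun n => _) = (fun n => (\int[mu]_(t in D) (rnorm (h t - r n t))%:E)%E))//.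
apply/funext => n; apply: (ge0_eq_integral_off_null mN N0).
- by move=> t; rewrite lee_fin rnorm_ge0.
- by move=> t; rewrite lee_fin rnorm_ge0.
- by move=> t Dt Nt; rewrite fh.
Unshelve. all: end_near. Qed.

(** Since real functionals separate points, this formula is all that is used of
    Bochner integrals from here on. *)
Lemma bochner_rfun D N f h u :
    measurable D -> measurable N -> mu N = 0%E ->
    (forall t, D t -> ~ N t -> f t = h t) -> simple_limit mu D h ->
    mu.-integrable D (fun t => (rnorm (h t))%:E) -> real_functional u ->
  u (bochner mu D f) = \int[mu]_(t in D) u (h t).
Proof.
move=> mD mN N0 fh hl ih hu.
have [v hv] := is_bochner_ex mD mN N0 fh hl ih.
apply: (is_bochner_rfun mD mN N0 fh hl ih _ hu).
exact: (xgetPex 0 (ex_intro _ v hv)).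
Qed.

End BochnerExistence.

(** * Strong measurability on the half-line *)

Section StrongMeasurability.
Context {R : realType} {X : normedModType R[i]}.
Local Notation mu := (@lebesgue_measure R).
Implicit Types (f h g : R -> X).

Lemma measurable_Rplus : measurable (@Rplus R).
Proof. exact: measurable_itv. Qed.

Lemma Rplus_ge0 (t : R) : Rplus t = (0 <= t) :> Prop.
Proof. by rewrite /Rplus /= in_itv /= andbT. Qed.

(** The index 0 is reserved for the points beyond [n], so that finitely many
    indices occur; the cell of index [k.+1] is the [k]-th interval of length
    [1 / n.+1]. *)
Definition cell (n : nat) (t : R) : nat :=
  if t < n%:R then (Num.truncn (t * n.+1%:R)).+1 else 0.

Definition cell_point (n k : nat) : R := k.-1%:R / n.+1%:R.

Lemma cell_fin_valued n : fin_valued (@Rplus R) (cell n).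
Proof.
split.
  apply: (@sub_finite_set _ _ `I_((n * n.+1).+2)); last exact: finite_II.
  move=> _ [t + <-] /=; rewrite Rplus_ge0 /cell => t0.
  case: ifPn => // tn; rewrite ltnS ltnS.
  rewrite truncn_le_nat; apply: (@lt_trans _ _ (n%:R * n.+1%:R)).
    by rewrite ltr_pM2r.
  by rewrite -natrM ltr_nat.
case=> [|k].
  rewrite (_ : _ `&` _ = Rplus `&` `[n%:R, +oo[).
    by apply: measurableI; [exact: measurable_Rplus|exact: measurable_itv].
  apply/seteqP; split=> t; rewrite /cell /= in_itv /= andbT => -[t0].
    by case: ifPn => //; rewrite -leNgt.
  by move=> nt; rewrite ltNge nt.
rewrite (_ : _ `&` _ = Rplus `&` (`]-oo, n%:R[ `&` `[k%:R / n.+1%:R, k.+1%:R / n.+1%:R[)).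
  apply: measurableI; first exact: measurable_Rplus.
  by apply: measurableI; exact: measurable_itv.
apply/seteqP; split=> t; rewrite /cell /= !in_itv /= Rplus_ge0 => -[t0].
  case: ifPn => // tn -[<-]; split=> //; split=> //.
  by rewrite ler_pdivrMr// ltr_pdivlMr// truncn_itv// mulr_ge0.
move=> [tn]; rewrite ler_pdivrMr// ltr_pdivlMr// => kt; split=> //.
by rewrite tn; congr _.+1; apply: truncn_def.
Qed.

Lemma cell_point_cvg (t : R) : 0 <= t ->
  cell_point n (cell n t) @[n --> \oo] --> t.
Proof.
move=> t0; apply/cvgrPdist_lt => e e0.
near=> n.
have tn : t < n%:R by near: n; exact: nbhs_infty_gtr.
rewrite /cell_point /cell tn /=.
have /truncn_itv/andP[le1 lt2] : 0 <= t * n.+1%:R by rewrite mulr_ge0.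
have lt1 : t * n.+1%:R - (Num.truncn (t * n.+1%:R))%:R < 1.
  by rewrite ltrBlDl natr1.
have ne : e^-1 < n.+1%:R.
  rewrite (@lt_trans _ _ n%:R) ?ltr_nat//; near: n; exact: nbhs_infty_gtr.
rewrite -[X in X - _](mulfK (x := n.+1%:R)) ?pnatr_eq0// -mulrBl.
rewrite ger0_norm; last by rewrite divr_ge0// subr_ge0.
rewrite ltr_pdivrMr//; apply: (lt_trans lt1).
by rewrite -ltr_pdivrMl// mulr1.
Unshelve. all: end_near. Qed.

Lemma cell_point_Rplus n k : Rplus (cell_point n k).
Proof. by rewrite Rplus_ge0 divr_ge0. Qed.

Lemma cell_comp_cvg (V : topologicalType) (c : R -> V) (t : R) :
    {within Rplus, continuous c} -> 0 <= t ->
  c (cell_point n (cell n t)) @[n --> \oo] --> c t.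
Proof.
move=> /subspace_continuousP cc t0; apply: cvg_comp; last first.
  by apply: cc; rewrite Rplus_ge0.
move=> A wA; change (\forall n \near \oo, A (cell_point n (cell n t))).
have : \forall n \near \oo, Rplus (cell_point n (cell n t)) ->
  A (cell_point n (cell n t)) := cell_point_cvg t0 wA.
by apply: filterS => n; apply; exact: cell_point_Rplus.
Qed.

(** The approximating functions sample [g] at the left ends of the cells. *)
Lemma continuous_simple_limit g :
  {within Rplus, continuous g} -> simple_limit mu Rplus g.
Proof.
move=> cg.
pose s n t := if cell n t is 0 then 0 else g (cell_point n (cell n t)).
exists s; split=> [n|t]; last first.
  rewrite Rplus_ge0 => t0; have := cell_comp_cvg cg t0.
  apply: cvg_trans; apply: near_eq_cvg; near=> n; rewrite /s.
  have tn : t < n%:R by near: n; exact: nbhs_infty_gtr.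
  by rewrite {2}/cell tn.
have fs : fin_valued Rplus (s n).
  exact: (fin_valued_comp (fun k => if k is 0 then 0 else g (cell_point n k))
    (cell_fin_valued n)).
apply: fin_valued_simple => //; first exact: measurable_Rplus.
have mI : measurable (`[0, n%:R[ : set R) by exact: measurable_itv.
apply: (@le_lt_trans _ _ (mu (`[0, n%:R[ : set R))); last first.
  by rewrite lebesgue_measure_itv /=; case: ifP => _; rewrite ?sube0 ltry.
apply: le_measure; rewrite ?inE//.
  rewrite (_ : _ `&` _ = Rplus `&` (fun t => s n t != 0) @^-1` [set true])//.
  by have [_ /(_ true)] := fin_valued_comp (fun x => x != 0) fs.
move=> t [+ /=]; rewrite Rplus_ge0 /s /cell in_itv /= => ->.
by case: ifPn => //; rewrite eqxx.
Unshelve. all: end_near. Qed.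

Lemma simple_limit_scale (c : R -> R[i]^o) h :
    {within Rplus, continuous c} -> simple_limit mu Rplus h ->
  simple_limit mu Rplus (fun t => c t *: h t).
Proof.
move=> cc [s [ss sh]].
exists (fun n t => c (cell_point n (cell n t)) *: s n t); split=> [n|t Dt].
  apply: (@simple_image _ _ _ X mu Rplus (s n) _ (cell n)
    (fun k x => (c (cell_point n k) : R[i]) *: x) measurable_Rplus (ss n)
    (cell_fin_valued n)) => k.
  by rewrite scaler0.
apply: (@cvgZ _ _ nat _ _ (fun n => c (cell_point n (cell n t)))); last exact: sh.
by apply: cell_comp_cvg => //; rewrite -Rplus_ge0.
Qed.

End StrongMeasurability.

Section Representative.
Context {d : measure_display} {T : measurableType d} {R : realType}
  {X : normedModType R[i]}.
Variables (mu : {measure set T -> \bar R}).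

(** Every null set being contained in a measurable one, [f] may be replaced by 0 on
    it. The prescribed part [N'] will be the set where an essential bound fails. *)
Lemma strongly_measurable_rep (D N' : set T) (f : T -> X) :
    measurable D -> measurable N' -> mu N' = 0%E -> strongly_measurable mu D f ->
  exists N h, [/\ measurable N, mu N = 0%E, N' `<=` N, simple_limit mu D h &
    (forall t, ~ N t -> h t = f t) /\ (forall t, N t -> h t = 0)].
Proof.
move=> mD mN' N'0 [s [ss [N1 [mN1 N10 sN1]]]].
pose N := N1 `|` N'; pose b t := `[< N t >].
exists N, (fun t => if b t then 0 else f t).
have mN : measurable N by exact: measurableU.
split=> //; last by split=> t; rewrite /b => Nt; [rewrite asboolF|rewrite asboolT].
- exact: null_set_setU.
- by move=> t ?; right.
exists (fun n t => if b t then 0 else s n t); split=> [n|t Dt].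
  apply: (@simple_image _ _ _ _ _ _ _ _ b (fun b x => if b then 0 else x)) => //.
  - split; first exact: finite_finset.
    have E : b @^-1` [set true] = N.
      by apply/seteqP; split=> t /=; rewrite /b; [move/asboolP|move/asboolT].
    case; first by rewrite E; exact: measurableI.
    rewrite (_ : b @^-1` [set false] = ~` N).
      by apply: measurableI => //; exact: measurableC.
    apply/seteqP; split=> t; rewrite /b /=.
      by move=> /negbT/asboolPn.
      by move=> Nt; exact: asboolF.
  - by case.
case: ifPn => bt; first exact: cvg_cst.
have Nt : ~ N t by move=> Nt; move: bt; rewrite /b asboolT.
have [st|st] := pselect (s^~ t n @[n --> \oo] --> f t); first exact: st.
by exfalso; apply: Nt; left; apply: sN1 => /(_ Dt).
Qed.

End Representative.

(** * Goursat's lemma for real differential forms *)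

Section IntervalIntegral.
Context {R : realType}.
Local Notation mu := (@lebesgue_measure R).
Implicit Types (f g F : R -> R) (a b c k l m x : R).

Definition itv_int f a b : R := \int[mu]_(x in `[a, b]) f x.

Lemma cont_itv_integrable f a b : (forall x, a <= x <= b -> {for x, continuous f}) ->
  mu.-integrable `[a, b] (EFin \o f).
Proof.
move=> cf; apply: continuous_compact_integrable; first exact: segment_compact.
apply: continuous_in_subspaceT => x; rewrite inE /= in_itv /=; exact: cf.
Qed.

Lemma itv_int_split f a m b : a <= m -> m <= b ->
    (forall x, a <= x <= b -> {for x, continuous f}) ->
  itv_int f a b = itv_int f a m + itv_int f m b.
Proof.
move=> am mb cf; have fi := cont_itv_integrable cf.
apply/eqP; rewrite addrC -subr_eq; apply/eqP.
rewrite /itv_int -(Rintegral_itv_obnd_cbnd (r := m)); last first.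
  by apply: integrableS fi => //; apply: subset_itvr; rewrite bnd_simp.
by rewrite Rintegral_itvB.
Qed.

Lemma itv_int_cst k a b : a <= b -> itv_int (fun=> k) a b = k * (b - a).
Proof.
move=> ab; rewrite /itv_int Rintegral_cst//= lebesgue_measure_itv /= lte_fin.
case: ltP => [|ba]; first by rewrite -EFinB.
by rewrite (le_anti (introT andP (conj ab ba))) subrr.
Qed.

Lemma itv_int_le f M a b : a <= b ->
    (forall x, a <= x <= b -> {for x, continuous f}) ->
    (forall x, a <= x <= b -> `|f x| <= M) ->
  `|itv_int f a b| <= M * (b - a).
Proof.
move=> ab cf fM; have fi := cont_itv_integrable cf.
apply: (le_trans (le_normr_Rintegral _ fi)) => //.
rewrite -(itv_int_cst M ab); apply: le_Rintegral => //.
- exact: integrable_norm.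
- by apply: cont_itv_integrable => x _; exact: cvg_cst.
Qed.

Lemma itv_intB f g a b :
    (forall x, a <= x <= b -> {for x, continuous f}) ->
    (forall x, a <= x <= b -> {for x, continuous g}) ->
  itv_int (fun x => f x - g x) a b = itv_int f a b - itv_int g a b.
Proof.
by move=> cf cg; rewrite /itv_int RintegralB//; exact: cont_itv_integrable.
Qed.

Lemma itv_int_near_cst f k (e : R) a b : a <= b ->
    (forall x, a <= x <= b -> {for x, continuous f}) ->
    (forall x, a <= x <= b -> `|f x - k| <= e) ->
  `|itv_int f a b - k * (b - a)| <= e * (b - a).
Proof.
move=> ab cf fe.
rewrite -(itv_int_cst k ab) -itv_intB//; last by move=> x _; exact: cvg_cst.
apply: itv_int_le => // x xab; apply: cvgB; [exact: cf|exact: cvg_cst].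
Qed.

Lemma itv_int_mono f g a b :
    (forall x, a <= x <= b -> {for x, continuous f}) ->
    (forall x, a <= x <= b -> {for x, continuous g}) ->
    (forall x, a <= x <= b -> f x <= g x) ->
  itv_int f a b <= itv_int g a b.
Proof.
move=> cf cg fg; apply: le_Rintegral => //.
- exact: cont_itv_integrable.
- exact: cont_itv_integrable.
Qed.

Lemma itv_intD f g a b :
    (forall x, a <= x <= b -> {for x, continuous f}) ->
    (forall x, a <= x <= b -> {for x, continuous g}) ->
  itv_int (fun x => f x + g x) a b = itv_int f a b + itv_int g a b.
Proof.
by move=> cf cg; rewrite /itv_int RintegralD//; exact: cont_itv_integrable.
Qed.

Lemma itv_intZ k f a b : (forall x, a <= x <= b -> {for x, continuous f}) ->
  itv_int (fun x => k * f x) a b = k * itv_int f a b.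
Proof.
by move=> cf; rewrite /itv_int RintegralZl//; exact: cont_itv_integrable.
Qed.

Lemma itv_int_EFin f a b : (forall x, a <= x <= b -> {for x, continuous f}) ->
  (itv_int f a b)%:E = (\int[mu]_(x in `[a, b]) (f x)%:E)%E.
Proof.
move=> cf; rewrite /itv_int /Rintegral fineK//.
exact: integrable_fin_num (cont_itv_integrable cf).
Qed.

Lemma derive_continuous F x (D : R) : is_derive x 1 F D -> {for x, continuous F}.
Proof. by move=> FD; apply/differentiable_continuous/derivable1_diffP; exact: ex_derive. Qed.

Lemma itv_int_FTC f F a b : a < b -> (forall x, is_derive x 1 F (f x)) ->
  (forall x, {for x, continuous f}) -> itv_int f a b = F b - F a.
Proof.
move=> ab dF cf; apply: EFin_inj; rewrite itv_int_EFin//.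
rewrite (@continuous_FTC2 _ f F)// ?EFinB//.
- by apply: continuous_subspaceT => x; exact: cf.
- split=> [x _|//|].
  + by have := dF x => ?; exact: ex_derive.
  + apply: cvg_at_right_filter; exact: (derive_continuous (dF a)).
  + apply: cvg_at_left_filter; exact: (derive_continuous (dF b)).
- by move=> x _; rewrite derive1E; have := dF x => ?; exact: derive_val.
Qed.

End IntervalIntegral.

Section Goursat.
Context {R : realType}.
Variables (P Q : R -> R -> R).
Implicit Types (a c l x y : R).

(** The line integral of [P dx + Q dy] along the boundary, counterclockwise, of
    the square of side [l] with lower left corner [(a, c)]. *)
Definition circulation a c l : R :=
  itv_int (fun x => P x c - P x (c + l)) a (a + l) +
  itv_int (fun y => Q (a + l) y - Q a y) c (c + l).

Definition sep_cont x y := {for x, continuous (P ^~ y)} /\ {for y, continuous (Q x)}.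

(** First-order contact, at [(x0, y0)], with an affine form whose coefficients
    satisfy the Cauchy-Riemann equations and which therefore is closed. *)
Definition cr_contact x0 y0 (p q al be e dl : R) :=
  forall x y, `|x - x0| <= dl -> `|y - y0| <= dl ->
    `|P x y - (p + al * (x - x0) + be * (y - y0))| <= e * (`|x - x0| + `|y - y0|) /\
    `|Q x y - (q + be * (x - x0) - al * (y - y0))| <= e * (`|x - x0| + `|y - y0|).

Definition cr_diff x0 y0 := exists p q al be : R, forall e, 0 < e ->
  exists2 dl, 0 < dl & cr_contact x0 y0 p q al be e dl.

Definition in_square a c l x y := (a <= x <= a + l) /\ (c <= y <= c + l).

Lemma circulation_quarter a c h : 0 <= h ->
    (forall x y, in_square a c (h + h) x y -> sep_cont x y) ->
  circulation a c (h + h) =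
  circulation a c h + circulation (a + h) c h +
  (circulation a (c + h) h + circulation (a + h) (c + h) h).
Proof.
move=> h0 sc; rewrite /circulation !addrA.
have cP y x : a <= x <= a + h + h -> c <= y <= c + h + h ->
    {for x, continuous (P ^~ y)}.
  by move=> xa yc; apply: (sc x y _).1; rewrite /in_square !addrA.
have cQ x y : a <= x <= a + h + h -> c <= y <= c + h + h ->
    {for y, continuous (Q x)}.
  by move=> xa yc; apply: (sc x y _).2; rewrite /in_square !addrA.
have spP y : c <= y <= c + h + h ->
    itv_int (P ^~ y) a (a + h + h) =
    itv_int (P ^~ y) a (a + h) + itv_int (P ^~ y) (a + h) (a + h + h).
  by move=> yc; apply: itv_int_split => [||x xa]; [lra|lra|exact: cP].
have spQ x : a <= x <= a + h + h ->
    itv_int (Q x) c (c + h + h) =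
    itv_int (Q x) c (c + h) + itv_int (Q x) (c + h) (c + h + h).
  by move=> xa; apply: itv_int_split => [||y yc]; [lra|lra|exact: cQ].
rewrite !itv_intB; last first.
all: try by move=> z hz; first [apply: cP; clear - hz h0; lra|apply: cQ; clear - hz h0; lra].
by rewrite !spP ?spQ; clear - h0; lra.
Qed.

Lemma circulation_bound a c l (M : R) : 0 <= l ->
    (forall x y, in_square a c l x y -> sep_cont x y) ->
    (forall x y, in_square a c l x y -> `|P x y| <= M /\ `|Q x y| <= M) ->
  `|circulation a c l| <= 4 * M * l.
Proof.
move=> l0 sc PM.
have h1 : `|itv_int (fun x => P x c - P x (c + l)) a (a + l)| <= (2 * M) * (a + l - a).
  apply: itv_int_le => [|x xa|x xa]; first lra.
    by apply: cvgB; apply: (sc _ _ _).1; split=> //; lra.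
  rewrite (le_trans (ler_normB _ _))//.
  have := (PM x c _).1; have := (PM x (c + l) _).1.
  rewrite /in_square => /(_ (conj xa _)) h /(_ (conj xa _)) h'.
  by have {}h := h ltac:(lra); have {}h' := h' ltac:(lra); lra.
have h2 : `|itv_int (fun y => Q (a + l) y - Q a y) c (c + l)| <= (2 * M) * (c + l - c).
  apply: itv_int_le => [|y yc|y yc]; first lra.
    by apply: cvgB; apply: (sc _ _ _).2; split=> //; lra.
  rewrite (le_trans (ler_normB _ _))//.
  have := (PM a y _).2; have := (PM (a + l) y _).2.
  rewrite /in_square => /(_ (conj _ yc)) h /(_ (conj _ yc)) h'.
  by have {}h := h ltac:(lra); have {}h' := h' ltac:(lra); lra.
rewrite /circulation (le_trans (ler_normD _ _))//.
by move: h1 h2; rewrite ![_ + l - _]addrC !addKr; lra.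
Qed.

(** The circulation of the closed affine form is 0; there remain the errors, at
    most [2 * e * l] at each point of the four edges of length [l]. *)
Lemma circulation_small a c l x0 y0 (p q al be e dl : R) : 0 < e -> 0 <= l -> l <= dl ->
    (forall x y, in_square a c l x y -> sep_cont x y) ->
    in_square a c l x0 y0 -> cr_contact x0 y0 p q al be e dl ->
  `|circulation a c l| <= 8 * e * l ^+ 2.
Proof.
move=> e0 l0 ldl sc [x0a y0c] lin.
have near x y : in_square a c l x y -> `|x - x0| <= l /\ `|y - y0| <= l.
  by move=> [xa yc]; rewrite !ler_norml; lra.
have pt x y : in_square a c l x y ->
    `|P x y - (p + al * (x - x0) + be * (y - y0))| <= 2 * e * l /\
    `|Q x y - (q + be * (x - x0) - al * (y - y0))| <= 2 * e * l.
  move=> s; have [xl yl] := near x y s.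
  have [h1 h2] := lin x y (le_trans xl ldl) (le_trans yl ldl).
  have le2 : e * (`|x - x0| + `|y - y0|) <= 2 * e * l.
    by rewrite -mulrA mulrCA ler_pM2l//; lra.
  by split; [exact: le_trans h1 _|exact: le_trans h2 _].
have h1 : `|itv_int (fun x => P x c - P x (c + l)) a (a + l) -
    (- (be * l)) * (a + l - a)| <= (4 * e * l) * (a + l - a).
  apply: itv_int_near_cst => [|x xa|x xa]; first lra.
    by apply: cvgB; apply: (sc _ _ _).1; split=> //; lra.
  have [+ _] := pt x c ltac:(split=> //; lra).
  have [+ _] := pt x (c + l) ltac:(split=> //; lra).
  by rewrite !ler_norml; lra.
have h2 : `|itv_int (fun y => Q (a + l) y - Q a y) c (c + l) -
    (be * l) * (c + l - c)| <= (4 * e * l) * (c + l - c).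
  apply: itv_int_near_cst => [|y yc|y yc]; first lra.
    by apply: cvgB; apply: (sc _ _ _).2; split=> //; lra.
  have [_ +] := pt a y ltac:(split=> //; lra).
  have [_ +] := pt (a + l) y ltac:(split=> //; lra).
  by rewrite !ler_norml; lra.
move: h1 h2; rewrite /circulation ![_ + l - _]addrC !addKr.
by rewrite !ler_norml expr2; lra.
Qed.

(** Goursat's lemma. One of the four quarters of a square carries at least a
    quarter of its circulation; iterating, the circulations around a nested
    sequence of squares decrease no faster than their areas, which contradicts
    differentiability at the common point. *)
Lemma goursat a c L : 0 < L ->
    (forall x y, in_square a c L x y -> sep_cont x y) ->
    (forall x y, in_square a c L x y -> cr_diff x y) ->
  circulation a c L = 0.
Proof.
move=> L0 sc cr; apply: contrapT => /eqP I0.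
set I := `|circulation a c L|; have {}I0 : 0 < I by rewrite normr_gt0.
pose l n : R := L / 2 ^+ n.
have l0 n : 0 < l n by rewrite divr_gt0// exprn_gt0.
have lS n : l n = l n.+1 + l n.+1.
  by rewrite /l exprS invfM; field; rewrite expf_neq0.
pose inv n (s : R * R) := [/\ a <= s.1, s.1 + l n <= a + L, c <= s.2,
  s.2 + l n <= c + L & I / 4 ^+ n <= `|circulation s.1 s.2 (l n)|].
have step (ns : nat * (R * R)) : exists s' : R * R, inv ns.1 ns.2 ->
   inv ns.1.+1 s' /\ [/\ ns.2.1 <= s'.1, s'.1 + l ns.1.+1 <= ns.2.1 + l ns.1,
     ns.2.2 <= s'.2 & s'.2 + l ns.1.+1 <= ns.2.2 + l ns.1].
  case: ns => n [x y] /=.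
  have [[/= ax xa cy yc big]|ninv] := pselect (inv n (x, y)); last by exists (x, y).
  set h := l n.+1; have h0 : 0 < h by exact: l0.
  have lh : l n = h + h by exact: lS.
  rewrite lh in xa yc big.
  have Ih : I / 4 ^+ n = 4 * (I / 4 ^+ n.+1).
    by rewrite [4 ^+ n.+1]exprS invfM; field; rewrite expf_neq0.
  have quar : `|circulation x y (h + h)| <=
     `|circulation x y h| + `|circulation (x + h) y h| +
     (`|circulation x (y + h) h| + `|circulation (x + h) (y + h) h|).
    rewrite circulation_quarter//; last 2 first.
    - exact: ltW.
    - by move=> x' y' [h1 h2]; apply: sc; split; lra.
    by rewrite (le_trans (ler_normD _ _))// lerD// ler_normD.
  rewrite Ih in big; set J := I / 4 ^+ n.+1 in big *.
  have [q1|q1] := leP J `|circulation x y h|.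
    by exists (x, y) => _; rewrite lh; split; split=> //=; rewrite -?/h; clear - ax xa cy yc h0; lra.
  have [q2|q2] := leP J `|circulation (x + h) y h|.
    by exists (x + h, y) => _; rewrite lh; split; split=> //=; rewrite -?/h; clear - ax xa cy yc h0; lra.
  have [q3|q3] := leP J `|circulation x (y + h) h|.
    by exists (x, y + h) => _; rewrite lh; split; split=> //=; rewrite -?/h; clear - ax xa cy yc h0; lra.
  have [q4|q4] := leP J `|circulation (x + h) (y + h) h|.
    by exists (x + h, y + h) => _; rewrite lh; split; split=> //=; rewrite -?/h; clear - ax xa cy yc h0; lra.
  exfalso; lra.
have [nx nxP] := choice step.
pose s := nat_rect (fun=> (R * R)%type) (a, c) (fun n p => nx (n, p)).
have sinv n : inv n (s n).
  elim: n => [|n ih]; last by have [] := nxP (n, s n) ih.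
  by split=> /=; rewrite ?/l ?expr0 ?divr1 ?lexx//.
have snest n : [/\ (s n).1 <= (s n.+1).1, (s n.+1).1 + l n.+1 <= (s n).1 + l n,
     (s n).2 <= (s n.+1).2 & (s n.+1).2 + l n.+1 <= (s n).2 + l n].
  by have [] := nxP (n, s n) (sinv n).
have nest m n : (m <= n)%N -> [/\ (s m).1 <= (s n).1, (s n).1 + l n <= (s m).1 + l m,
     (s m).2 <= (s n).2 & (s n).2 + l n <= (s m).2 + l m].
  elim: n => [|n ih]; first by rewrite leqn0 => /eqP ->.
  rewrite leq_eqVlt => /predU1P[->//|]; rewrite ltnS => /ih[h1 h2 h3 h4].
  by have [k1 k2 k3 k4] := snest n; split; lra.
have cross m n : (s n).1 <= (s m).1 + l m /\ (s n).2 <= (s m).2 + l m.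
  have [/nest[h1 h2 h3 h4]|/ltnW/nest[h1 h2 h3 h4]] := leqP m n.
    by have := l0 n; lra.
  by have := l0 m; lra.
(* the lower left corners converge to the common point of the squares *)
pose x0 := sup (range (fun n => (s n).1)); pose y0 := sup (range (fun n => (s n).2)).
have in0 n : in_square (s n).1 (s n).2 (l n) x0 y0.
  split; apply/andP; split.
  - apply: ub_le_sup; last by exists n.
    by exists ((s 0).1 + l 0) => _ [m _ <-]; have [] := cross 0 m.
  - apply: ge_sup; first by exists (s 0).1, 0.
    by move=> _ [m _ <-]; have [] := cross n m.
  - apply: ub_le_sup; last by exists n.
    by exists ((s 0).2 + l 0) => _ [m _ <-]; have [] := cross 0 m.
  - apply: ge_sup; first by exists (s 0).2, 0.
    by move=> _ [m _ <-]; have [] := cross n m.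
have in0' : in_square a c L x0 y0.
  by have := in0 0; rewrite /= /l expr0 divr1.
have [p [q [al [be lin]]]] := cr _ _ in0'.
have e0 : 0 < I / (16 * L ^+ 2) by rewrite divr_gt0// mulr_gt0// exprn_gt0.
have [dl dl0 lin'] := lin _ e0.
have [n ln] : exists n, l n <= dl.
  have [n _ /(_ n (leqnn n))] : \forall n \near \oo, l n < dl; last by move=> /ltW; exists n.
  have : l n @[n --> \oo] --> 0.
    rewrite -(mulr0 L); apply: cvgM; first exact: cvg_cst.
    under eq_fun do rewrite -exprVn.
    by apply: cvg_expr; rewrite ger0_norm ?invr_ge0// invf_lt1// ltr1n.
  move=> /cvgrPdist_lt/(_ _ dl0); apply: filterS => n.
  by rewrite sub0r normrN; apply: le_lt_trans; exact: ler_norm.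
have [i1 i2 i3 i4 big] := sinv n.
have scn x y : in_square (s n).1 (s n).2 (l n) x y -> sep_cont x y.
  by move=> [h1 h2]; apply: sc; split; lra.
have := circulation_small e0 (ltW (l0 n)) ln scn (in0 n) lin'.
move=> /(le_trans big); apply/negP; rewrite -ltNge.
have -> : 8 * (I / (16 * L ^+ 2)) * l n ^+ 2 = (I / 4 ^+ n) / 2.
  have -> : 4 = 2 ^+ 2 :> R by rewrite expr2; lra.
  rewrite /l -exprM mulnC exprM; field; rewrite expf_neq0//=; lra.
have : 0 < I / 4 ^+ n by rewrite divr_gt0// exprn_gt0.
lra.
Qed.

End Goursat.

(** * Cauchy's theorem with a removable singularity *)

Section Punctured.
Context {R : realType}.
Variables (P Q : R -> R -> R) (r : R).
Hypothesis r0 : 0 < r.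
Hypothesis sc : forall x y : R, `|x| <= r -> `|y| <= r -> sep_cont P Q x y.
Hypothesis cr : forall x y : R, `|x| <= r -> `|y| <= r -> (x != 0) || (y != 0) ->
  cr_diff P Q x y.
Hypothesis bnd : exists M dl : R, 0 < dl /\ forall x y, `|x| <= dl -> `|y| <= dl ->
  `|P x y| <= M /\ `|Q x y| <= M.

Let corner (b : bool) (l : R) : R := if b then - l else 0.

Let goursat_away a c h : 0 < h ->
    - r <= a -> a + h <= r -> - r <= c -> c + h <= r ->
    [|| 0 < a, a + h < 0, 0 < c | c + h < 0] ->
  circulation P Q a c h = 0.
Proof.
move=> h0 ra ar rc cr' away; apply: goursat => // x y [xa yc].
  by apply: sc; rewrite ler_norml; lra.
by apply: cr; rewrite ?ler_norml; lra.
Qed.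

(** Three of the four quarters of a square with a corner at the origin avoid the
    origin, so that only the quarter at the origin contributes. *)
Let circulation_corner b b' h : 0 < h -> h + h <= r ->
  circulation P Q (corner b (h + h)) (corner b' (h + h)) (h + h) =
  circulation P Q (corner b h) (corner b' h) h.
Proof.
move=> h0 hr; have hE : - (h + h) + h = - h by lra.
rewrite circulation_quarter; last 2 first.
- exact: ltW.
- move=> x y [xa yc]; apply: sc; move: xa yc;
    by case: b; case: b'; rewrite /= ler_norml; lra.
case: b; case: b'; rewrite /= ?hE ?add0r.
- by rewrite [X in X + _ + _]goursat_away 1?[circulation _ _ (- h) (- (h + h)) _]goursat_away
    1?[circulation _ _ (- (h + h)) (- h) _]goursat_away ?add0r//; lra.
- by rewrite [X in X + _ + _]goursat_away 1?[X in _ + (X + _)]goursat_away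
    1?[X in _ + (_ + X)]goursat_away ?add0r ?addr0//; lra.
- by rewrite [X in X + _ + _]goursat_away 1?[X in _ + X + _]goursat_away
    1?[X in _ + (_ + X)]goursat_away ?add0r ?addr0//; lra.
- by rewrite [X in _ + X + _]goursat_away 1?[X in _ + (X + _)]goursat_away
    1?[X in _ + (_ + X)]goursat_away ?add0r ?addr0//; lra.
Qed.

Let circulation_corner0 b b' : circulation P Q (corner b r) (corner b' r) r = 0.
Proof.
pose l n : R := r / 2 ^+ n.
have l0 n : 0 < l n by rewrite divr_gt0// exprn_gt0.
have lS n : l n = l n.+1 + l n.+1.
  by rewrite /l exprS invfM; field; rewrite expf_neq0.
have lr n : l n <= r.
  by elim: n => [|n]; [rewrite /l expr0 divr1|have := lS n; have := l0 n.+1; lra].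
have E n : circulation P Q (corner b r) (corner b' r) r =
    circulation P Q (corner b (l n)) (corner b' (l n)) (l n).
  elim: n => [|n ->]; first by rewrite /l expr0 divr1.
  by rewrite (lS n) circulation_corner// -lS.
have [M [dl [dl0 PM]]] := bnd.
have lim : l n @[n --> \oo] --> 0.
  rewrite -(mulr0 r); apply: cvgM; first exact: cvg_cst.
  under eq_fun do rewrite -exprVn.
  by apply: cvg_expr; rewrite ger0_norm ?invr_ge0// invf_lt1// ltr1n.
apply/eqP; rewrite -normr_le0; apply/ler_addgt0Pl => e e0; rewrite addr0.
have M0 : 0 <= M.
  by have [h _] := PM 0 0 ltac:(rewrite normr0; lra) ltac:(rewrite normr0; lra);
    exact: le_trans h.
have k0 : 0 < Num.min dl (e / (4 * M + 1)).
  by rewrite lt_min dl0 divr_gt0//; lra.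
have /cvgrPdist_lt/(_ _ k0)[n _ /(_ n (leqnn n))] := lim.
rewrite sub0r normrN gtr0_norm// lt_min => /andP[ldl le].
rewrite (E n) => {E}; apply: le_trans (circulation_bound (M := M) (ltW (l0 n)) _ _) _.
- move=> x y [xa yc]; apply: sc; have := lr n; have := l0 n; move: xa yc;
    by case: b; case: b'; rewrite /= ler_norml; lra.
- move=> x y [xa yc]; apply: PM; have := l0 n; move: xa yc;
    by case: b; case: b'; rewrite /= ler_norml; lra.
have : (4 * M + 1) * l n < e by rewrite -ltr_pdivlMl// 1?mulrC//; lra.
have := l0 n; lra.
Qed.

(** Cauchy's theorem with a removable singularity at the centre: the four
    quadrants have a corner there, and shrinking towards the corner does not
    change the circulation. *)
Lemma circulation_punctured : circulation P Q (- r) (- r) (r + r) = 0.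
Proof.
rewrite circulation_quarter; last 2 first.
- exact: ltW.
- by move=> x y [xa yc]; apply: sc; rewrite ler_norml; lra.
rewrite addNr; have := circulation_corner0 true true.
have := circulation_corner0 true false; have := circulation_corner0 false true.
have := circulation_corner0 false false; rewrite /corner => -> -> -> ->.
by rewrite !addr0.
Qed.

End Punctured.

(** * Complex differentiability *)

Section ComplexModulus.
Context {R : realType}.
Implicit Types (z w c : R[i]) (x y : R).

Definition cabs z : R := @rnorm R R[i]^o z.

Lemma cabsM c z : cabs (c * z) = cabs c * cabs z.
Proof. exact: (@rnormZ R R[i]^o). Qed.

Lemma cabsE x y : cabs (x +i* y) = Num.sqrt (x ^+ 2 + y ^+ 2).
Proof. by rewrite /cabs /rnorm normc_def. Qed.

Lemma cabsD z w : cabs (z + w) <= cabs z + cabs w.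
Proof. exact: (@ler_rnormD R R[i]^o). Qed.

Lemma cabsN z : cabs (- z) = cabs z.
Proof. exact: (@rnormN R R[i]^o). Qed.

Lemma cabs_ge0 z : 0 <= cabs z.
Proof. exact: (@rnorm_ge0 R R[i]^o). Qed.

Lemma cabs0 : cabs 0 = 0.
Proof. exact: (@rnorm0 R R[i]^o). Qed.

Lemma cabs_eq0 z : cabs z = 0 -> z = 0.
Proof. exact: (@rnorm_eq0 R R[i]^o). Qed.

Lemma cabs_gt0 z : z != 0 -> 0 < cabs z.
Proof. by move=> z0; rewrite lt0r cabs_ge0 andbT; apply: contra_neq z0; exact: cabs_eq0. Qed.

Lemma cabs_re x : cabs x%:C = `|x|.
Proof. by rewrite cabsE expr0n addr0 sqrtr_sqr. Qed.

Lemma cabs1 : cabs 1 = 1.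
Proof. by have := cabs_re 1; rewrite normr1. Qed.

Lemma cabs_im x : cabs (0 +i* x) = `|x|.
Proof. by rewrite cabsE expr0n add0r sqrtr_sqr. Qed.

Lemma cabsV z : cabs z^-1 = (cabs z)^-1.
Proof.
have [->|z0] := eqVneq z 0; first by rewrite invr0 cabs0 invr0.
apply: (mulfI (lt0r_neq0 (cabs_gt0 z0))).
by rewrite -cabsM !divff ?cabs1// gt_eqF// cabs_gt0.
Qed.

Lemma cabs_ge_re x y : `|x| <= cabs (x +i* y).
Proof. by rewrite cabsE -sqrtr_sqr ler_wsqrtr// lerDl sqr_ge0. Qed.

Lemma cabs_ge_im x y : `|y| <= cabs (x +i* y).
Proof. by rewrite cabsE -sqrtr_sqr ler_wsqrtr// lerDr sqr_ge0. Qed.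

Lemma complex_split x y : x +i* y = x%:C + (0 +i* y).
Proof. by apply/eqP; rewrite eq_complex /= addr0 add0r !eqxx. Qed.

Lemma cabs_le x y : cabs (x +i* y) <= `|x| + `|y|.
Proof. by rewrite complex_split (le_trans (cabsD _ _))// cabs_re cabs_im. Qed.

End ComplexModulus.

Section ComplexDerivative.
Context {R : realType} {X : normedModType R[i]}.
Implicit Types (z w : R[i]) (H G : R[i] -> X) (c : R[i] -> R[i]) (e dl : R).

(** Complex differentiability in the form that estimates use: the moduli are real
    numbers rather than elements of [R[i]]. *)
Definition cdiff H z := exists D : X, forall e, 0 < e ->
  exists2 dl, 0 < dl & forall w, cabs (w - z) <= dl ->
    rnorm (H w - H z - (w - z) *: D) <= e * cabs (w - z).

Lemma derivable_cdiff (F : R[i]^o -> X) (z : R[i]^o) :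
  derivable F z 1 -> cdiff F z.
Proof.
move=> /cvg_ex[/= D dF]; exists D => e e0.
have /(cvgrPdist_lt _ _).1 := dF => /(_ e%:C); rewrite ltcR => /(_ e0).
move=> /nbhs_ballP[k /= + kF]; rewrite ltcE /= => /andP[/eqP k0 kR].
exists (complex.Re k / 2); first by rewrite divr_gt0.
move=> w wz; have [->|wnz] := eqVneq w z.
  by rewrite !subrr scale0r subr0 rnorm0 cabs0 mulr0.
have h0 : w - z != 0 by rewrite subr_eq0.
have := kF (w - z); rewrite -ball_normE /= sub0r normrN => /(_ _ h0).
have -> : `|w - z| < k.
  rewrite (_ : `|w - z| = (cabs (w - z))%:C); last exact: (@rnormE R R[i]^o).
  by rewrite ltcE /= k0 eqxx /=; lra.
move=> /(_ isT); rewrite rnormE ltcR /= [(w - z) *: 1]mulr1 subrK => h.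
have -> : F w - F z - (w - z) *: D = - ((w - z) *: (D - (w - z)^-1 *: (F w - F z))).
  by rewrite scalerBr scalerA divff// scale1r opprB.
by rewrite rnormN rnormZ mulrC ler_wpM2r ?cabs_ge0// ltW.
Qed.

Lemma cdiff_lip H z : cdiff H z -> exists K dl, [/\ 0 <= K, 0 < dl &
  forall w, cabs (w - z) <= dl -> rnorm (H w - H z) <= K * cabs (w - z)].
Proof.
move=> [D /(_ 1 ltr01)[dl dl0 HD]]; exists (1 + rnorm D), dl; split=> //.
  by rewrite addr_ge0// rnorm_ge0.
move=> w wz; rewrite -(subrK ((w - z) *: D) (H w - H z)).
rewrite (le_trans (ler_rnormD _ _))// mulrDl lerD ?HD//.
by rewrite rnormZ mulrC.
Qed.

Lemma cdiff_continuous H z : cdiff H z -> forall e, 0 < e ->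
  exists2 dl, 0 < dl & forall w, cabs (w - z) <= dl -> rnorm (H w - H z) <= e.
Proof.
move=> /cdiff_lip[K [dl [K0 dl0 HK]]] e e0.
have K1 : 0 < K + 1 by lra.
exists (Num.min dl (e / (K + 1))); first by rewrite lt_min dl0 divr_gt0.
move=> w; rewrite le_min => /andP[wd we]; apply: (le_trans (HK w wd)).
rewrite ler_pdivlMr// in we; have := cabs_ge0 (w - z); nra.
Qed.

Lemma cdiff_near H G z dl : 0 < dl -> (forall w, cabs (w - z) <= dl -> H w = G w) ->
  cdiff G z -> cdiff H z.
Proof.
move=> dl0 HG [D GD]; exists D => e /GD[dl' dl'0 h].
exists (Num.min dl dl'); first by rewrite lt_min dl0.
move=> w; rewrite le_min => /andP[wd we]; rewrite !HG ?subrr ?cabs0//; last exact: ltW.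
exact: h.
Qed.

Lemma cdiff_cst (x : X) z : cdiff (fun=> x) z.
Proof.
exists 0 => e e0; exists 1 => // w _; rewrite scaler0 subrr subr0 rnorm0.
by rewrite mulr_ge0 ?cabs_ge0 ?ltW.
Qed.

Lemma cdiffB H G z : cdiff H z -> cdiff G z -> cdiff (fun w => H w - G w) z.
Proof.
move=> [D HD] [E GE]; exists (D - E) => e e0.
have e2 : 0 < e / 2 by rewrite divr_gt0.
have [d1 d10 h1] := HD _ e2; have [d2 d20 h2] := GE _ e2.
exists (Num.min d1 d2); first by rewrite lt_min d10.
move=> w; rewrite le_min => /andP[/h1 w1 /h2 w2].
have -> : H w - G w - (H z - G z) - (w - z) *: (D - E) =
    (H w - H z - (w - z) *: D) - (G w - G z - (w - z) *: E).
  by apply: rfun_sep => u hu; rewrite scalerBr !rfunB//; ring.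
by have := ler_rnormB (H w - H z - (w - z) *: D) (G w - G z - (w - z) *: E); lra.
Qed.

End ComplexDerivative.

Section ComplexDerivativeTheory.
Context {R : realType} {X : normedModType R[i]}.
Implicit Types (z w : R[i]) (H G : R[i] -> X) (c : R[i] -> R[i]) (e dl : R).

Lemma cdiffZ (c : R[i] -> R[i]^o) H z : cdiff c z -> cdiff H z ->
  cdiff (fun w => (c w : R[i]) *: H w) z.
Proof.
move=> cc hH; have [K1 [d1 [K10 d10 L1]]] := cdiff_lip cc.
have [K2 [d2 [K20 d20 L2]]] := cdiff_lip hH.
case: cc => D cD; case: hH => E HE.
exists ((D : R[i]) *: H z + (c z : R[i]) *: E) => e e0.
pose A := rnorm (H z) + cabs (c z) + K1 * K2 + 1.
have h0 := rnorm_ge0 (H z); have c0 := cabs_ge0 (c z).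
have A0 : 0 < A by rewrite /A; have := mulr_ge0 K10 K20; lra.
have eA : 0 < e / A by rewrite divr_gt0.
have [d3 d30 h3] := cD _ eA; have [d4 d40 h4] := HE _ eA.
exists (Num.min (Num.min d1 d2) (Num.min (Num.min d3 d4) (e / A))).
  by rewrite !lt_min d10 d20 d30 d40.
move=> w; rewrite !le_min => /andP[/andP[/L1 l1 /L2 l2] /andP[/andP[/h3 l3 /h4 l4] le]].
have -> : (c w : R[i]) *: H w - (c z : R[i]) *: H z - (w - z) *: ((D : R[i]) *: H z + (c z : R[i]) *: E) =
    (c w - c z - (w - z) *: D : R[i]) *: H z + (c z : R[i]) *: (H w - H z - (w - z) *: E)
    + (c w - c z : R[i]) *: (H w - H z).
  apply: rfun_sep => u hu.
  rewrite !scalerBr !scalerDr !scalerA !(scalerBl (c w - c z)) !(scalerBl (c w)).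
  by rewrite [(c z : R[i]) * (w - z)]mulrC !(rfunB _ _ hu, rfunD _ _ hu); ring.
apply: (le_trans (ler_rnormD _ _)).
have b1 : rnorm ((c w - c z - (w - z) *: D : R[i]) *: H z +
    (c z : R[i]) *: (H w - H z - (w - z) *: E)) <=
    (e / A * cabs (w - z)) * rnorm (H z) + cabs (c z) * (e / A * cabs (w - z)).
  by rewrite (le_trans (ler_rnormD _ _))// !rnormZ lerD// ?ler_wpM2r// ler_wpM2l.
have b2 : rnorm ((c w - c z : R[i]) *: (H w - H z)) <=
    (K1 * cabs (w - z)) * (K2 * (e / A)).
  rewrite rnormZ ler_pM ?cabs_ge0 ?rnorm_ge0//.
  by rewrite (le_trans l2)// ler_wpM2l.
apply: (le_trans (lerD b1 b2)).
have -> : e / A * cabs (w - z) * rnorm (H z) + cabs (c z) * (e / A * cabs (w - z)) +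
   K1 * cabs (w - z) * (K2 * (e / A)) = (e * cabs (w - z)) * ((A - 1) / A).
  by rewrite /A; ring.
rewrite ler_piMr ?mulr_ge0 ?cabs_ge0// ?ltW// ltr_pdivrMr// mul1r; lra.
Qed.

Lemma cdiff_ext H G z : H =1 G -> cdiff G z -> cdiff H z.
Proof. by move=> /funext ->. Qed.

End ComplexDerivativeTheory.

Section ScalarDerivative.
Context {R : realType}.
Implicit Types (z w : R[i]).

Lemma cdiff_inv z : z != 0 -> cdiff (fun w => w^-1 : R[i]^o) z.
Proof.
move=> z0; have az := cabs_gt0 z0.
exists (- z ^- 2 : R[i]^o) => e e0.
have k0 : 0 < e * cabs z ^+ 3 / 2 by rewrite divr_gt0// mulr_gt0// exprn_gt0.
exists (Num.min (cabs z / 2) (e * cabs z ^+ 3 / 2)); first by rewrite lt_min divr_gt0.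
move=> w; rewrite le_min => /andP[w1 w2].
have w3 : cabs z / 2 <= cabs w.
  have : cabs z <= cabs w + cabs (w - z).
    by rewrite -{1}(subKr w z) (le_trans (cabsD _ _))// cabsN.
  lra.
have w0 : w != 0.
  by apply: contraTneq w3 => ->; rewrite cabs0 -ltNge divr_gt0.
change (cabs (w^-1 - z^-1 - (w - z) * (- z ^- 2)) <= e * cabs (w - z)).
have -> : w^-1 - z^-1 - (w - z) * (- z ^- 2) = (w - z) * ((w - z) * (w^-1 * (z^-1 * z^-1))).
  by field; rewrite z0 w0.
rewrite cabsM mulrC ler_wpM2r ?cabs_ge0// !cabsM !cabsV.
rewrite -!invfM ler_pdivrMr ?mulr_gt0 ?cabs_gt0//; apply: (le_trans w2).
have : cabs z / 2 * (cabs z * cabs z) <= cabs w * (cabs z * cabs z).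
  by rewrite ler_wpM2r// mulr_ge0 ?cabs_ge0.
by rewrite !exprS expr0 mulr1 => h; rewrite -mulrA ler_pM2l//; lra.
Qed.

Lemma cdiff_id z : cdiff (fun w => w : R[i]^o) z.
Proof.
exists (1 : R[i]^o) => e e0; exists 1 => // w _.
change (cabs (w - z - (w - z) * 1) <= e * cabs (w - z)).
by rewrite mulr1 subrr cabs0 mulr_ge0 ?cabs_ge0// ltW.
Qed.

End ScalarDerivative.

(** * A Cauchy estimate on a square *)

Section CauchyInequality.
Context {R : realType} {X : normedModType R[i]}.
Implicit Types (z w : R[i]) (H q : R[i] -> X) (u : X -> R) (x y : R).

Lemma rfun_complex u (a b : R) (v : X) : real_functional u ->
  u ((a +i* b) *: v) = a * u v + b * u ('i *: v).
Proof.
move=> hu; have -> : a +i* b = a%:C + b%:C * 'i.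
  by apply/eqP; rewrite eq_complex /= !(mul0r, mulr0, mulr1, subr0, addr0, add0r) !eqxx.
by rewrite scalerDl -scalerA rfunD// !rfunZ.
Qed.

Lemma rnorm_i (v : X) : rnorm ('i *: v) = rnorm v.
Proof. by rewrite rnormZ (_ : rnorm _ = 1) ?mul1r//; have := @cabs_im R 1; rewrite normr1. Qed.

Lemma complexB x y x0 y0 : (x +i* y) - (x0 +i* y0) = (x - x0) +i* (y - y0) :> R[i].
Proof. by []. Qed.

Definition cont_at q z := forall e : R, 0 < e -> exists2 dl, 0 < dl &
  forall w, cabs (w - z) <= dl -> rnorm (q w - q z) <= e.

Lemma cont_at_near (k : X -> R) q x y : (forall v v', `|k v - k v'| <= rnorm (v - v')) ->
    cont_at q (x +i* y) ->
  {for x, continuous (fun x => k (q (x +i* y)))} /\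
  {for y, continuous (fun y => k (q (x +i* y)))}.
Proof.
move=> kl cq; split; apply/cvgrPdist_le => e /cq[dl dl0 h];
  apply/nbhs_ballP; exists dl => // t /= /ltW tx;
  rewrite distrC (le_trans (kl _ _))// h//.
  by rewrite complexB subrr [X in cabs X]complexr0 cabs_re distrC.
by rewrite complexB subrr cabs_im distrC.
Qed.

Lemma rfun_lip u : real_functional u -> forall v v', `|u v - u v'| <= rnorm (v - v').
Proof. by move=> hu v v'; rewrite -rfunB// rfun_le. Qed.

Lemma rfun_lip_i u : real_functional u ->
  forall v v', `|u ('i *: v) - u ('i *: v')| <= rnorm (v - v').
Proof.
by move=> hu v v'; rewrite -rfunB// -scalerBr -[leRHS]rnorm_i rfun_le.
Qed.

Lemma rnorm_lip (v v' : X) : `|rnorm v - rnorm v'| <= rnorm (v - v').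
Proof.
have := ler_rnormD (v - v') v'; have := ler_rnormD (v' - v) v.
by rewrite !subrK [rnorm (v' - v)]rnorm_distC ler_norml; lra.
Qed.

(** The real form [u (q dz)] has the coefficients [u q] along [dx] and [u (i q)]
    along [dy]; if [D] is the derivative of [q], then [u D] and [u (i D)] are their
    derivatives, and [i ^ 2 = - 1] yields the Cauchy-Riemann equations. *)
Lemma rfun_cr_diff u q x y : real_functional u -> cdiff q (x +i* y) ->
  cr_diff (fun x y => u (q (x +i* y))) (fun x y => u ('i *: q (x +i* y))) x y.
Proof.
move=> hu [D qD].
exists (u (q (x +i* y))), (u ('i *: q (x +i* y))), (u D), (u ('i *: D)) => e e0.
have [dl dl0 h] := qD _ e0; exists (dl / 2); first by rewrite divr_gt0.
move=> x' y' x'd y'd.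
have wd : cabs ((x' +i* y') - (x +i* y)) <= `|x' - x| + `|y' - y|.
  by rewrite complexB cabs_le.
have := h (x' +i* y') ltac:(by apply: (le_trans wd); lra).
set E := rnorm _ => hE; have {}hE : E <= e * (`|x' - x| + `|y' - y|).
  by apply: (le_trans hE); rewrite ler_wpM2l// ltW.
have ii : 'i *: ('i *: D) = - D by rewrite scalerA -expr2 sqr_i scaleN1r.
split.
  apply: le_trans hE; apply: le_trans (rfun_le _ hu).
  rewrite !rfunB// complexB (rfun_complex (x' - x))// le_eqVlt; apply/orP; left; apply/eqP.
  by congr `|_|; ring.
apply: le_trans hE; rewrite /E -rnorm_i; apply: le_trans (rfun_le _ hu).
rewrite !scalerBr !rfunB// complexB scalerA [_ * (_ +i* _)]mulrC -scalerA.
rewrite (rfun_complex (x' - x))// ii rfunN// le_eqVlt; apply/orP; left; apply/eqP.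
by congr `|_|; ring.
Qed.

(** Cauchy's theorem for [(H z - H 0) / z], tested with a functional that norms
    [i H 0]: the contribution of [H 0 / z] is the angle swept by the boundary times
    the norm of [H 0], and the modulus of [1 / z] is at most [1 / r] there. The
    constant 4 is a lower bound for the angle [2 pi]. *)
Lemma cauchy_estimate (r : R) H : 0 < r ->
    (forall x y, `|x| <= r -> `|y| <= r -> cdiff H (x +i* y)) ->
  4 * r * rnorm (H 0) <=
  itv_int (fun x => rnorm (H (x +i* - r)) + rnorm (H (x +i* r)) +
                    (rnorm (H (r +i* x)) + rnorm (H ((- r) +i* x)))) (- r) r.
Proof.
move=> r0 dH.
have z00 : (0 +i* 0) = 0 :> R[i] by [].
have zn0 x y : (x != 0) || (y != 0) -> x +i* y != 0.
  by rewrite eq_complex /= negb_and.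
have dH0 : cdiff H 0 by rewrite -z00; apply: dH; rewrite normr0 ltW.
have [D0 D0P] := dH0.
(* the value [D0] removes the singularity of the difference quotient *)
pose q z := if z == 0 then D0 else (z^-1 : R[i]) *: (H z - H 0).
have qdiff x y : `|x| <= r -> `|y| <= r -> (x != 0) || (y != 0) -> cdiff q (x +i* y).
  move=> xr yr /zn0 z0.
  apply: (@cdiff_near _ _ _ (fun z => (z^-1 : R[i]) *: (H z - H 0)) _ (cabs (x +i* y) / 2)).
  - by rewrite divr_gt0// cabs_gt0.
  - move=> w wz; rewrite /q ifN//; apply: contraTneq wz => ->.
    by rewrite sub0r cabsN -ltNge; have := cabs_gt0 z0; lra.
  apply: cdiffZ; first exact: cdiff_inv.
  by apply: cdiffB; [exact: dH|exact: cdiff_cst].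
have qcont x y : `|x| <= r -> `|y| <= r -> cont_at q (x +i* y).
  move=> xr yr; have [/(qdiff _ _ xr yr)|] := boolP ((x != 0) || (y != 0)).
    exact: cdiff_continuous.
  rewrite negb_or !negbK => /andP[/eqP -> /eqP ->] e e0; have [dl dl0 h] := D0P _ e0; exists dl => // w.
  rewrite z00 /q eqxx; have [-> _|w0] := eqVneq w 0.
    by rewrite subrr rnorm0 ltW.
  move=> /h; rewrite subr0 => hw; rewrite -(ler_pM2l (cabs_gt0 w0)) [leRHS]mulrC.
  rewrite -[leLHS]rnormZ scalerBr scalerA divff// scale1r; exact: hw.
have [u hu uE] := norming_functional ('i *: H 0); rewrite rnorm_i in uE.
pose P x y := u (q (x +i* y)); pose Q x y := u ('i *: q (x +i* y)).
have cP x y : `|x| <= r -> `|y| <= r -> sep_cont P Q x y.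
  move=> xr yr; split.
    by have [] := cont_at_near (rfun_lip hu) (qcont x y xr yr).
  by have [] := cont_at_near (rfun_lip_i hu) (qcont x y xr yr).
have I0 : circulation P Q (- r) (- r) (r + r) = 0.
  apply: circulation_punctured => //.
    by move=> x y xr yr xy; apply: rfun_cr_diff => //; exact: qdiff.
  have [|||dl dl0 h] := qcont 0 0 _ _ 1; rewrite ?normr0 ?ltW//.
  exists (rnorm (q 0) + 1), (dl / 2); split; first by rewrite divr_gt0.
  move=> x y xd yd; have : rnorm (q (x +i* y)) <= rnorm (q 0) + 1.
    rewrite -[q (x +i* y)](subrK (q 0)) (le_trans (ler_rnormD _ _))// addrC lerD2l.
    by rewrite h// z00 subr0 (le_trans (cabs_le _ _))//; lra.
  by move=> b; split; apply: le_trans b;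
    rewrite (le_trans (rfun_le _ hu))// rnorm_i.
have nr : `|r| <= r by rewrite gtr0_norm.
have nNr : `|- r| <= r by rewrite normrN.
have rr : - r + (r + r) = r by lra.
rewrite /circulation rr in I0.
pose n x y := rnorm (H (x +i* y)).
have cn x y : `|x| <= r -> `|y| <= r ->
    {for x, continuous (n ^~ y)} /\ {for y, continuous (n x)}.
  by move=> xr yr; exact: (cont_at_near rnorm_lip (cdiff_continuous (dH x y xr yr))).
pose N x := n x (- r) + n x r + (n r x + n (- r) x).
have cN x : - r <= x <= r -> {for x, continuous N}.
  rewrite -ler_norml => xr; apply: cvgD; apply: cvgD.
  - exact: (cn _ _ xr nNr).1.
  - exact: (cn _ _ xr nr).1.
  - exact: (cn _ _ nr xr).2.
  - exact: (cn _ _ nNr xr).2.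
have cA x : - r <= x <= r -> {for x, continuous (fun x => P x (- r) - P x r)}.
  rewrite -ler_norml => xr; apply: cvgB.
  - exact: (cP _ _ xr nNr).1.
  - exact: (cP _ _ xr nr).1.
have cB x : - r <= x <= r -> {for x, continuous (fun x => Q r x - Q (- r) x)}.
  rewrite -ler_norml => xr; apply: cvgB.
  - exact: (cP _ _ nr xr).2.
  - exact: (cP _ _ nNr xr).2.
pose n0 := rnorm (H 0).
(* on the four edges together the contribution of [H 0 / z] is [4 r ^ 2 n0 / s], at
   least [2 n0] because [s], the squared distance to the origin, is at most
   [2 r ^ 2] *)
have key x : - r <= x <= r -> 2 * n0 + (r * (P x (- r) - P x r) + r * (Q r x - Q (- r) x)) <= N x.
  rewrite -ler_norml => xr; pose s := x ^+ 2 + r ^+ 2.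
  have sr : r ^+ 2 <= s by rewrite /s lerDr sqr_ge0.
  have s2r : s <= 2 * r ^+ 2.
    rewrite /s mulr_natl mulr2n lerD2r -(real_normK (num_real x)) lerXn2r// nnegrE//.
    exact: ltW.
  have s0 : 0 < s by rewrite (lt_le_trans _ sr)// exprn_gt0.
  have ar (a b : R) : a ^+ 2 + b ^+ 2 = s -> cabs (a +i* b)^-1 <= r^-1.
    move=> ab; rewrite cabsV lef_pV2 ?posrE//; last first.
      by rewrite cabsE ab sqrtr_gt0.
    by rewrite cabsE ab -[leLHS]gtr0_norm// -sqrtr_sqr ler_wsqrtr.
  have qb (a b : R) : a ^+ 2 + b ^+ 2 = s ->
      q (a +i* b) = (a +i* b)^-1 *: H (a +i* b) - (a +i* b)^-1 *: H 0.
    move=> ab; rewrite /q ifN ?scalerBr//; apply: contraTneq s0.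
    by rewrite -ab => -[-> ->]; rewrite expr0n /= addr0 ltxx.
  have inv (a b : R) (v : X) : a ^+ 2 + b ^+ 2 = s ->
      u ((a +i* b)^-1 *: v) = a / s * u v - b / s * u ('i *: v).
    move=> ab; have -> : (a +i* b)^-1 = (a / s) +i* (- (b / s)).
      by rewrite -ab.
    by rewrite rfun_complex// mulNr.
  have ii : u ('i *: ('i *: H 0)) = - u (H 0).
    by rewrite scalerA -expr2 sqr_i scaleN1r rfunN.
  have Pb (a b : R) : a ^+ 2 + b ^+ 2 = s -> exists2 h, `|h| <= n a b / r &
      P a b = h - (a / s * u (H 0) - b / s * n0).
    move=> ab; exists (u ((a +i* b)^-1 *: H (a +i* b))).
      rewrite (le_trans (rfun_le _ hu))// rnormZ [leRHS]mulrC.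
      by rewrite ler_wpM2r ?rnorm_ge0//; exact: ar.
    by rewrite /P qb// rfunB// (inv _ _ (H 0))// uE.
  have Qb (a b : R) : a ^+ 2 + b ^+ 2 = s -> exists2 h, `|h| <= n a b / r &
      Q a b = h - (a / s * n0 + b / s * u (H 0)).
    move=> ab; exists (u ('i *: ((a +i* b)^-1 *: H (a +i* b)))).
      rewrite (le_trans (rfun_le _ hu))// rnorm_i rnormZ [leRHS]mulrC.
      by rewrite ler_wpM2r ?rnorm_ge0//; exact: ar.
    rewrite /Q qb// scalerBr rfunB// [in X in _ - X]scalerA [X in X *: H 0]mulrC.
    by rewrite -scalerA (inv _ _ ('i *: H 0))// ii uE; ring.
  have [h1 h1n ->] := Pb x (- r) ltac:(by rewrite sqrrN).
  have [h2 h2n ->] := Pb x r erefl.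
  have [h3 h3n ->] := Qb r x ltac:(by rewrite addrC).
  have [h4 h4n ->] := Qb (- r) x ltac:(by rewrite sqrrN addrC).
  have {}h1n : r * h1 <= n x (- r).
    rewrite mulrC -ler_pdivlMr//; exact: le_trans (ler_norm _) h1n.
  have {}h2n : - (r * h2) <= n x r.
    rewrite -mulrN mulrC -ler_pdivlMr//; apply: le_trans h2n; rewrite -normrN; exact: ler_norm.
  have {}h3n : r * h3 <= n r x.
    rewrite mulrC -ler_pdivlMr//; exact: le_trans (ler_norm _) h3n.
  have {}h4n : - (r * h4) <= n (- r) x.
    rewrite -mulrN mulrC -ler_pdivlMr//; apply: le_trans h4n; rewrite -normrN; exact: ler_norm.
  have n00 : 0 <= n0 by exact: rnorm_ge0.
  have main : 2 * n0 <= 4 * (r ^+ 2 / s) * n0.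
    rewrite ler_wpM2r// (_ : 4 = 2 * 2); last by ring.
    rewrite -mulrA ler_peMr// mulrA ler_pdivlMr// mul1r; exact: s2r.
  rewrite /N; set v := u (H 0).
  have -> : 2 * n0 + (r * (h1 - (x / s * v - - r / s * n0) - (h2 - (x / s * v - r / s * n0))) +
     r * (h3 - (r / s * n0 + x / s * v) - (h4 - (- r / s * n0 + x / s * v)))) =
     (2 * n0 - 4 * (r ^+ 2 / s) * n0) + (r * h1 - r * h2) + (r * h3 - r * h4).
    by rewrite expr2; ring.
  lra.
have rN : - r <= r by lra.
have cc (k : R) (f : R -> R) : (forall x, - r <= x <= r -> {for x, continuous f}) ->
    forall x, - r <= x <= r -> {for x, continuous (fun x => k * f x)}.
  by move=> cf x xr; apply: cvgM; [exact: cvg_cst|exact: cf].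
have kc x : - r <= x <= r -> {for x, continuous (fun=> 2 * n0)}.
  by move=> _; exact: cst_continuous.
have cAB x : - r <= x <= r -> {for x, continuous
    (fun x => r * (P x (- r) - P x r) + r * (Q r x - Q (- r) x))}.
  by move=> xr; apply: cvgD; exact: (cc r _ _ x).
have := @itv_int_mono R (fun x => 2 * n0 + (r * (P x (- r) - P x r) + r * (Q r x - Q (- r) x)))
   N (- r) r _ cN key.
rewrite (itv_intD kc cAB) (itv_intD (cc r _ cA) (cc r _ cB)).
rewrite (itv_intZ r cA) (itv_intZ r cB) -mulrDr I0 mulr0 addr0 itv_int_cst// => h.
have -> : 4 * r * rnorm (H 0) = 2 * n0 * (r - - r) by rewrite /n0; ring.
apply: h => x xr; apply: cvgD; [exact: cvg_cst|exact: cAB].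
Qed.

End CauchyInequality.

(** * The complex exponential *)

Section ComplexExponential.
Context {R : realType}.
Implicit Types (z w k : R[i]) (x y t : R).

Lemma cexpD z w : cexp (z + w) = cexp z * cexp w.
Proof.
case: z => a b; case: w => c d; rewrite /cexp /= expRD cosD sinD.
by apply/eqP; rewrite eq_complex /=; apply/andP; split; apply/eqP; ring.
Qed.

Lemma cexp0 : cexp (0 : R[i]) = 1.
Proof. by rewrite /cexp /= expR0 cos0 sin0 mul1r. Qed.

Lemma cabs_cexp z : cabs (cexp z) = expR (complex.Re z).
Proof.
rewrite /cexp cabsM cabs_re cabsE cos2Dsin2 sqrtr1 mulr1.
by rewrite ger0_norm// expR_ge0.
Qed.

Lemma is_derive_contact (f : R -> R) x (D : R) : is_derive x 1 f D ->
  forall e, 0 < e -> exists2 dl, 0 < dl & forall h, `|h| <= dl ->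
    `|f (h + x) - f x - h * D| <= e * `|h|.
Proof.
move=> fD e e0; have df : derivable f x 1 by exact: ex_derive.
have : h^-1 *: ((f \o shift x) (h *: 1) - f x) @[h --> 0^'] --> 'D_1 f x by exact: df.
rewrite derive_val => /cvgrPdist_lt/(_ _ e0).
move=> /nbhs_ballP[k /= k0 kF]; exists (k / 2); first by rewrite divr_gt0.
move=> h hk; have [->|h0] := eqVneq h 0.
  by rewrite add0r subrr mul0r subr0 normr0 mulr0.
have := kF h; rewrite /ball /= sub0r normrN => /(_ ltac:(lra) h0).
rewrite [h *: 1]mulr1 => hD.
have -> : f (h + x) - f x - h * D = - (h * (D - h^-1 *: (f (h + x) - f x))).
  by rewrite /GRing.scale /=; field.
by rewrite normrN normrM mulrC ler_wpM2r// ltW.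
Qed.

(** The derivative of the exponential at 0, from the derivatives at 0 of the three
    real functions that define it. *)
Lemma cexp_contact (e : R) : 0 < e -> exists2 dl, 0 < dl & forall k,
  cabs k <= dl -> cabs (cexp k - 1 - k) <= e * cabs k.
Proof.
move=> e0.
have [d1 d10 h1] := is_derive_contact (is_derive_expR (0 : R)) (e := Num.min (e / 8) 1)
  ltac:(by rewrite lt_min divr_gt0/=).
have [d2 d20 h2] := is_derive_contact (is_derive_cos (0 : R)) (e := e / 16) ltac:(by rewrite divr_gt0).
have [d3 d30 h3] := is_derive_contact (is_derive_sin (0 : R)) (e := e / 16) ltac:(by rewrite divr_gt0).
pose dl := Num.min (Num.min d1 d2) (Num.min d3 (Num.min (1 / 2) (e / 8))).
exists dl; first by rewrite !lt_min d10 d20 d30 /= !divr_gt0.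
move=> [a b] abd.
have ad := le_trans (cabs_ge_re a b) abd; have bd := le_trans (cabs_ge_im a b) abd.
move: ad bd; rewrite /dl !le_min => /andP[/andP[ad1 _] /andP[_ /andP[ah ae]]].
move=> /andP[/andP[_ bd2] /andP[bd3 /andP[bh be]]].
have := h1 a ad1; have := h2 b bd2; have := h3 b bd3.
rewrite !addr0 expR0 cos0 sin0 !mulr1 subr0 oppr0 mulr0 subr0 => s3 s2 s1.
have na := normr_ge0 a; have nb := normr_ge0 b.
have s1' : `|expR a - 1 - a| <= e / 8 * `|a|.
  by rewrite (le_trans s1)// ler_wpM2r// ge_min lexx.
have s1'' : `|expR a - 1 - a| <= `|a|.
  by rewrite (le_trans s1)// -[leRHS]mul1r ler_wpM2r// ge_min lexx orbT.
have e2 : `|expR a| <= 2.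
  rewrite (ger0_norm (expR_ge0 a)).
  by have := ler_norm (expR a - 1 - a); have := ler_norm a; lra.
have e1 : `|expR a - 1| <= 2 * `|a|.
  move: s1''; have := lerB_normD (expR a - 1) (- a); rewrite normrN; lra.
have -> : cexp (a +i* b) - 1 - (a +i* b) =
    (expR a * (cos b - 1) + (expR a - 1 - a)) +i* (expR a * (sin b - b) + (expR a - 1) * b).
  by rewrite /cexp /=; apply/eqP; rewrite eq_complex /=; apply/andP; split; apply/eqP; ring.
apply: (le_trans (cabs_le _ _)).
have r1 : `|expR a * (cos b - 1) + (expR a - 1 - a)| <= e / 8 * `|b| + e / 8 * `|a|.
  rewrite (le_trans (ler_normD _ _))// lerD// normrM.
  rewrite (le_trans (ler_pM _ _ e2 s2))//; lra.
have r2 : `|expR a * (sin b - b) + (expR a - 1) * b| <= e / 8 * `|b| + 2 * `|a| * (e / 8).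
  rewrite (le_trans (ler_normD _ _))// lerD// normrM.
    by rewrite (le_trans (ler_pM _ _ e2 s3))//; lra.
  by rewrite ler_pM.
have A := cabs_ge_re a b; have B := cabs_ge_im a b.
have : e * `|a| <= e * cabs (a +i* b) by rewrite ler_pM2l.
have : e * `|b| <= e * cabs (a +i* b) by rewrite ler_pM2l.
have C : 0 <= e * `|a| by rewrite mulr_ge0// ltW.
have C' : 0 <= e * `|b| by rewrite mulr_ge0// ltW.
lra.
Qed.

Lemma cdiff_cexp (a : R[i]) z : cdiff (fun w => cexp (w * a) : R[i]^o) z.
Proof.
exists (cexp (z * a) * a : R[i]^o) => e e0.
pose B := cabs (cexp (z * a)) * cabs a + 1; have B0 : 0 < B.
  by rewrite /B ltr_wpDl// mulr_ge0// cabs_ge0.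
have [dl dl0 h] := cexp_contact (divr_gt0 e0 B0).
have a0 := cabs_ge0 a.
exists (dl / (cabs a + 1)); first by rewrite divr_gt0//; lra.
move=> w; rewrite ler_pdivlMr; last by lra.
move=> wd; set k := w - z.
change (cabs (cexp (w * a) - cexp (z * a) - k * (cexp (z * a) * a)) <= e * cabs k).
have -> : cexp (w * a) = cexp (z * a) * cexp (k * a).
  by rewrite -cexpD /k; congr cexp; ring.
have -> : cexp (z * a) * cexp (k * a) - cexp (z * a) - k * (cexp (z * a) * a) =
    cexp (z * a) * (cexp (k * a) - 1 - k * a) by ring.
rewrite cabsM; have kd : cabs (k * a) <= dl.
  by rewrite cabsM (le_trans _ wd)// ler_wpM2l ?cabs_ge0//; lra.
apply: (@le_trans _ _ (cabs (cexp (z * a)) * (e / B * cabs (k * a)))).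
  by rewrite ler_wpM2l ?cabs_ge0// h.
rewrite cabsM.
have -> : cabs (cexp (z * a)) * (e / B * (cabs k * cabs a)) =
   (e * cabs k) * ((B - 1) / B) by rewrite /B; ring.
rewrite ler_piMr ?mulr_ge0 ?cabs_ge0// ?ltW// ltr_pdivrMr// mul1r; lra.
Qed.

Lemma cdiff_real_continuous (c : R[i] -> R[i]^o) :
  (forall z, cdiff c z) -> {within Rplus, continuous (fun t : R => c t%:C)}.
Proof.
move=> dc; apply: continuous_subspaceT => t; apply/cvg_rnormP => e e0.
have e2 : 0 < e / 2 by rewrite divr_gt0.
have [dl dl0 h] := cdiff_continuous (dc t%:C) e2.
apply/nbhs_ballP; exists dl => // s /= /ltW ts.
have st : cabs (s%:C - t%:C) <= dl by rewrite -rmorphB /= cabs_re distrC.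
by rewrite rnorm_distC (le_lt_trans (h _ st))//; lra.
Qed.

End ComplexExponential.

(** * Truncated Laplace transforms *)

Section Kernels.
Context {R : realType} {X : completeNormedModType R[i]}.
Local Notation mu := (@lebesgue_measure R).
Implicit Types (D : set (measurableTypeR R)) (u : X -> R) (k z : R[i]) (t s x : R) (c : R -> R[i]^o).
(* [h] is a representative of [f] that is a limit of simple functions everywhere,
   so that its norm is measurable *)
Variables (f h : R -> X) (N : set R).
Hypothesis mN : measurable N.
Hypothesis N0 : mu N = 0%E.
Hypothesis fh : forall t, Rplus t -> ~ N t -> f t = h t.
Hypothesis hl : simple_limit mu Rplus h.

Lemma Rintegral_le_ge0 D (g G : R -> R) : measurable D ->
    mu.-integrable D (EFin \o g) -> measurable_fun D G ->
    (forall s, D s -> `|g s| <= G s) ->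
  ((\int[mu]_(s in D) g s)%:E <= \int[mu]_(s in D) (G s)%:E)%E.
Proof.
move=> mD gi mG gG; rewrite /Rintegral fineK ?integrable_fin_num//.
apply: (le_trans (lee_abs _)).
have mg := measurable_int mu gi.
apply: (le_trans (le_abse_integral mu mD mg)); apply: ge0_le_integral => //.
- exact: measurableT_comp.
- exact/measurable_EFinP.
Qed.

Lemma measurable_cabs c : {within Rplus, continuous c} ->
  measurable_fun Rplus (fun s => cabs (c s)).
Proof. by move=> cc; exact: (simple_limit_rnorm (continuous_simple_limit cc)). Qed.

Lemma measurable_rnorm_rep : measurable_fun Rplus (fun s => rnorm (h s)).
Proof. exact: (simple_limit_rnorm hl). Qed.

(** Multiplication by a nonzero [k] followed by [u] is [cabs k] times a functional
    of norm at most 1, so that [bochner_rfun] applies to it. *)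
Lemma kernel_rfun D c k u : measurable D -> D `<=` Rplus ->
    {within Rplus, continuous c} ->
    mu.-integrable D (fun s => (cabs (c s) * rnorm (h s))%:E) ->
    real_functional u ->
  mu.-integrable D (EFin \o (fun s => u ((k * c s : R[i]) *: h s))) /\
  u (k *: bochner mu D (fun s => (c s : R[i]) *: f s)) =
    \int[mu]_(s in D) u ((k * c s : R[i]) *: h s).
Proof.
move=> mD DR cc ci hu.
have sl : simple_limit mu D (fun s => (c s : R[i]) *: h s).
  by apply: simple_limit_restrict (simple_limit_scale cc hl) => //; exact: measurable_Rplus.
have [->|k0] := eqVneq k 0.
  have E : (fun s => u ((0 * c s : R[i]) *: h s)) = cst 0.
    by apply/funext => s; rewrite mul0r scale0r rfun0.
  rewrite E; split; first exact: integrable0.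
  by rewrite scale0r rfun0// /Rintegral integral0.
have ck := cabs_gt0 k0.
pose u' v := (cabs k)^-1 * u (k *: v).
have hu' : real_functional u'.
  split=> [v w|a v|v]; rewrite /u'.
  - by rewrite scalerDr rfunD// mulrDr.
  - by rewrite scalerA [_ * a%:C]mulrC -scalerA rfunZ//; ring.
  - rewrite normrM ger0_norm ?invr_ge0 ?cabs_ge0// ler_pdivrMl//.
    by rewrite (le_trans (rfun_le _ hu))// rnormZ.
have uE v : u (k *: v) = cabs k * u' v by rewrite /u' mulrA divff ?mul1r// gt_eqF.
have ci' : mu.-integrable D (fun s => (rnorm ((c s : R[i]) *: h s))%:E).
  by under eq_fun do rewrite rnormZ.
have iu' : mu.-integrable D (EFin \o (fun s => u' ((c s : R[i]) *: h s))).
  apply: le_integrable ci' => //.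
    by apply/measurable_EFinP; exact: (simple_limit_rfun sl hu').
  by move=> s _ /=; rewrite lee_fin [leRHS]ger0_norm ?rnorm_ge0// rfun_le.
have E : (fun s => u ((k * c s : R[i]) *: h s)) = (fun s => cabs k * u' ((c s : R[i]) *: h s)).
  by apply/funext => s; rewrite -scalerA uE.
rewrite E; split.
  exact: (integrableZl mD (cabs k) iu').
rewrite uE RintegralZl//; congr (_ * _).
apply: (bochner_rfun mD mN N0 _ sl ci' hu') => s Ds Ns.
by rewrite fh//; exact: DR.
Qed.

Definition laplace_kernel z s : R[i]^o := cexp (- (z * s%:C)).

Lemma cabs_kernel z s : cabs (laplace_kernel z s) = expR (- (complex.Re z * s)).
Proof. by rewrite /laplace_kernel cabs_cexp; case: z => a b /=; rewrite mulr0 subr0. Qed.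

Lemma kernel_cdiff z w : cdiff (fun v => cexp (- (z * v)) : R[i]^o) w.
Proof.
apply: (@cdiff_ext _ _ _ (fun v => cexp (v * - z) : R[i]^o)); last exact: cdiff_cexp.
by move=> v /=; congr cexp; ring.
Qed.

Lemma kernel_continuous z : {within Rplus, continuous (laplace_kernel z)}.
Proof. exact: (cdiff_real_continuous (kernel_cdiff z)). Qed.

Definition truncated_laplace t z : X :=
  bochner mu `[0, t] (fun s => (laplace_kernel z s : R[i]) *: f s).

Hypothesis hexp : forall x, 0 < x ->
  mu.-integrable Rplus (fun s => (expR (- (x * s)) * rnorm (h s))%:E).

Lemma itv0_Rplus t : `[0, t] `<=` (@Rplus R).
Proof. by move=> s /=; rewrite in_itv /= => /andP[s0 _]; rewrite Rplus_ge0. Qed.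

Lemma locally_integrable_rep t : mu.-integrable `[0, t] (fun s => (rnorm (h s))%:E).
Proof.
have i1 : mu.-integrable `[0, t] (fun s => ((expR t)%:E * (expR (- (1 * s)) * rnorm (h s))%:E)%E).
  apply: integrableZl => //; apply: integrableS (hexp ltr01) => //.
  - exact: measurable_Rplus.
  - exact: itv0_Rplus.
apply: le_integrable i1 => //.
  apply/measurable_EFinP; apply: measurable_funS measurable_rnorm_rep; first exact: measurable_Rplus.
  exact: itv0_Rplus.
move=> s /=; rewrite in_itv /= => /andP[s0 st]; rewrite lee_fin.
rewrite !ger0_norm ?rnorm_ge0 ?mulr_ge0 ?expR_ge0 ?rnorm_ge0// mulrA -expRD.
rewrite -[leLHS]mul1r ler_wpM2r ?rnorm_ge0// -[leLHS]expR0 ler_expR; lra.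
Qed.

Lemma bounded_kernel_integrable t c : {within Rplus, continuous c} ->
    (exists M : R, forall s, 0 <= s <= t -> cabs (c s) <= M) ->
  mu.-integrable `[0, t] (fun s => (cabs (c s) * rnorm (h s))%:E).
Proof.
move=> cc [M cM].
have i1 : mu.-integrable `[0, t] (fun s => (M%:E * (rnorm (h s))%:E)%E).
  by apply: integrableZl => //; exact: locally_integrable_rep.
apply: le_integrable i1 => //.
  apply/measurable_EFinP; apply: (@measurable_funS _ _ _ _ Rplus).
  - exact: measurable_Rplus.
  - exact: itv0_Rplus.
  - by apply: measurable_funM; [exact: measurable_cabs|exact: measurable_rnorm_rep].
move=> s /=; rewrite in_itv /= => s0t; rewrite lee_fin.
have M0 : 0 <= M by rewrite (le_trans _ (cM _ s0t))// cabs_ge0.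
by rewrite !ger0_norm ?rnorm_ge0 ?mulr_ge0 ?cabs_ge0 ?rnorm_ge0// ler_wpM2r ?rnorm_ge0// cM.
Qed.

Lemma kernel_itv_bound z t s : 0 <= s <= t ->
  cabs (laplace_kernel z s) <= expR (`|complex.Re z| * t).
Proof.
move=> /andP[s0 st]; rewrite cabs_kernel ler_expR -mulNr.
rewrite (@le_trans _ _ (`|complex.Re z| * s))//; last by rewrite ler_wpM2l.
by rewrite ler_wpM2r// -normrN ler_norm.
Qed.

Lemma kernel_itv_integrable z t :
  mu.-integrable `[0, t] (fun s => (cabs (laplace_kernel z s) * rnorm (h s))%:E).
Proof.
apply: bounded_kernel_integrable; first exact: kernel_continuous.
by exists (expR (`|complex.Re z| * t)) => s; exact: kernel_itv_bound.
Qed.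

Let absorb_le (a b c e m : R) : 0 <= a -> 0 <= b -> 0 <= c -> 0 <= e -> 0 <= m ->
  a * (e / (a * b * c + 1) * (m * b)) * c <= e * m.
Proof.
move=> a0 b0 c0 e0 m0; have B0 : 0 < a * b * c + 1 by rewrite ltr_wpDl// !mulr_ge0.
have -> : a * (e / (a * b * c + 1) * (m * b)) * c =
  (e * m) * ((a * b * c) / (a * b * c + 1)) by ring.
by rewrite ler_piMr ?mulr_ge0// ler_pdivrMr// mul1r lerDl ler01.
Qed.

(** Truncated Laplace integrals are entire: differentiate under the integral
    sign, the first-order contact of the exponential being uniform over the
    bounded range of integration. *)
Lemma truncated_laplace_cdiff t z : 0 <= t -> cdiff (truncated_laplace t) z.
Proof.
move=> t0; pose I := \int[mu]_(s in `[0, t]) rnorm (h s).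
have I0 : 0 <= I by apply: Rintegral_ge0 => s _; exact: rnorm_ge0.
pose E0 := expR (`|complex.Re z| * t).
have E00 : 0 < E0 by exact: expR_gt0.
pose c' s : R[i]^o := - s%:C * laplace_kernel z s.
have cc' : {within Rplus, continuous c'}.
  apply: (cdiff_real_continuous (c := fun w => (- w) * cexp (- (z * w)))) => w.
  apply: cdiffZ; last exact: kernel_cdiff.
  apply: (@cdiff_ext _ _ _ (fun w => (0 : R[i]^o) - w)); first by move=> v; rewrite sub0r.
  by apply: cdiffB; [exact: cdiff_cst|exact: cdiff_id].
have ic' : mu.-integrable `[0, t] (fun s => (cabs (c' s) * rnorm (h s))%:E).
  apply: bounded_kernel_integrable => //; exists (t * E0) => s s0t.
  rewrite cabsM cabsN cabs_re ler_pM ?cabs_ge0//; last exact: kernel_itv_bound.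
  by rewrite ger0_norm; lra.
have mD : measurable (`[0, t] : set (measurableTypeR R)) by exact: measurable_itv.
have DR := @itv0_Rplus t.
exists (bochner mu `[0, t] (fun s => (c' s : R[i]) *: f s)) => e e0.
pose B := E0 * t * I + 1; have B0 : 0 < B by rewrite /B ltr_wpDl// !mulr_ge0// ltW.
have [dl dl0 hd] := cexp_contact (divr_gt0 e0 B0).
exists (dl / (t + 1)); first by rewrite divr_gt0//; lra.
move=> w; rewrite ler_pdivlMr; last by lra.
move=> wd; set v := _ - _ - _; have [u hu <-] := norming_functional v.
have [i1 e1] := kernel_rfun 1 mD DR (@kernel_continuous w) (kernel_itv_integrable w t) hu.
have [i2 e2] := kernel_rfun 1 mD DR (@kernel_continuous z) (kernel_itv_integrable z t) hu.
have [i3 e3] := kernel_rfun (w - z) mD DR cc' ic' hu.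
have -> : u v = \int[mu]_(s in `[0, t]) (u ((1 * laplace_kernel w s : R[i]) *: h s) -
    u ((1 * laplace_kernel z s : R[i]) *: h s) - u (((w - z) * c' s : R[i]) *: h s)).
  rewrite (RintegralB mD (integrableB mD i1 i2) i3) (RintegralB mD i1 i2).
  rewrite -e1 -e2 -e3 2!scale1r; apply: (etrans (rfunB _ _ hu)).
  by congr (_ - _); exact: rfunB.
have i12 := integrableB mD (integrableB mD i1 i2) i3.
have pt s : 0 <= s <= t -> `|u ((1 * laplace_kernel w s : R[i]) *: h s) -
    u ((1 * laplace_kernel z s : R[i]) *: h s) - u (((w - z) * c' s : R[i]) *: h s)| <=
    (E0 * (e / B * (cabs (w - z) * t))) * rnorm (h s).
  move=> s0t; have /andP[s0 st] := s0t; rewrite -!rfunB// -!scalerBl.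
  rewrite (le_trans (rfun_le _ hu))// rnormZ ler_wpM2r ?rnorm_ge0//.
  set k := - ((w - z) * s%:C).
  have -> : 1 * laplace_kernel w s - 1 * laplace_kernel z s - (w - z) * c' s =
      laplace_kernel z s * (cexp k - 1 - k) :> R[i].
    rewrite /c' /laplace_kernel !mul1r.
    have -> : cexp (- (w * s%:C)) = cexp (- (z * s%:C)) * cexp k.
      by rewrite -cexpD /k; congr cexp; ring.
    by rewrite /k; ring.
  have ck : cabs k = cabs (w - z) * s by rewrite /k cabsN cabsM cabs_re ger0_norm.
  have ckt : cabs k <= cabs (w - z) * t by rewrite ck ler_wpM2l ?cabs_ge0.
  rewrite -/(cabs _) cabsM ler_pM ?cabs_ge0//; first exact: kernel_itv_bound.
  have kd : cabs k <= dl.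
    by rewrite (le_trans ckt)// (le_trans _ wd)// ler_wpM2l ?cabs_ge0// lerDl ler01.
  by rewrite (le_trans (hd _ kd))// ler_wpM2l// ltW// divr_gt0.
apply: (le_trans (ler_norm _)).
apply: (le_trans (le_normr_Rintegral mD i12)).
have iphi := locally_integrable_rep t.
apply: (@le_trans _ _ (\int[mu]_(s in `[0, t]) ((E0 * (e / B * (cabs (w - z) * t))) * rnorm (h s)))).
  apply: le_Rintegral => //; first exact: integrable_norm.
  exact: (integrableZl mD _ iphi).
rewrite (RintegralZl _ mD iphi) -/I.
exact: absorb_le (ltW E00) t0 I0 (ltW e0) (cabs_ge0 _).
Qed.

Definition exponential_kernel x t s : R := expR (- (x * `|s - t|)).

Lemma cabs_shifted_kernel z t s :
  cabs (cexp (z * t%:C) * laplace_kernel z s) = expR (complex.Re z * (t - s)).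
Proof.
rewrite cabsM cabs_kernel cabs_cexp -expRD; congr expR.
by case: z => a b /=; rewrite mulr0 subr0; ring.
Qed.

Lemma measurable_rnorm_rep_on D : measurable D -> D `<=` Rplus ->
  measurable_fun D (fun s => rnorm (h s)).
Proof. by move=> mD DR; apply: measurable_funS measurable_rnorm_rep => //; exact: measurable_Rplus. Qed.

Lemma measurable_exponential_kernel x t D : measurable_fun D (exponential_kernel x t).
Proof.
apply: measurableT_comp => //; apply: measurableT_comp => //.
apply: measurable_funM => //; apply: measurableT_comp => //.
by apply: measurable_funB.
Qed.

Lemma exponential_kernel_le D x t : measurable D -> D `<=` Rplus ->
  (\int[mu]_(s in D) (exponential_kernel x t s * rnorm (h s))%:E <=
   \int[mu]_(s in Rplus) (exponential_kernel x t s * rnorm (h s))%:E)%E.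
Proof.
move=> mD DR; apply: ge0_subset_integral => //.
- exact: measurable_Rplus.
- apply/measurable_EFinP; apply: measurable_funM; last exact: measurable_rnorm_rep.
  exact: measurable_exponential_kernel.
- by move=> s _; rewrite lee_fin mulr_ge0 ?expR_ge0 ?rnorm_ge0.
Qed.

(** To the left of the imaginary axis [e^(t z) e^(- z s)] decays as [s] moves from
    [t] into the past, and only [s <= t] occurs. *)
Lemma truncated_laplace_bound t z : complex.Re z <= 0 ->
  ((rnorm (cexp (z * t%:C) *: truncated_laplace t z))%:E <=
   \int[mu]_(s in Rplus) (exponential_kernel `|complex.Re z| t s * rnorm (h s))%:E)%E.
Proof.
move=> z0; have mD : measurable (`[0, t] : set (measurableTypeR R)) by exact: measurable_itv.
apply: le_trans (exponential_kernel_le _ _ mD (@itv0_Rplus t)).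
have [u hu <-] := norming_functional (cexp (z * t%:C) *: truncated_laplace t z).
have [i1 ->] := kernel_rfun (cexp (z * t%:C)) mD (@itv0_Rplus t) (@kernel_continuous z)
  (kernel_itv_integrable z t) hu.
apply: Rintegral_le_ge0 => //.
  apply: measurable_funM; first exact: measurable_exponential_kernel.
  by apply: measurable_rnorm_rep_on => //; exact: itv0_Rplus.
move=> s /=; rewrite in_itv /= => /andP[s0 st].
rewrite (le_trans (rfun_le _ hu))// rnormZ ler_wpM2r ?rnorm_ge0//.
rewrite [leLHS]cabs_shifted_kernel /exponential_kernel ler_expR ler0_norm// ler0_norm; last by lra.
lra.
Qed.

(** To its right the same product decays as [s] moves into the future, and only
    [s > t] occurs in the difference. *)
Lemma laplace_tail_bound t z : 0 <= t -> 0 < complex.Re z ->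
  ((rnorm (cexp (z * t%:C) *: (laplace f z - truncated_laplace t z)))%:E <=
   \int[mu]_(s in Rplus) (exponential_kernel `|complex.Re z| t s * rnorm (h s))%:E)%E.
Proof.
move=> t0 z0; have mD : measurable (`[0, t] : set (measurableTypeR R)) by exact: measurable_itv.
have mT : measurable (`]t, +oo[ : set (measurableTypeR R)) by exact: measurable_itv.
have TR : (`]t, +oo[ : set R) `<=` Rplus.
  by move=> s /=; rewrite in_itv /= andbT Rplus_ge0; lra.
apply: le_trans (exponential_kernel_le _ _ mT TR).
have [u hu <-] := norming_functional (cexp (z * t%:C) *: (laplace f z - truncated_laplace t z)).
have [i1 e1] := kernel_rfun (cexp (z * t%:C)) mD (@itv0_Rplus t) (@kernel_continuous z)
  (kernel_itv_integrable z t) hu.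
have iz : mu.-integrable Rplus (fun s => (cabs (laplace_kernel z s) * rnorm (h s))%:E).
  by under eq_fun do rewrite cabs_kernel; exact: hexp.
have [i2 e2] := kernel_rfun (cexp (z * t%:C)) measurable_Rplus (@subset_refl _ _)
  (@kernel_continuous z) iz hu.
have e2' : u (cexp (z * t%:C) *: laplace f z) = _ := e2.
have b1 : (BLeft 0 <= BRight t)%O by rewrite bnd_simp.
have b2 : (BRight t <= +oo)%O by rewrite bnd_simp.
have -> : u (cexp (z * t%:C) *: (laplace f z - truncated_laplace t z)) =
    \int[mu]_(s in `]t, +oo[) u ((cexp (z * t%:C) * laplace_kernel z s : R[i]) *: h s).
  rewrite scalerBr; apply: (etrans (rfunB _ _ hu)).
  exact: etrans (congr2 (fun a b => a - b) e2' e1) (Rintegral_itvB i2 b1 b2).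
move: {e1 e2 e2' iz} i2 => i2.
apply: Rintegral_le_ge0 => //.
- by apply: integrableS i2 => //; exact: measurable_Rplus.
- apply: measurable_funM; first exact: measurable_exponential_kernel.
  exact: measurable_rnorm_rep_on.
move=> s /=; rewrite in_itv /= andbT => ts.
rewrite (le_trans (rfun_le _ hu))// rnormZ ler_wpM2r ?rnorm_ge0//.
rewrite [leLHS]cabs_shifted_kernel /exponential_kernel ler_expR (gtr0_norm z0).
by rewrite gtr0_norm ?subr_gt0// -mulrN opprB.
Qed.

End Kernels.

(** * The Cauchy kernel *)

Section CauchyKernel.
Context {R : realType}.
Local Notation mu := (@lebesgue_measure R).
Implicit Types (a d r s t x : R).

Definition cauchy_kernel d : R := (1 + d ^+ 2)^-1.

Lemma cauchy_kernel_gt0 d : 0 < cauchy_kernel d.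
Proof. by rewrite invr_gt0 ltr_pwDl// sqr_ge0. Qed.

Lemma cauchy_kernel_le1 d : cauchy_kernel d <= 1.
Proof. by rewrite invf_le1 ?lerDl ?sqr_ge0// ltr_pwDl// sqr_ge0. Qed.

Lemma cauchy_kernel_continuous t x : {for x, continuous (fun s => cauchy_kernel (s - t))}.
Proof.
apply: cvgV; first by rewrite gt_eqF// ltr_pwDl// sqr_ge0.
apply: cvgD; first exact: cvg_cst.
apply: (@cvg_comp _ _ _ (fun s => s - t) (fun y => y ^+ 2)).
  by apply: cvgB; [exact: cvg_id|exact: cvg_cst].
exact: exprn_continuous.
Qed.

Lemma integral_cauchy_kernel t :
  (\int[mu]_(s in Rplus) (cauchy_kernel (s - t))%:E <= (pi : R)%:E)%E.
Proof.
have dF x : is_derive x 1 (fun s => atan (s - t)) (cauchy_kernel (x - t)).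
  have dB : is_derive x 1 (fun s : R => s - t) 1.
    by apply: is_derive_eq; rewrite subr0.
  by have := @is_derive1_comp _ atan (fun s => s - t) x _ _ (is_derive1_atan (x - t)) dB; rewrite mulr1.
rewrite /Rplus (@ge0_continuous_FTC2y _ _ (fun s => atan (s - t)) 0 (pi / 2)).
- rewrite -EFinB lee_fin; have := atan_gtNpi2 (0 - t); lra.
- by move=> x _; rewrite ltW// cauchy_kernel_gt0.
- apply: continuous_subspaceT => x; exact: cauchy_kernel_continuous.
- apply: (@cvg_comp _ _ _ (fun s => s - t) atan _ +oo); last exact: cvgy_atan.
  exact: cvg_addrr.
- by move=> x _; have := dF x => ?; exact: ex_derive.
- by apply: cvg_at_right_filter; exact: (derive_continuous (dF 0)).
- by move=> x _; rewrite derive1E; have := dF x => ?; exact: derive_val.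
Qed.

Lemma cauchy_kernel_ge d : 0 <= d -> (1 + d) ^- 2 <= cauchy_kernel d.
Proof.
move=> d0; rewrite lef_pV2 ?posrE ?exprn_gt0 ?ltr_pwDl ?sqr_ge0//; nra.
Qed.

(** Raising the rate of decay from [d] to [1 + d] costs a factor [e ^ r] and gives
    an integral at most [(1 + d) ^ - 2], bounded also near [d = 0]. *)
Lemma itv_int_linear_exp r d : 0 < r -> r <= 1 -> 0 <= d ->
  itv_int (fun x => x * expR (- (x * d))) 0 r <= expR r * cauchy_kernel d.
Proof.
move=> r0 r1 d0; pose a := 1 + d; have a0 : 0 < a by rewrite /a; lra.
have dE x : is_derive x 1 (fun x : R => expR (- (x * a))) (- a * expR (- (x * a))).
  have dl : is_derive x 1 (fun x : R => - (x * a)) (- a).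
    by apply: is_derive_eq; rewrite /GRing.scale /= mulr0 add0r mulr1.
  by have := @is_derive1_comp _ expR (fun x => - (x * a)) x _ _ (is_derive_expR _) dl; rewrite mulrC.
have cE x : {for x, continuous (fun x : R => expR (- (x * a)))} := derive_continuous (dE x).
have dF x : is_derive x 1 (fun x => - (x / a + (a ^+ 2)^-1) * expR (- (x * a))) (x * expR (- (x * a))).
  have dl : is_derive x 1 (fun x : R => - (x / a + (a ^+ 2)^-1)) (- a^-1).
    by apply: is_derive_eq; rewrite /GRing.scale /= mulr0 add0r mulr1 addr0.
  apply: is_derive_eq; rewrite /GRing.scale /=; field; lra.
have cf x : {for x, continuous (fun x : R => x * expR (- (x * a)))}.
  by apply: cvgM; [exact: cvg_id|exact: cE].
have cg x : {for x, continuous (fun x : R => x * expR (- (x * d)))}.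
  apply: cvgM; first exact: cvg_id.
  apply: (@cvg_comp _ _ _ (fun x => - (x * d)) expR); last exact: continuous_expR.
  by apply: cvgN; apply: cvgM; [exact: cvg_id|exact: cvg_cst].
apply: (@le_trans _ _ (itv_int (fun x => expR r * (x * expR (- (x * a)))) 0 r)).
  apply: itv_int_mono => // [x _|x /andP[x0 xr]].
    by apply: cvgM; [exact: cvg_cst|exact: cf].
  rewrite mulrCA ler_wpM2l// -expRD ler_expR /a; lra.
rewrite itv_intZ// ler_wpM2l ?expR_ge0// (itv_int_FTC r0 dF cf).
rewrite !mul0r oppr0 expR0 !mulr1 add0r opprK.
apply: le_trans (cauchy_kernel_ge d0); rewrite -[leRHS]add0r lerD2r.
by rewrite mulNr oppr_le0 mulr_ge0 ?expR_ge0// addr_ge0 ?divr_ge0 ?invr_ge0 ?sqr_ge0 ?ltW.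
Qed.

End CauchyKernel.

(** * Integrating exponential kernels over the contour *)

Section SmoothedKernel.
Context {R : realType}.
Implicit Types (a b d r s t x : R).

(** The majorant, at distance [d] in time, of the four boundary terms of
    abscissa or ordinate [x]: the two horizontal edges, where the weight is of the
    order of [|x|], and the two vertical ones. *)
Definition contour_kernel r x d : R :=
  6 / r * (`|x| * expR (- (`|x| * `|d|))) + 6 * expR (- (r * `|d|)).

(** The horizontal part is twice [6 / r] times the bound of [itv_int_linear_exp], the
    vertical part 6 times the length [2 r] times that of [exp_le_cauchy_kernel]. *)
Definition contour_const r : R := 12 / r * expR r + 48 / r.

Lemma contour_kernel_ge0 r x d : 0 < r -> 0 <= contour_kernel r x d.
Proof.
by move=> r0; rewrite addr_ge0// !mulr_ge0 ?expR_ge0// invr_ge0 ltW.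
Qed.

Lemma abs_exp_continuous d x :
  {for x, continuous (fun x : R => `|x| * expR (- (`|x| * `|d|)))}.
Proof.
have cn : {for x, continuous (@Num.norm R R)} by exact: norm_continuous.
apply: cvgM; first exact: cn.
apply: (@cvg_comp _ _ _ (fun x => - (`|x| * `|d|)) expR); last exact: continuous_expR.
by apply: cvgN; apply: cvgM; [exact: cn|exact: cvg_cst].
Qed.

Lemma contour_kernel_continuous r d x :
  {for x, continuous (fun x => contour_kernel r x d)}.
Proof.
apply: cvgD; last exact: cvg_cst.
by apply: cvgM; [exact: cvg_cst|exact: abs_exp_continuous].
Qed.

(** From [e ^ y >= (1 + y / 2) ^ 2] for [y = r d]. *)
Lemma exp_le_cauchy_kernel r d : 0 < r -> r <= 1 -> 0 <= d ->
  expR (- (r * d)) <= 4 / r ^+ 2 * cauchy_kernel d.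
Proof.
move=> r0 r1 d0; rewrite expRN /cauchy_kernel -mulrA -invfM -[leLHS]mul1r.
rewrite ler_pdivrMr ?expR_gt0// mulrAC ler_pdivlMr; last first.
  by rewrite mulr_gt0 ?exprn_gt0// ltr_pwDl// sqr_ge0.
have -> : expR (r * d) = expR (r * d / 2) ^+ 2.
  by rewrite expr2 -expRD; congr expR; field.
have h := expR_ge1Dx (r * d / 2).
have rd : 0 <= r * d / 2 by rewrite divr_ge0// mulr_ge0// ltW.
have h2 : (1 + r * d / 2) ^+ 2 <= expR (r * d / 2) ^+ 2.
  by rewrite lerXn2r ?nnegrE ?expR_ge0//; lra.
have r2 : r ^+ 2 <= 1 by rewrite expr_le1// ltW.
rewrite mul1r; apply: le_trans (_ : 4 * (1 + r * d / 2) ^+ 2 <= _); last by lra.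
by rewrite !expr2 in r2 *; lra.
Qed.

Lemma itv_int_contour_kernel r d : 0 < r -> r <= 1 -> 0 <= d ->
  itv_int (fun x => contour_kernel r x d) (- r) r <= contour_const r * cauchy_kernel d.
Proof.
move=> r0 r1 d0; have rN : - r <= r by lra.
pose p x := `|x| * expR (- (`|x| * `|d|)).
have cp x : {for x, continuous p} by exact: abs_exp_continuous.
have half : itv_int p 0 r <= expR r * cauchy_kernel d.
  apply: le_trans (itv_int_linear_exp r0 r1 d0).
  rewrite le_eqVlt; apply/orP; left; apply/eqP; apply: eq_Rintegral => x.
  by rewrite inE /= in_itv /= => /andP[x0 _]; rewrite /p !ger0_norm.
have even : itv_int p (- r) 0 = itv_int p 0 r.
  have := @integration_by_substitution_oppr R p 0 r (ltW r0).
  rewrite oppr0 => H; rewrite /itv_int /Rintegral H.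
    by congr fine; apply: eq_integral => x _ /=; rewrite /p normrN.
  by apply: continuous_subspaceT => x; exact: cp.
rewrite /contour_kernel itv_intD; last 2 first.
- by move=> x _; apply: cvgM; [exact: cvg_cst|exact: cp].
- by move=> x _; exact: cvg_cst.
rewrite (@itv_intZ _ _ p); last by move=> x _; exact: cp.
rewrite itv_int_cst// (@itv_int_split _ p _ 0); [|lra|lra|by move=> x _; exact: cp].
rewrite even (ger0_norm d0).
have r12 : 0 <= 12 / r by rewrite divr_ge0// ltW.
have e1 := ler_wpM2l r12 half.
have r12' : 0 <= 12 * r by rewrite mulr_ge0// ltW.
have e2 := ler_wpM2l r12' (exp_le_cauchy_kernel r0 r1 d0).
have -> : 6 / r * (itv_int p 0 r + itv_int p 0 r) + 6 * expR (- (r * d)) * (r - - r) =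
  12 / r * itv_int p 0 r + 12 * r * expR (- (r * d)) by ring.
apply: (le_trans (lerD e1 e2)); rewrite le_eqVlt; apply/orP; left; apply/eqP.
by rewrite /contour_const; field; lra.
Qed.

Lemma measurable_contour_kernel r t :
  measurable_fun [set: measurableTypeR R * measurableTypeR R]
    (fun xs => contour_kernel r xs.1 (xs.2 - t)).
Proof.
apply: measurable_funD.
  apply: measurable_funM => //; apply: measurable_funM.
    by apply: measurableT_comp => //; exact: measurable_fst.
  apply: measurableT_comp => //; apply: measurableT_comp => //.
  apply: measurable_funM; first by apply: measurableT_comp => //; exact: measurable_fst.
  by apply: measurableT_comp => //; apply: measurable_funB => //; exact: measurable_snd.
apply: measurable_funM => //; apply: measurableT_comp => //; apply: measurableT_comp => //.
apply: measurable_funM => //.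
by apply: measurableT_comp => //; apply: measurable_funB => //; exact: measurable_snd.
Qed.

Lemma measurable_cauchy_kernel :
  measurable_fun [set: measurableTypeR R * measurableTypeR R]
    (fun ts => cauchy_kernel (ts.2 - ts.1)).
Proof.
apply: (@measurableT_comp _ _ _ _ _ _ (fun d : R => cauchy_kernel d)).
  apply: continuous_measurable_fun => x.
  have h : continuous_at x (fun s => cauchy_kernel (s - 0)).
    exact: cauchy_kernel_continuous.
  by rewrite (_ : (fun s => _) = @cauchy_kernel R) in h => //; apply/funext => s; rewrite subr0.
by apply: measurable_funB; [exact: measurable_snd|exact: measurable_fst].
Qed.

End SmoothedKernel.

Section TonelliOn.
Context {R : realType}.
Local Notation mu := (@lebesgue_measure R).
Variables (D1 D2 : set (measurableTypeR R)).
Variables (k : measurableTypeR R * measurableTypeR R -> R) (phi : R -> R).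
Hypotheses (mD1 : measurable D1) (mD2 : measurable D2).
Hypotheses (k0 : forall z, 0 <= k z) (phi0 : forall s, 0 <= phi s).
Hypotheses (mk : measurable_fun setT k) (mphi : measurable_fun D2 phi).

Let G (z : measurableTypeR R * measurableTypeR R) : \bar R :=
  (k z * \1_D1 z.1 * (phi \_ D2) z.2)%:E.

Let G0 z : (0 <= G z)%E.
Proof.
by rewrite lee_fin !mulr_ge0//; rewrite /patch; case: ifP.
Qed.

Let mG : measurable_fun setT G.
Proof.
apply/measurable_EFinP; apply: measurable_funM.
  apply: measurable_funM => //.
  by apply: (measurableT_comp _ measurable_fst); exact: measurable_indic.
apply: (measurableT_comp _ measurable_snd).
by apply/(measurable_restrictT _ mD2).
Qed.

Let inner x : D1 x -> (\int[mu]_(s in D2) (k (x, s) * phi s)%:E = \int[mu]_s G (x, s))%E.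
Proof.
move=> D1x; rewrite integral_mkcond; apply: eq_integral => s _.
rewrite /G /= indicE mem_set// mulr1 /patch; case: ifP => //.
by rewrite mulr0.
Qed.

Lemma measurable_inner :
  measurable_fun D1 (fun x => \int[mu]_(s in D2) (k (x, s) * phi s)%:E)%E.
Proof.
apply: (@eq_measurable_fun _ _ _ _ D1 (fun x => \int[mu]_s G (x, s))%E).
  by move=> x; rewrite inE => D1x; rewrite inner.
apply: (@measurable_funS _ _ _ _ setT) => //.
exact: (measurable_fun_fubini_tonelli_F (m2 := mu) G).
Qed.

Lemma tonelli_on :
  (\int[mu]_(x in D1) \int[mu]_(s in D2) (k (x, s) * phi s)%:E =
   \int[mu]_(s in D2) ((\int[mu]_(x in D1) (k (x, s))%:E) * (phi s)%:E))%E.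
Proof.
rewrite [LHS](_ : _ = (\int[mu]_x \int[mu]_s G (x, s))%E); last first.
  rewrite [LHS]integral_mkcond; apply: eq_integral => x _; rewrite {1}/patch.
  case: ifPn => [/set_mem|] D1x; first exact: inner.
  rewrite integral0_eq// => s _; rewrite /G /= indicE (negbTE D1x).
  by rewrite mulr0 mul0r.
rewrite (fubini_tonelli (m1 := mu) (m2 := mu) G)//.
rewrite [RHS]integral_mkcond; apply: eq_integral => s _; rewrite {1}/patch.
case: ifPn => [/set_mem|] D2s; last first.
  by rewrite integral0_eq// => x _; rewrite /G /= /patch (negbTE D2s) mulr0.
rewrite -ge0_integralZr//; last 3 first.
- apply/measurable_EFinP; apply: (@measurable_funS _ _ _ _ setT) => //.
  by apply: measurableT_comp mk _; exact: measurable_pair2.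
- by move=> x _; rewrite lee_fin.
- by rewrite lee_fin.
rewrite [RHS]integral_mkcond; apply: eq_integral => x _.
rewrite /G /= {1}/patch mem_set// indicE; rewrite /patch.
by case: ifPn => D1x; [rewrite mulr1|rewrite mulr0 mul0r].
Qed.

End TonelliOn.

(** * Newman's contour argument *)

Section Newman.
Context {R : realType} {X : completeNormedModType R[i]}.
Local Notation mu := (@lebesgue_measure R).
Implicit Types (z w : R[i]) (t s x y : R).
Variables (f h : R -> X) (N : set R).
Hypothesis mN : measurable N.
Hypothesis N0 : mu N = 0%E.
Hypothesis fh : forall t, Rplus t -> ~ N t -> f t = h t.
Hypothesis hl : simple_limit mu Rplus h.
Hypothesis hexp : forall x, 0 < x ->
  mu.-integrable Rplus (fun s => (expR (- (x * s)) * rnorm (h s))%:E).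
Variables (U : set R[i]^o) (F : R[i]^o -> X).
Hypothesis lF : laplace_extension f U F.
Hypothesis U0 : U 0.

Let g t := F 0 - bochner mu `[0, t] f.

(** All that is used of the extension, besides the formula in the right
    half-plane, is a small closed square around the origin. *)
Lemma extension_square : exists r M : R, [/\ 0 < r, r <= 1, 0 <= M &
  forall x y, `|x| <= r -> `|y| <= r ->
    cdiff F (x +i* y) /\ rnorm (F (x +i* y)) <= M].
Proof.
have [oU _ _ hF _] := lF.
have /nbhs_ballP[e /= + eU] : nbhs (0 : R[i]^o) U by exact: open_nbhs_nbhs.
rewrite ltcE /= => /andP[/eqP e0 eR].
have [dl dl0 Fdl] := cdiff_continuous (derivable_cdiff (hF _ U0)) ltr01.
exists (Num.min 1 (Num.min (complex.Re e / 3) (dl / 2))), (rnorm (F 0) + 1); split.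
- by rewrite !lt_min ltr01 !divr_gt0.
- by rewrite ge_min lexx.
- by rewrite addr_ge0// rnorm_ge0.
move=> x y; rewrite !le_min => /andP[_ /andP[x1 x2]] /andP[_ /andP[y1 y2]].
have xy := cabs_le x y; split.
  apply: derivable_cdiff; apply: hF; apply: eU; rewrite -ball_normE /= sub0r normrN.
  rewrite (_ : `|_| = (cabs (x +i* y))%:C); last exact: (@rnormE R R[i]^o).
  by rewrite ltcE /= e0 eqxx /=; lra.
rewrite -[F _](subrK (F 0)) (le_trans (ler_rnormD _ _))// addrC lerD2l.
by apply: Fdl; rewrite subr0; lra.
Qed.

Lemma truncated_laplace0 t : truncated_laplace f t 0 = bochner mu `[0, t] f.
Proof.
rewrite /truncated_laplace; congr bochner; apply/funext => s.
by rewrite /laplace_kernel mul0r oppr0 cexp0 scale1r.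
Qed.

Let tail t x : \bar R := (\int[mu]_(s in Rplus) (exponential_kernel x t s * rnorm (h s))%:E)%E.

Let tail_ge0 t x : (0 <= tail t x)%E.
Proof. by apply: integral_ge0 => s _; rewrite lee_fin mulr_ge0 ?expR_ge0 ?rnorm_ge0. Qed.

(** To the left, [F] and the truncated integral are bounded separately, the first
    by [M] and the decay of [e^(t z)]; to the right, [F] is the transform itself and
    only the tail of the integral remains. *)
Lemma resolvent_bound t (M : R) z : 0 <= t -> rnorm (F z) <= M -> complex.Re z != 0 ->
  ((rnorm (cexp (z * t%:C) *: (F z - truncated_laplace f t z)))%:E <=
   tail t `|complex.Re z|%R + (M * expR (- (`|complex.Re z| * t)))%:E)%E.
Proof.
move=> t0 FM; rewrite neq_lt => /orP[z0|z0].
  rewrite scalerBr.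
  apply: (@le_trans _ _ ((rnorm (cexp (z * t%:C) *: truncated_laplace f t z))%:E +
    (rnorm (cexp (z * t%:C) *: F z))%:E)%E).
    by rewrite -EFinD lee_fin (le_trans (ler_rnormB _ _))// addrC.
  apply: leeD; first exact: (truncated_laplace_bound mN N0 fh hl hexp t (ltW z0)).
  rewrite lee_fin rnormZ mulrC ler_pM ?rnorm_ge0//.
  rewrite [leLHS]cabs_cexp ler_expR ltr0_norm//.
  by case: (z) => a b /=; rewrite mulr0 subr0; lra.
have [_ _ _ _ ->//] := lF.
apply: (@le_trans _ _ (tail t `|complex.Re z|%R)).
  exact: (laplace_tail_bound mN N0 fh hl hexp t0 z0).
rewrite leeDl// lee_fin mulr_ge0 ?expR_ge0//.
by rewrite (le_trans _ FM)// rnorm_ge0.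
Qed.

(** The factor [1 + z ^ 2 / r ^ 2], written as a product of scalings: it is 1 at the
    origin and vanishes where the boundary of the square meets the imaginary axis,
    where the bounds of [resolvent_bound] do not decay in [t]. *)
Definition newman_weight (r : R) z : R[i]^o := 1 - (z * (- (r ^- 2)%:C)) * z.

Lemma newman_weight_cdiff r z : cdiff (newman_weight r) z.
Proof.
apply: cdiffB; first exact: cdiff_cst.
apply: (@cdiffZ _ R[i]^o (fun z => z * (- (r ^- 2)%:C)) (fun z => z)); last exact: cdiff_id.
by apply: (@cdiffZ _ R[i]^o (fun z => z) (fun=> - (r ^- 2)%:C));
  [exact: cdiff_id|exact: cdiff_cst].
Qed.

(** For [y ^ 2 = r ^ 2] the weight is [x (x + 2 i y) / r ^ 2]. *)
Lemma newman_weight_horizontal (r x y : R) : 0 < r -> `|x| <= r -> `|y| = r ->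
  cabs (newman_weight r (x +i* y)) <= 3 / r * `|x|.
Proof.
move=> r0 xr yr; have y2 : y ^+ 2 = r ^+ 2 by rewrite -(real_normK (num_real y)) yr.
have -> : newman_weight r (x +i* y) = (r ^- 2)%:C * (x%:C * (x +i* (2 * y))).
  rewrite /newman_weight; apply/eqP; rewrite eq_complex /=; apply/andP; split; apply/eqP.
    rewrite !(mul0r, mulr0, subr0, addr0, add0r, oppr0).
    have -> : 1 = r ^- 2 * y ^+ 2 by rewrite y2 mulVf// expf_neq0// gt_eqF.
    by ring.
  by rewrite !(mul0r, mulr0, subr0, addr0, add0r, oppr0); ring.
have r20 : 0 <= r ^- 2 by rewrite invr_ge0 exprn_ge0// ltW.
rewrite !cabsM !cabs_re (ger0_norm r20).
have : cabs (x +i* (2 * y)) <= 3 * r.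
  by rewrite (le_trans (cabs_le _ _))// normrM yr ger0_norm//; lra.
move=> /(ler_wpM2l (normr_ge0 x)) k.
rewrite ler_pdivrMl ?exprn_gt0//; apply: (le_trans k).
by rewrite le_eqVlt; apply/orP; left; apply/eqP; field; lra.
Qed.

Lemma newman_weight_vertical (r x y : R) : 0 < r -> `|x| <= r -> `|y| <= r ->
  cabs (newman_weight r (x +i* y)) <= 3.
Proof.
move=> r0 xr yr; rewrite /newman_weight (le_trans (cabsD _ _))// cabsN cabs1.
have s2 : cabs (x +i* y) ^+ 2 <= 2 * r ^+ 2.
  rewrite cabsE sqr_sqrtr ?addr_ge0 ?sqr_ge0//.
  rewrite -(real_normK (num_real x)) -(real_normK (num_real y)).
  have : `|x| ^+ 2 <= r ^+ 2 by rewrite lerXn2r ?nnegrE// ltW.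
  have : `|y| ^+ 2 <= r ^+ 2 by rewrite lerXn2r ?nnegrE// ltW.
  lra.
have r20 : 0 <= r ^- 2 by rewrite invr_ge0 exprn_ge0// ltW.
rewrite !cabsM cabsN cabs_re (ger0_norm r20) mulrAC -expr2.
have : cabs (x +i* y) ^+ 2 * r ^- 2 <= 2 by rewrite ler_pdivrMr ?exprn_gt0.
lra.
Qed.

(** With [w] the weight, [(F - F_t) e^(t z) w] is differentiable at the points of
    the closed square and takes the value [g t] at the origin; on each edge it is
    dominated by exponential averages of the norm of [f]. *)
Theorem newman_estimate : exists C : R, 0 <= C /\ forall t, 0 <= t ->
  ((rnorm (g t))%:E <= C%:E * (\int[mu]_(s in Rplus)
     (cauchy_kernel (s - t) * rnorm (h s))%:E + (cauchy_kernel t)%:E))%E.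
Proof.
have [r [M [r0 r1 M0 FM]]] := extension_square.
pose K := contour_const r; have K0 : 0 < K.
  by rewrite /K /contour_const ltr_wpDl ?divr_gt0// mulr_ge0 ?expR_ge0// divr_ge0// ltW.
exists (K * (1 + M) / (4 * r)); split.
  have rr : 0 <= 4 * r by rewrite mulr_ge0// ltW.
  exact: divr_ge0 (mulr_ge0 (ltW K0) (addr_ge0 ler01 M0)) rr.
move=> t t0.
pose H z : X := (cexp (z * t%:C) * newman_weight r z : R[i]) *: (F z - truncated_laplace f t z).
have dH x y : `|x| <= r -> `|y| <= r -> cdiff H (x +i* y).
  move=> xr yr; apply: cdiffZ.
    apply: (@cdiffZ _ R[i]^o (fun z => cexp (z * t%:C)) (newman_weight r)).
      exact: cdiff_cexp.
    exact: newman_weight_cdiff.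
  apply: cdiffB; first by have [] := FM x y xr yr.
  exact: (truncated_laplace_cdiff mN N0 fh hl hexp).
have H0 : H 0 = g t.
  rewrite /H /newman_weight mul0r cexp0 mul1r !mul0r subr0 scale1r.
  by rewrite truncated_laplace0.
have rN : - r <= r by lra.
have nr : `|r| = r by rewrite gtr0_norm.
have nNr : `|- r| = r by rewrite normrN.
pose n x y := rnorm (H (x +i* y)).
have cn x y : `|x| <= r -> `|y| <= r ->
    {for x, continuous (n ^~ y)} /\ {for y, continuous (n x)}.
  by move=> xr yr; exact: (cont_at_near rnorm_lip (cdiff_continuous (dH x y xr yr))).
pose S x := n x (- r) + n x r + (n r x + n (- r) x).
have cS x : - r <= x <= r -> {for x, continuous S}.
  rewrite -ler_norml => xr; apply: cvgD; apply: cvgD.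
  - by apply: (cn _ _ xr _).1; rewrite nNr.
  - by apply: (cn _ _ xr _).1; rewrite nr.
  - by apply: (cn _ _ _ xr).2; rewrite nr.
  - by apply: (cn _ _ _ xr).2; rewrite nNr.
have est := cauchy_estimate r0 dH.
pose A x := (tail t x + (M * expR (- (x * t)))%:E)%E.
have A0 x : (0 <= A x)%E.
  by apply: adde_ge0 => //; rewrite lee_fin mulr_ge0 ?expR_ge0.
have AE (c y : R) : 0 <= c ->
    (c%:E * A y = c%:E * tail t y + (c * (M * expR (- (y * t))))%:E)%E.
  move=> c0; rewrite /A; move: (tail t y) (tail_ge0 t y) => T T0.
  by rewrite ge0_muleDr// lee_fin mulr_ge0 ?expR_ge0.
have hor x y : `|x| <= r -> `|y| = r -> ((n x y)%:E <= (3 / r * `|x|)%:E * A `|x|%R)%E.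
  move=> xr yr; have yr' : `|y| <= r by rewrite yr.
  have wh := newman_weight_horizontal r0 xr yr.
  have [x0|x0] := eqVneq x 0.
    rewrite x0 normr0 mulr0 mul0e /n /H lee_fin.
    have -> : newman_weight r (0 +i* y) = 0.
      apply: cabs_eq0; apply/eqP; rewrite eq_le cabs_ge0 andbT.
      by move: wh; rewrite x0 normr0 mulr0.
    by rewrite mulr0 scale0r rnorm0.
  have rb := resolvent_bound t0 (FM x y xr yr').2 (x0 : complex.Re (x +i* y) != 0).
  rewrite /n /H mulrC -scalerA rnormZ EFinM.
  apply: (@le_trans _ _ ((3 / r * `|x|)%:E
    * (rnorm (cexp ((x +i* y) * t%:C) *:
         (F (x +i* y) - truncated_laplace f t (x +i* y))))%:E)%E).
    by rewrite -!EFinM lee_fin ler_wpM2r// rnorm_ge0.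
  by apply: lee_wpmul2l rb; rewrite lee_fin (le_trans (cabs_ge0 _) wh).
have ver x y : `|x| = r -> `|y| <= r -> ((n x y)%:E <= 3%:E * A r)%E.
  move=> xr yr; have xr' : `|x| <= r by rewrite xr.
  have wv := newman_weight_vertical r0 xr' yr.
  have x0 : x != 0 by rewrite -normr_eq0 xr gt_eqF.
  have rb := resolvent_bound t0 (FM x y xr' yr).2 (x0 : complex.Re (x +i* y) != 0).
  rewrite /= xr in rb.
  rewrite /n /H mulrC -scalerA rnormZ EFinM.
  apply: (@le_trans _ _ (3%:E
    * (rnorm (cexp ((x +i* y) * t%:C) *:
         (F (x +i* y) - truncated_laplace f t (x +i* y))))%:E)%E).
    by rewrite -!EFinM lee_fin ler_wpM2r// rnorm_ge0.
  by apply: lee_wpmul2l rb.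
have mph := measurable_rnorm_rep hl.
have mR : measurable (Rplus : set (measurableTypeR R)) by exact: measurable_Rplus.
pose k (xs : measurableTypeR R * measurableTypeR R) := contour_kernel r xs.1 (xs.2 - t).
have mk : measurable_fun setT k by exact: measurable_contour_kernel.
have k0 (v : measurableTypeR R * measurableTypeR R) : 0 <= k v by exact: contour_kernel_ge0.
(* the four edges together, in terms of the kernel that is integrated below *)
have Sle x : - r <= x <= r -> ((S x)%:E <=
    \int[mu]_(s in Rplus) (k (x, s) * rnorm (h s))%:E + (M * contour_kernel r x t)%:E)%E.
  rewrite -ler_norml => xr.
  apply: (@le_trans _ _ ((n x (- r))%:E + (n x r)%:E + ((n r x)%:E + (n (- r) x)%:E))%E).
    exact: lexx.
  apply: (@le_trans _ _ ((6 / r * `|x|)%:E * A `|x|%R + 6%:E * A r)%E).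
    have -> : ((6 / r * `|x|)%:E = (3 / r * `|x|)%:E + (3 / r * `|x|)%:E)%E.
      by rewrite -EFinD; congr EFin; ring.
    have -> : (6%:E = 3%:E + 3%:E :> \bar R)%E by rewrite -EFinD; congr EFin; ring.
    have p3 : 0 <= 3 / r * `|x| by rewrite mulr_ge0 ?divr_ge0// ltW.
    rewrite !ge0_muleDl ?lee_fin//.
    by do 2?apply: leeD; [exact: hor|exact: hor|exact: ver|exact: ver].
  have p6 : 0 <= 6 / r * `|x| by rewrite mulr_ge0 ?divr_ge0// ltW.
  rewrite !AE// addeACA; apply: leeD; last first.
    rewrite -EFinD lee_fin /contour_kernel (ger0_norm t0) le_eqVlt.
    by apply/orP; left; apply/eqP; ring.
  have pl (y : R) : measurable_fun Rplus (fun s => (exponential_kernel y t s * rnorm (h s))%:E).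
    by apply/measurable_EFinP; apply: measurable_funM => //; exact: measurable_exponential_kernel.
  have pl0 (y s : R) : (0 <= (exponential_kernel y t s * rnorm (h s))%:E)%E.
    by rewrite lee_fin mulr_ge0 ?expR_ge0 ?rnorm_ge0.
  have zl (c y : R) : 0 <= c -> (c%:E * tail t y =
      \int[mu]_(s in Rplus) (c%:E * (exponential_kernel y t s * rnorm (h s))%:E))%E.
    by move=> c0; exact: (esym (ge0_integralZl_EFin mu mR (fun s _ => pl0 y s) (pl y) c0)).
  have p60 : 0 <= (6 : R) by [].
  rewrite zl// zl// -ge0_integralD//; last 4 first.
  - by move=> s _; apply: mule_ge0; [rewrite lee_fin|exact: pl0].
  - exact: (measurable_funeM _ (pl _)).
  - by move=> s _; apply: mule_ge0; [rewrite lee_fin|exact: pl0].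
  - exact: (measurable_funeM _ (pl _)).
  rewrite le_eqVlt; apply/orP; left; apply/eqP; apply: eq_integral => s _.
  rewrite -!EFinM -EFinD /k /contour_kernel /exponential_kernel /=; congr EFin; ring.
pose ck x := contour_kernel r x t.
have cck x : - r <= x <= r -> {for x, continuous ck}.
  by move=> _; exact: contour_kernel_continuous.
have ick d : itv_int (fun x => contour_kernel r x d) (- r) r <= K * cauchy_kernel d.
  have := itv_int_contour_kernel r0 r1 (normr_ge0 d).
  rewrite /contour_kernel normr_id /cauchy_kernel real_normK//.
  by rewrite num_real.
have mI : measurable (`[- r, r] : set (measurableTypeR R)) by exact: measurable_itv.
pose J := (\int[mu]_(s in Rplus) (cauchy_kernel (s - t) * rnorm (h s))%:E)%E.
have J0 : (0 <= J)%E.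
  by apply: integral_ge0 => s _; rewrite lee_fin mulr_ge0 ?rnorm_ge0// ltW// cauchy_kernel_gt0.
(* integration over the boundary turns the exponential averages into a single
   average against the Cauchy kernel, by Tonelli's theorem *)
have main : ((4 * r * rnorm (g t))%:E <= K%:E * J + (M * (K * cauchy_kernel t))%:E)%E.
  apply: (@le_trans _ _ (\int[mu]_(x in `[(- r)%R, r]) (S x)%:E)%E).
    by rewrite -itv_int_EFin// lee_fin -H0; exact: est.
  apply: (@le_trans _ _ (\int[mu]_(x in `[(- r)%R, r]) (\int[mu]_(s in Rplus) (k (x, s) * rnorm (h s))%:E +
      (M * ck x)%:E))%E).
    apply: (ge0_le_integral_off_null (N := set0)) => //.
    - by move=> x; rewrite lee_fin !addr_ge0// rnorm_ge0.
    - move=> x; rewrite adde_ge0//; last by rewrite lee_fin mulr_ge0// contour_kernel_ge0.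
      by apply: integral_ge0 => s _; rewrite lee_fin mulr_ge0 ?rnorm_ge0.
    - by move=> x /=; rewrite in_itv /= => xr _; exact: Sle.
  have cM x : - r <= x <= r -> {for x, continuous (fun x => M * ck x)}.
    by move=> xr; apply: cvgM; [exact: cvg_cst|exact: cck].
  rewrite ge0_integralD//; last 4 first.
  - by move=> x _; apply: integral_ge0 => s _; rewrite lee_fin mulr_ge0 ?rnorm_ge0.
  - by apply: (@measurable_inner R _ Rplus k) => // s; exact: rnorm_ge0.
  - by move=> x _; rewrite lee_fin mulr_ge0// contour_kernel_ge0.
  - exact: measurable_int (cont_itv_integrable cM).
  apply: leeD; last first.
    by rewrite -itv_int_EFin// itv_intZ// lee_fin ler_wpM2l//; exact: ick.
  rewrite tonelli_on//; last by move=> s; exact: rnorm_ge0.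
  rewrite /J -ge0_integralZl_EFin//; last 3 first.
  - by move=> s _; rewrite lee_fin mulr_ge0 ?rnorm_ge0// ltW// cauchy_kernel_gt0.
  - apply/measurable_EFinP; apply: measurable_funM => //.
    by apply: measurable_funTS; apply: continuous_measurable_fun => x; exact: cauchy_kernel_continuous.
  - exact: ltW.
  apply: (ge0_le_integral_off_null (N := set0)) => //.
  - move=> s; rewrite mule_ge0 ?lee_fin ?rnorm_ge0//.
    by apply: integral_ge0 => x _; rewrite lee_fin.
  - move=> s; rewrite lee_fin !mulr_ge0 ?rnorm_ge0// ltW//.
    exact: cauchy_kernel_gt0.
  - move=> s Ds _; rewrite EFinM muleA.
    apply: lee_wpmul2r; first by rewrite lee_fin rnorm_ge0.
    rewrite -(itv_int_EFin (f := fun x => contour_kernel r x (s - t))) -?EFinM ?lee_fin//.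
    by move=> x _; exact: contour_kernel_continuous.
have r4 : (4 * r)%R != 0 by rewrite mulf_neq0// gt_eqF.
have gE : ((rnorm (g t))%:E = ((4 * r)^-1)%:E * (4 * r * rnorm (g t))%:E)%E.
  by rewrite -EFinM mulrA mulVf// mul1r.
have CE : ((K * (1 + M) / (4 * r))%:E = ((4 * r)^-1)%:E * (K * (1 + M))%:E)%E.
  by rewrite -EFinM mulrC.
have r40 : 0 <= (4 * r)^-1 by rewrite invr_ge0 mulr_ge0// ltW.
rewrite -/J gE CE -muleA; apply: lee_wpmul2l; first by rewrite lee_fin.
apply: (le_trans main).
have j0 := ltW (cauchy_kernel_gt0 t).
move: J J0 {main} => J J0; rewrite ge0_muleDr ?lee_fin//; apply: leeD.
  by apply: lee_wpmul2r => //; rewrite lee_fin ler_peMr ?lerDl// ltW.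
by rewrite -EFinM lee_fin mulrA ler_wpM2r// mulrC ler_wpM2l ?lerDr// ltW.
Qed.

End Newman.

(** * Averages against the Cauchy kernel *)

Section CauchyAverages.
Context {R : realType}.
Local Notation mu := (@lebesgue_measure R).
Implicit Types (e s t y : R).
Variables (phi : R -> R) (q : R).
Hypothesis phi0 : forall s, 0 <= phi s.
Hypothesis mphi : measurable_fun (Rplus : set (measurableTypeR R)) phi.
Hypothesis q1 : 1 <= q.

Definition cauchy_average (psi : R -> R) t : \bar R :=
  (\int[mu]_(s in Rplus) (cauchy_kernel (s - t) * psi s)%:E)%E.

Let mR : measurable (Rplus : set (measurableTypeR R)).
Proof. exact: measurable_Rplus. Qed.

Let j0 d : 0 <= cauchy_kernel d :> R.
Proof. exact/ltW/cauchy_kernel_gt0. Qed.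

Let mj t : measurable_fun (Rplus : set (measurableTypeR R)) (fun s => cauchy_kernel (s - t)).
Proof.
apply: measurable_funTS; apply: continuous_measurable_fun => x.
exact: cauchy_kernel_continuous.
Qed.

Lemma cauchy_average_ge0 psi t : (forall s, 0 <= psi s) -> (0 <= cauchy_average psi t)%E.
Proof. by move=> p0; apply: integral_ge0 => s _; rewrite lee_fin mulr_ge0. Qed.

(** The first term suffices if [y <= e]; otherwise [y / e <= (y / e) ^ q]. *)
Lemma young_eps e y : 0 < e -> 0 <= y -> y <= e + e * (e^-1 `^ q) * y `^ q.
Proof.
move=> e0 y0; have [ye|ey] := leP y e.
  by rewrite (le_trans ye)// lerDl !mulr_ge0 ?powR_ge0// ltW.
have -> : e * (e^-1 `^ q) * y `^ q = e * ((y / e) `^ q).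
  by rewrite powRM ?invr_ge0 ?(ltW e0)//; ring.
have h : y / e <= (y / e) `^ q.
  rewrite -[leLHS]powRr1 ?divr_ge0 ?(ltW e0)// ler_powR//.
  by rewrite ler_pdivlMr// mul1r ltW.
rewrite (le_trans (_ : y <= e * (y / e)))//; first by rewrite mulrCA divff ?mulr1// gt_eqF.
by rewrite (le_trans (ler_wpM2l (ltW e0) h))// lerDr ltW.
Qed.

Let phiq s := phi s `^ q.

Let mphiq : measurable_fun (Rplus : set (measurableTypeR R)) phiq.
Proof. by apply: (measurableT_comp (measurable_powR q)). Qed.

Let phiq0 s : 0 <= phiq s.
Proof. exact: powR_ge0. Qed.

Lemma cauchy_average_young e t : 0 < e ->
  (cauchy_average phi t <= (e * pi)%:E + (e * (e^-1 `^ q))%:E * cauchy_average phiq t)%E.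
Proof.
move=> e0; have c0 : 0 <= e * (e^-1 `^ q) by rewrite mulr_ge0 ?powR_ge0 ?ltW.
have mjq : measurable_fun (Rplus : set (measurableTypeR R))
    (fun s => (cauchy_kernel (s - t) * phiq s)%:E).
  by apply/measurable_EFinP; apply: measurable_funM.
apply: (@le_trans _ _ (\int[mu]_(s in Rplus) (e%:E * (cauchy_kernel (s - t))%:E +
    (e * (e^-1 `^ q))%:E * (cauchy_kernel (s - t) * phiq s)%:E))%E).
  apply: (ge0_le_integral_off_null (N := set0)) => //.
  - by move=> s; rewrite lee_fin mulr_ge0.
  - by move=> s; rewrite -!EFinM -EFinD lee_fin addr_ge0// !mulr_ge0 ?(ltW e0) ?powR_ge0.
  - move=> s _ _; rewrite -!EFinM -EFinD lee_fin.
    rewrite (le_trans (ler_wpM2l (j0 _) (young_eps e0 (phi0 s))))// /phiq.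
    by rewrite le_eqVlt; apply/orP; left; apply/eqP; ring.
have j0E s : (0 <= (cauchy_kernel (s - t))%:E)%E by rewrite lee_fin.
have p0E s : (0 <= (cauchy_kernel (s - t) * phiq s)%:E)%E by rewrite lee_fin mulr_ge0.
have mjE : measurable_fun (Rplus : set (measurableTypeR R)) (fun s => (cauchy_kernel (s - t))%:E).
  exact/measurable_EFinP.
rewrite ge0_integralD//; last 4 first.
- by move=> s _; rewrite mule_ge0// lee_fin ltW.
- exact: measurable_funeM.
- by move=> s _; rewrite mule_ge0// lee_fin.
- exact: measurable_funeM.
rewrite (ge0_integralZl_EFin mu mR (fun s _ => j0E s) mjE (ltW e0)).
rewrite (ge0_integralZl_EFin mu mR (fun s _ => p0E s) mjq c0).
apply: leeD => //; rewrite EFinM; apply: lee_wpmul2l; first by rewrite lee_fin ltW.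
exact: integral_cauchy_kernel.
Qed.

Hypothesis Ifin : (\int[mu]_(s in Rplus) (phiq s)%:E < +oo)%E.

Lemma cauchy_average_powR_lty t : (cauchy_average phiq t < +oo)%E.
Proof.
apply: le_lt_trans Ifin; apply: (ge0_le_integral_off_null (N := set0)) => //.
- by move=> s; rewrite lee_fin mulr_ge0.
- by move=> s; rewrite lee_fin ler_piMl// cauchy_kernel_le1.
Qed.

Lemma cauchy_average_powR_fin t : cauchy_average phiq t \is a fin_num.
Proof. by rewrite ge0_fin_numE ?cauchy_average_powR_lty// cauchy_average_ge0. Qed.

Lemma cauchy_average_fin t : cauchy_average phi t \is a fin_num.
Proof.
rewrite ge0_fin_numE ?cauchy_average_ge0//.
apply: le_lt_trans (cauchy_average_young t ltr01) _.
rewrite -(fineK (cauchy_average_powR_fin t)) -EFinM -EFinD; exact: ltry.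
Qed.

Let A t := fine (cauchy_average phi t).
Let B t := fine (cauchy_average phiq t).

Lemma fine_average_young e t : 0 < e -> A t <= e * pi + e * (e^-1 `^ q) * B t.
Proof.
move=> /(cauchy_average_young t); rewrite -(fineK (cauchy_average_fin t)).
by rewrite -(fineK (cauchy_average_powR_fin t)) -EFinM -EFinD lee_fin.
Qed.

(** A substitute for Jensen's inequality, with a constant: the choice of [e] makes
    the left-hand side of [fine_average_young] equal to [e * pi + e]. *)
Lemma fine_average_powR t : (A t / (pi + 1)) `^ q <= B t.
Proof.
have A0 : 0 <= A t by rewrite fine_ge0// cauchy_average_ge0.
have B0 : 0 <= B t by rewrite fine_ge0// cauchy_average_ge0.
have p1 : 0 < pi + 1 :> R by rewrite addr_gt0// pi_gt0.
have q0 : q != 0 by rewrite gt_eqF// (lt_le_trans ltr01).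
move: A0; rewrite le_eqVlt => /predU1P[<-|A0]; first by rewrite mul0r powR0.
set e := A t / (pi + 1); have e0 : 0 < e by rewrite divr_gt0.
have Ae : A t = e * (pi + 1) by rewrite /e mulrAC mulfK// gt_eqF.
have := fine_average_young t e0; rewrite [leLHS]Ae mulrDr mulr1 lerD2l -mulrA.
rewrite -[leLHS]mulr1 ler_pM2l// => h.
have eq0 : 0 < e `^ q by rewrite powR_gt0.
rewrite -(ler_pM2l (_ : 0 < e^-1 `^ q)); last by rewrite powR_gt0// invr_gt0.
rewrite -powRM ?invr_ge0 ?(ltW e0)// mulVf ?powR1// gt_eqF//.
Qed.

Lemma fine_average_bounded : exists M : R, 0 <= M /\ forall t, A t <= M.
Proof.
pose I := fine (\int[mu]_(s in Rplus) (phiq s)%:E)%E.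
have I0 : 0 <= I by rewrite fine_ge0// integral_ge0// => s _; rewrite lee_fin.
exists (pi + I); split; first by rewrite addr_ge0// pi_ge0.
move=> t; have := fine_average_young t ltr01; rewrite invr1 powR1 !mul1r.
move=> /le_trans; apply; rewrite lerD2l fine_le ?cauchy_average_powR_fin//.
  by rewrite ge0_fin_numE// integral_ge0// => s _; rewrite lee_fin.
apply: (ge0_le_integral_off_null (N := set0)) => //.
- by move=> s; rewrite lee_fin mulr_ge0.
- by move=> s; rewrite lee_fin ler_piMl// cauchy_kernel_le1.
Qed.

Lemma cauchy_kernel_cvg0 (v : nat -> R) (s : R) :
  v n @[n --> \oo] --> +oo -> cauchy_kernel (s - v n) @[n --> \oo] --> 0.
Proof.
move=> vy; apply/cvgrPdist_lt => e e0.
have /cvgryPgt/(_ (s + e^-1 + 1)) := vy; apply: filterS => n vn.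
rewrite sub0r normrN ger0_norm//.
have ei : 0 < e^-1 by rewrite invr_gt0.
rewrite -[ltRHS]invrK ltf_pV2 ?posrE//; last by rewrite ltr_pwDl// sqr_ge0.
rewrite expr2; nra.
Qed.

(** The average of [phi ^ q] tends to 0 by dominated convergence, the kernel being
    bounded; [fine_average_young] with a small [e] then handles that of [phi]. *)
Lemma fine_average_cvg0 : A t @[t --> +oo] --> 0.
Proof.
have B0 : forall v : nat -> R, v n @[n --> \oo] --> +oo -> B (v n) @[n --> \oo] --> 0.
  move=> v vy.
  have iphi : mu.-integrable Rplus (fun s => (phiq s)%:E).
    apply/integrableP; split; first exact/measurable_EFinP.
    by under eq_integral do rewrite gee0_abs ?lee_fin//.
  have [| | | | |_ _ lim_int] := @dominated_convergence _ _ _ mu Rplus mR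
    (fun n s => (cauchy_kernel (s - v n) * phiq s)%:E) (cst 0%E)
    (fun s => (phiq s)%:E).
  - by move=> n; apply/measurable_EFinP; apply: measurable_funM.
  - exact: measurable_cst.
  - apply/aeW => s _; apply: cvg_EFin; first by near=> n.
    rewrite -[0](mul0r (phiq s)); apply: cvgM; last exact: cvg_cst.
    exact: cauchy_kernel_cvg0.
  - exact: iphi.
  - apply/aeW => s n _; rewrite gee0_abs ?lee_fin ?mulr_ge0//.
    by rewrite ler_piMl// cauchy_kernel_le1.
  move: lim_int; rewrite integral0 => /fine_cvgP[_]; exact.
apply/cvg_pinftyP => v vy; apply/cvgrPdist_le => e e0.
have p1 : 0 < pi + 1 :> R by rewrite addr_gt0// pi_gt0.
pose d := e / (pi + 1); have d0 : 0 < d by rewrite divr_gt0.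
pose c := d * (d^-1 `^ q); have c0 : 0 < c by rewrite mulr_gt0// powR_gt0// invr_gt0.
have k0 : 0 < d / c by rewrite divr_gt0.
have /cvgrPdist_lt/(_ _ k0) := B0 v vy; apply: filterS => n.
rewrite !sub0r !normrN => Bn; rewrite ger0_norm; last first.
  by rewrite fine_ge0// cauchy_average_ge0.
apply: (le_trans (fine_average_young (v n) d0)); rewrite -/c.
have : c * B (v n) <= d.
  rewrite -ler_pdivlMl// mulrC ltW//; apply: le_lt_trans Bn; exact: ler_norm.
have dE : d * pi + d = e.
  by rewrite -[X in _ + X]mulr1 -mulrDr /d divfK// gt_eqF.
lra.
Unshelve. all: end_near. Qed.

Lemma measurable_cauchy_average :
  measurable_fun (Rplus : set (measurableTypeR R)) (cauchy_average phiq).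
Proof.
exact: (@measurable_inner R _ _ (fun ts => cauchy_kernel (ts.2 - ts.1)) _ mR mR
  (fun v => j0 _) phiq0 (@measurable_cauchy_kernel R) mphiq).
Qed.

(** Tonelli's theorem and the integrability of the kernel in its other argument. *)
Lemma integral_cauchy_average_lty :
  (\int[mu]_(t in Rplus) cauchy_average phiq t < +oo)%E.
Proof.
pose k (ts : measurableTypeR R * measurableTypeR R) : R := cauchy_kernel (ts.2 - ts.1).
have k0 (v : measurableTypeR R * measurableTypeR R) : 0 <= k v by exact: j0.
have -> := tonelli_on mR mR k0 phiq0 (@measurable_cauchy_kernel R) mphiq.
apply: (@le_lt_trans _ _ (\int[mu]_(s in Rplus) ((pi : R)%:E * (phiq s)%:E))%E).
  apply: (ge0_le_integral_off_null (N := set0)) => //.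
  - by move=> s; rewrite mule_ge0 ?lee_fin//; apply: integral_ge0 => t _; rewrite lee_fin.
  - by move=> s; rewrite mule_ge0 ?lee_fin// pi_ge0.
  - move=> s _ _; apply: lee_wpmul2r; first by rewrite lee_fin.
    apply: le_trans (integral_cauchy_kernel s).
    rewrite le_eqVlt; apply/orP; left; apply/eqP; apply: eq_integral => t _.
    by rewrite /k /= /cauchy_kernel -opprB sqrrN.
have p0E s : (0 <= (phiq s)%:E)%E by rewrite lee_fin.
have mE : measurable_fun (Rplus : set (measurableTypeR R)) (fun s => (phiq s)%:E).
  exact/measurable_EFinP.
rewrite (ge0_integralZl_EFin mu mR (fun s _ => p0E s) mE (pi_ge0 R)).
by rewrite lte_mul_pinfty ?lee_fin ?pi_ge0.
Qed.

End CauchyAverages.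

(** * Lebesgue spaces and primitives *)

Section LpMembership.
Context {R : realType} {X : normedModType R[i]}.
Local Notation mu := (@lebesgue_measure R).
Implicit Types (f g : R -> X) (q : R) (t s : R).

Lemma Lnorm_patch_lty f q : 1 <= q ->
  ('N[mu]_(q%:E)[patch (fun=> 0%E) Rplus (fun t => (rnorm (f t))%:E)] < +oo)%E <->
  (\int[mu]_(t in Rplus) (rnorm (f t) `^ q)%:E < +oo)%E.
Proof.
move=> q1; have q0 : 0 < q := lt_le_trans ltr01 q1.
have -> : (\int[mu]_(t in Rplus) (rnorm (f t) `^ q)%:E =
    \int[mu]_t (`|patch (fun=> 0%E) Rplus (fun t => (rnorm (f t))%:E) t| `^ q))%E.
  rewrite integral_mkcond; apply: eq_integral => t _; rewrite /patch.
  case: ifP => _; last by rewrite abse0 poweR0r// gt_eqF.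
  by rewrite /= ger0_norm// rnorm_ge0.
rewrite Lnorm.unlock; split => [|h]; last exact: poweR_lty.
by apply: lty_poweRy; rewrite invr_neq0// gt_eqF.
Qed.

Lemma lebesgue_measureT_gt0 : (0 < mu [set: R])%E.
Proof. by rewrite -set_itvNyy lebesgue_measure_itv /=; exact: (ltry 0). Qed.

Lemma Lnorm_patch_infty_lty f :
  ('N[mu]_(+oo%E)[patch (fun=> 0%E) Rplus (fun t => (rnorm (f t))%:E)] < +oo)%E <->
  exists M : R, {ae mu, forall t, Rplus t -> rnorm (f t) <= M}.
Proof.
rewrite Lnorm.unlock lebesgue_measureT_gt0; split.
  move=> ess; have [M Mess] : exists M : R, (ess_sup mu (abse \o patch (fun=> 0%E) Rplus
      (fun t => (rnorm (f t))%:E)) <= M%:E)%E.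
    move: ess; case: (ess_sup _ _) => [M _||_]//; first by exists M.
    by exists 0; rewrite leNye.
  exists M; move/ess_supP : Mess; apply: filterS => t + Rt.
  by rewrite /= /patch mem_set//= lee_fin ger0_norm// rnorm_ge0.
move=> [M fM]; apply: (@le_lt_trans _ _ (Num.max M 0)%:E); last exact: ltry.
apply/ess_supP; have [A [mA A0 subA]] := fM; exists A; split=> // t nle.
apply: subA => {}fM; apply: nle.
rewrite /= /patch; case: ifPn => [/set_mem Rt|_] /=.
  by rewrite lee_fin ger0_norm ?rnorm_ge0// le_max fM.
by rewrite normr0 lee_fin le_max lexx orbT.
Qed.

Lemma continuous_strongly_measurable g :
  {within Rplus, continuous g} -> strongly_measurable mu Rplus g.
Proof.
by move=> /continuous_simple_limit[s [ss sg]]; exists s; split=> //; apply/aeW.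
Qed.

End LpMembership.

Section PrimitiveContinuity.
Context {R : realType} {X : completeNormedModType R[i]}.
Local Notation mu := (@lebesgue_measure R).
Implicit Types (t s : R).
Variables (f h : R -> X) (N : set R).
Hypothesis mN : measurable N.
Hypothesis N0 : mu N = 0%E.
Hypothesis fh : forall t, Rplus t -> ~ N t -> f t = h t.
Hypothesis hl : simple_limit mu Rplus h.
Hypothesis hexp : forall x, 0 < x ->
  mu.-integrable Rplus (fun s => (expR (- (x * s)) * rnorm (h s))%:E).

Let Phi t : R := \int[mu]_(s in `[0, t]) rnorm (h s).

Let mitv t : measurable (`[0, t] : set (measurableTypeR R)).
Proof. exact: measurable_itv. Qed.

Let hl_itv t : simple_limit mu `[0, t] h.
Proof.
apply: simple_limit_restrict hl => //; first exact: measurable_Rplus.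
exact: itv0_Rplus.
Qed.

Lemma primitive_dist s t : 0 <= s -> s <= t ->
  rnorm (bochner mu `[0, t] f - bochner mu `[0, s] f) <= Phi t - Phi s.
Proof.
move=> s0 st; apply: rnorm_le_rfun => u hu.
have iphi v := locally_integrable_rep hl hexp v.
have b v := bochner_rfun (mitv v) mN N0 (fun x Dx => fh (itv0_Rplus Dx)) (hl_itv v) (iphi v) hu.
have iu v : mu.-integrable `[0, v] (EFin \o (fun s => u (h s))).
  apply: le_integrable (iphi v) => //.
    by apply/measurable_EFinP; exact: (simple_limit_rfun (hl_itv v) hu).
  by move=> x _ /=; rewrite lee_fin [leRHS]ger0_norm ?rnorm_ge0// rfun_le.
have b1 : (BLeft 0 <= BRight s)%O by rewrite bnd_simp.
have b2 : (BRight s <= BRight t)%O by rewrite bnd_simp.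
rewrite (rfunB _ _ hu) (b t) (b s) (Rintegral_itvB (iu t) b1 b2).
rewrite /Phi (Rintegral_itvB (iphi t) b1 b2).
have mI : measurable (`]s, t] : set (measurableTypeR R)) by exact: measurable_itv.
have sub : (`]s, t] : set (measurableTypeR R)) `<=` `[0, t].
  by apply: subset_itvr; rewrite bnd_simp.
apply: le_Rintegral => //.
- exact: integrableS (iu t).
- exact: integrableS (iphi t).
- by move=> x _; apply: le_trans (rfun_le _ hu); exact: ler_norm.
Qed.

Lemma primitive_continuous (c : X) :
  {within Rplus, continuous (fun t => c - bochner mu `[0, t] f)}.
Proof.
apply/subspace_continuousP => x; rewrite Rplus_ge0 => x0.
have x1 : 0 <= x + 1 by lra.
have /subspace_continuousP/(_ x) := parameterized_integral_continuous x1
  (locally_integrable_rep hl hexp (x + 1)).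
rewrite /= in_itv /= x0 lerDl ler01 => /(_ isT)/cvgrPdist_lt Phic.
apply/cvg_rnormP => e /Phic; rewrite !near_withinE => near_e.
near=> y => Ry; have y0 : 0 <= y by rewrite -Rplus_ge0.
have xy1 : `|x - y| < 1 by near: y; apply/nbhs_ballP; exists 1 => /=.
have yI : `[0, x + 1]%classic y.
  rewrite /= in_itv /= y0; move: xy1; rewrite ltr_norml; lra.
have : `|Phi x - Phi y| < e by move: yI; near: y; exact: near_e.
apply: le_lt_trans; rewrite opprD opprK addrACA subrr add0r addrC.
have [xy|/ltW yx] := leP x y.
  by rewrite distrC (le_trans (primitive_dist x0 xy))// ler_norm.
by rewrite rnorm_distC (le_trans (primitive_dist y0 yx))// ler_norm.
Unshelve. all: end_near. Qed.

End PrimitiveContinuity.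

(** * Functions dominated by a Cauchy average *)

Section Representatives.
Context {R : realType} {X : completeNormedModType R[i]}.
Local Notation mu := (@lebesgue_measure R).
Implicit Types (x t s q : R).

Lemma cauchy_average_exp_integrable (h : R -> X) : simple_limit mu Rplus h ->
    (cauchy_average (fun s => rnorm (h s)) 0 < +oo)%E ->
  forall x, 0 < x -> mu.-integrable Rplus (fun s => (expR (- (x * s)) * rnorm (h s))%:E).
Proof.
move=> hl avg x x0.
have mR : measurable (Rplus : set (measurableTypeR R)) by exact: measurable_Rplus.
have mph := measurable_rnorm_rep hl.
have avgi : mu.-integrable Rplus (fun s => (cauchy_kernel (s - 0) * rnorm (h s))%:E).
  apply/integrableP; split.
    apply/measurable_EFinP; apply: measurable_funM => //.
    apply: measurable_funTS; apply: continuous_measurable_fun => y.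
    exact: cauchy_kernel_continuous.
  have jh0 s : 0 <= cauchy_kernel (s - 0) * rnorm (h s).
    by rewrite mulr_ge0 ?rnorm_ge0// ltW// cauchy_kernel_gt0.
  apply: le_lt_trans avg; apply: (ge0_le_integral_off_null (N := set0)) => // s _ _.
  by rewrite gee0_abs// lee_fin.
pose y := Num.min x 1; have y0 : 0 < y by rewrite lt_min x0 ltr01.
have y1 : y <= 1 by rewrite ge_min lexx orbT.
have yx : y <= x by rewrite ge_min lexx.
apply: (@le_integrable _ _ _ _ _ mR _
   (fun s => ((4 / y ^+ 2)%:E * (cauchy_kernel (s - 0) * rnorm (h s))%:E)%E)); last first.
- exact: integrableZl.
- move=> s; rewrite Rplus_ge0 => s0; rewrite /= lee_fin subr0.
  have c0 : 0 <= 4 / y ^+ 2 by rewrite divr_ge0// exprn_ge0// ltW.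
  rewrite [leLHS]ger0_norm ?mulr_ge0 ?expR_ge0 ?rnorm_ge0//.
  rewrite [leRHS]ger0_norm; last first.
    exact: mulr_ge0 c0 (mulr_ge0 (ltW (cauchy_kernel_gt0 _)) (rnorm_ge0 _)).
  rewrite mulrA ler_wpM2r ?rnorm_ge0//.
  apply: le_trans (exp_le_cauchy_kernel y0 y1 s0).
  by rewrite ler_expR lerN2 ler_wpM2r.
- apply/measurable_EFinP; apply: measurable_funM => //.
  by apply: measurableT_comp => //; exact: measurableT_comp.
Qed.

(** The representative is made 0 on the null set, which for infinite [p] includes
    the points where the essential bound fails; the bound then has no exceptions. *)
Lemma memLp_rep (p : \bar R) (f : R -> X) : (1 <= p)%E -> memLp mu Rplus p f ->
  exists (N : set R) (h : R -> X), [/\ measurable N, mu N = 0%E,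
    forall t, Rplus t -> ~ N t -> f t = h t, simple_limit mu Rplus h &
    (exists q : R, [/\ p = q%:E, 1 <= q &
       (\int[mu]_(s in Rplus) (rnorm (h s) `^ q)%:E < +oo)%E]) \/
    (p = +oo%E /\ exists M : R, 0 <= M /\ forall t, Rplus t -> rnorm (h t) <= M)].
Proof.
have mR : measurable (Rplus : set (measurableTypeR R)) by exact: measurable_Rplus.
case: p => [q|_|//] => [q1|]; move=> [fs fLp].
  rewrite lee_fin in q1.
  have [N [h [mN N0 _ hl [hf h0]]]] :=
    strongly_measurable_rep mR measurable0 (measure0 mu) fs.
  exists N, h; split=> //; first by move=> t _ /hf.
  left; exists q; split=> //; move/(Lnorm_patch_lty f q1) : fLp.
  apply: le_lt_trans; apply: (ge0_le_integral_off_null mN) => //.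
  - by move=> t; rewrite lee_fin powR_ge0.
  - by move=> t; rewrite lee_fin powR_ge0.
  - by move=> t _ /hf ->.
have /Lnorm_patch_infty_lty[M [N' [mN' N'0 fM]]] := fLp.
have [N [h [mN N0 NN hl [hf h0]]]] := strongly_measurable_rep mR mN' N'0 fs.
exists N, h; split=> //; first by move=> t _ /hf.
right; split=> //; exists (Num.max M 0); split; first by rewrite le_max lexx orbT.
move=> t Rt; have [Nt|Nt] := pselect (N t).
  by rewrite h0// rnorm0 le_max lexx orbT.
rewrite (hf _ Nt) le_max; apply/orP; left; apply: contrapT => fMt; apply: Nt; apply: NN.
by apply: fM => /= /(_ Rt).
Qed.

Lemma bounded_cauchy_average (phi : R -> R) (M : R) t : (forall s, 0 <= phi s) ->
    0 <= M -> (forall s, Rplus s -> phi s <= M) ->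
  (cauchy_average phi t <= (M * pi)%:E)%E.
Proof.
move=> p0 M0 pM; have jE s : (0 <= (cauchy_kernel (s - t))%:E)%E.
  by rewrite lee_fin ltW// cauchy_kernel_gt0.
apply: (@le_trans _ _ (\int[mu]_(s in Rplus) (M%:E * (cauchy_kernel (s - t))%:E))%E).
  apply: (ge0_le_integral_off_null (N := set0)) => //.
  - by move=> s; rewrite EFinM mule_ge0// lee_fin.
  - by move=> s; rewrite mule_ge0.
  - move=> s Rs _; rewrite EFinM muleC; apply: lee_wpmul2r => //.
    by rewrite lee_fin pM.
rewrite (ge0_integralZl_EFin mu _ (fun s _ => jE s))//.
- by rewrite EFinM; apply: lee_wpmul2l => //; exact: integral_cauchy_kernel.
- exact: measurable_Rplus.
- apply/measurable_EFinP; apply: measurable_funTS; apply: continuous_measurable_fun => x.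
  exact: cauchy_kernel_continuous.
Qed.

End Representatives.

Section Domination.
Context {R : realType} {X : completeNormedModType R[i]}.
Local Notation mu := (@lebesgue_measure R).
Implicit Types (x t s : R).
Variables (g : R -> X) (phi : R -> R) (q C : R).
Hypothesis cg : {within Rplus, continuous g}.
Hypothesis phi0 : forall s, 0 <= phi s.
Hypothesis mphi : measurable_fun (Rplus : set (measurableTypeR R)) phi.
Hypothesis q1 : 1 <= q.
Hypothesis Ifin : (\int[mu]_(s in Rplus) (phi s `^ q)%:E < +oo)%E.
Hypothesis Cge0 : 0 <= C.
Hypothesis gC : forall t, 0 <= t ->
  ((rnorm (g t))%:E <= C%:E * (cauchy_average phi t + (cauchy_kernel t)%:E))%E.

Let A t := fine (cauchy_average phi t).
Let B t := fine (cauchy_average (fun s => phi s `^ q) t).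

Let A0 t : 0 <= A t.
Proof. by rewrite fine_ge0// cauchy_average_ge0. Qed.

Let gA t : 0 <= t -> rnorm (g t) <= C * (A t + cauchy_kernel t).
Proof.
by move=> /gC; rewrite -(fineK (cauchy_average_fin phi0 mphi q1 Ifin t)) -EFinD -EFinM lee_fin.
Qed.

Lemma dominated_bounded : exists M : R, 0 <= M /\ forall t, 0 <= t -> rnorm (g t) <= M.
Proof.
have [M [M0 AM]] := fine_average_bounded phi0 mphi q1 Ifin.
exists (C * (M + 1)); split; first by rewrite mulr_ge0// addr_ge0.
move=> t /gA/le_trans; apply; rewrite ler_wpM2l// lerD ?AM//.
exact: cauchy_kernel_le1.
Qed.

(** A sum is at most twice its larger term, and the [q]-th power of the kernel is
    at most the kernel. *)
Lemma dominated_powR t : 0 <= t ->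
  rnorm (g t) `^ q <= (2 * (C * (pi + 1))) `^ q * (B t + cauchy_kernel t).
Proof.
move=> t0; have q0 : 0 <= q by rewrite (le_trans ler01).
have p1 : 0 < pi + 1 :> R by rewrite addr_gt0// pi_gt0.
pose a := A t / (pi + 1); pose b := cauchy_kernel t.
have a0 : 0 <= a by rewrite divr_ge0// ltW.
have b0 : 0 < b by exact: cauchy_kernel_gt0.
have m0 : 0 <= Num.max a b by rewrite le_max a0.
have D0 : 0 <= C * (pi + 1) by rewrite mulr_ge0// ltW.
have gle : rnorm (g t) <= (2 * (C * (pi + 1))) * Num.max a b.
  rewrite (le_trans (gA t0))// -/b.
  have -> : A t = a * (pi + 1) by rewrite /a divfK// gt_eqF.
  have am : a <= Num.max a b by rewrite le_max lexx.
  have bm : b <= Num.max a b by rewrite le_max lexx orbT.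
  have b1 : b <= b * (pi + 1) by rewrite ler_peMr ?lerDr ?pi_ge0// ltW.
  rewrite (le_trans (_ : _ <= C * (a * (pi + 1) + b * (pi + 1))))//.
    by rewrite ler_wpM2l// lerD2l.
  have -> : C * (a * (pi + 1) + b * (pi + 1)) = C * (pi + 1) * (a + b) by ring.
  rewrite (_ : 2 * _ * _ = C * (pi + 1) * (Num.max a b + Num.max a b)); last by ring.
  by rewrite ler_wpM2l// lerD.
have h : rnorm (g t) `^ q <= ((2 * (C * (pi + 1))) * Num.max a b) `^ q.
  by rewrite ge0_ler_powR// nnegrE ?rnorm_ge0// mulr_ge0// mulr_ge0.
rewrite (le_trans h)// powRM//; last by rewrite mulr_ge0.
rewrite ler_wpM2l ?powR_ge0//.
have aB : a `^ q <= B t by exact: fine_average_powR.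
have bb : b `^ q <= b by rewrite ge1r_powR// b0 cauchy_kernel_le1.
have B0 : 0 <= B t by exact: le_trans (powR_ge0 _ _) aB.
rewrite /Num.max; case: ifP => _.
  by rewrite (le_trans bb)// lerDr.
by rewrite (le_trans aB)// lerDl ltW.
Qed.

Lemma dominated_memLp : memLp mu Rplus q%:E g.
Proof.
split; first exact: continuous_strongly_measurable.
apply/(Lnorm_patch_lty g q1).
pose D := (2 * (C * (pi + 1))) `^ q.
have D0 : 0 <= D by exact: powR_ge0.
have B0 s : 0 <= B s by rewrite fine_ge0// cauchy_average_ge0// => ?; exact: powR_ge0.
have j0 s : 0 <= cauchy_kernel s :> R by exact/ltW/cauchy_kernel_gt0.
have mR : measurable (Rplus : set (measurableTypeR R)) by exact: measurable_Rplus.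
have BE s : cauchy_average (fun s => phi s `^ q) s = (B s)%:E.
  by rewrite /B fineK//; exact: cauchy_average_powR_fin Ifin s.
have mB : measurable_fun (Rplus : set (measurableTypeR R)) (fun s => (B s)%:E).
  by under eq_fun do rewrite -BE; exact: measurable_cauchy_average.
have mj : measurable_fun (Rplus : set (measurableTypeR R)) (fun s => (cauchy_kernel s)%:E).
  apply/measurable_EFinP; apply: measurable_funTS; apply: continuous_measurable_fun => x.
  have := @cauchy_kernel_continuous R 0 x.
  by rewrite (_ : (fun s => _) = @cauchy_kernel R)//; apply/funext => s; rewrite subr0.
apply: (@le_lt_trans _ _ (\int[mu]_(s in Rplus) (D%:E * ((B s)%:E + (cauchy_kernel s)%:E)))%E).
  apply: (ge0_le_integral_off_null (N := set0)) => //.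
  - by move=> s; rewrite lee_fin powR_ge0.
  - by move=> s; rewrite -EFinD -EFinM lee_fin mulr_ge0// addr_ge0.
  - move=> s; rewrite Rplus_ge0 => s0 _; rewrite -EFinD -EFinM lee_fin.
    exact: dominated_powR.
have sE s : (0 <= (B s)%:E + (cauchy_kernel s)%:E)%E.
  by rewrite -EFinD lee_fin addr_ge0.
rewrite (ge0_integralZl_EFin mu mR (fun s _ => sE s) (emeasurable_funD mB mj) D0).
rewrite ge0_integralD//; last 2 first.
- by move=> s _; rewrite lee_fin.
- by move=> s _; rewrite lee_fin.
rewrite lte_mul_pinfty ?lee_fin// lte_add_pinfty//.
  under eq_integral do rewrite -BE.
  exact: integral_cauchy_average_lty.
apply: (@le_lt_trans _ _ (pi : R)%:E); last exact: ltry.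
apply: le_trans (integral_cauchy_kernel (0 : R)); rewrite le_eqVlt; apply/orP; left.
by apply/eqP; apply: eq_integral => s _; rewrite subr0.
Qed.

Lemma dominated_C0 : C0 g.
Proof.
split=> //; apply/cvg_rnormP => e e0.
have lim : C * (A t + cauchy_kernel t) @[t --> +oo] --> 0.
  rewrite -(mulr0 C); apply: cvgM; first exact: cvg_cst.
  rewrite -[0]addr0; apply: cvgD; first exact: (fine_average_cvg0 phi0 mphi q1 Ifin).
  apply/cvg_pinftyP => v vy; have := cauchy_kernel_cvg0 0 vy.
  rewrite (_ : (fun n => cauchy_kernel (0 - v n)) = (fun n => cauchy_kernel (v n)))//.
  by apply/funext => n; rewrite sub0r /cauchy_kernel sqrrN.
near=> t; have t0 : 0 <= t by near: t; exact: nbhs_pinfty_ge.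
rewrite sub0r rnormN (le_lt_trans (gA t0))//.
have : `|0 - C * (A t + cauchy_kernel t)| < e.
  by near: t; move/cvgrPdist_lt : lim; apply.
by rewrite sub0r normrN; apply: le_lt_trans; exact: ler_norm.
Unshelve. all: end_near. Qed.

(** A bound [M] of [|g|] yields [|g| ^ r <= M ^ (r - q) |g| ^ q]. *)
Lemma dominated_memLp_ge (r : \bar R) : (q%:E <= r)%E -> memLp mu Rplus r g.
Proof.
have [M [M0 gM]] := dominated_bounded.
have [gs /(Lnorm_patch_lty g q1) gq] := dominated_memLp.
case: r => [r| |//] => [|_]; last first.
  split=> //; apply/Lnorm_patch_infty_lty; exists M; apply/aeW => t.
  by rewrite Rplus_ge0; exact: gM.
rewrite lee_fin => qr; split=> //; apply/(Lnorm_patch_lty g (le_trans q1 qr)).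
have mR : measurable (Rplus : set (measurableTypeR R)) by exact: measurable_Rplus.
have mg : measurable_fun (Rplus : set (measurableTypeR R)) (fun t => (rnorm (g t) `^ q)%:E).
  apply/measurable_EFinP; apply: (measurableT_comp (measurable_powR q)).
  exact: (simple_limit_rnorm (continuous_simple_limit cg)).
have gE t : (0 <= (rnorm (g t) `^ q)%:E)%E by rewrite lee_fin powR_ge0.
apply: (@le_lt_trans _ _ (\int[mu]_(t in Rplus) ((M `^ (r - q))%:E * (rnorm (g t) `^ q)%:E))%E).
  apply: (ge0_le_integral_off_null (N := set0)) => //.
  - by move=> t; rewrite lee_fin powR_ge0.
  - by move=> t; rewrite -EFinM lee_fin mulr_ge0 ?powR_ge0.
  - move=> t; rewrite Rplus_ge0 => t0 _; rewrite -EFinM lee_fin.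
    have -> : rnorm (g t) `^ r = rnorm (g t) `^ (r - q) * rnorm (g t) `^ q.
      rewrite -powRD ?subrK//; apply/implyP => /eqP r0.
      by exfalso; have := le_trans q1 qr; rewrite r0 ler10.
    rewrite ler_wpM2r ?powR_ge0// ge0_ler_powR ?subr_ge0 ?nnegrE ?rnorm_ge0//.
    exact: gM.
rewrite (ge0_integralZl_EFin mu mR (fun t _ => gE t) mg (powR_ge0 _ _)).
by rewrite lte_mul_pinfty ?lee_fin ?powR_ge0.
Qed.

End Domination.

Theorem theorem3p2 (R : realType) (X : completeNormedModType R[i])
  (p : \bar R) (f : R -> X) (U : set R[i]^o) (F : R[i]^o -> X) :
  (1 <= p)%E ->
  memLp (@lebesgue_measure R) Rplus p f ->
  laplace_extension f U F ->
  U 0 ->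
  let g := fun t : R => F 0 - bochner (@lebesgue_measure R) `[0, t] f in
  memLp (@lebesgue_measure R) Rplus p g /\
  ((p < +oo)%E ->
    C0 g /\
    (forall r : \bar R, (p <= r)%E ->
      memLp (@lebesgue_measure R) Rplus r g)).
Proof.
move=> p1 fLp lF U0 g.
have [N [h [mN N0 fh hl hp]]] := memLp_rep p1 fLp.
pose phi s := rnorm (h s).
have phi0 s : 0 <= phi s by exact: rnorm_ge0.
have mphi : measurable_fun (Rplus : set (measurableTypeR R)) phi by exact: measurable_rnorm_rep.
have avg : (cauchy_average phi 0 < +oo)%E.
  case: hp => [[q [_ q1 Ifin]]|[_ [M [M0 hM]]]].
    by have := cauchy_average_fin phi0 mphi q1 Ifin 0; rewrite ge0_fin_numE// cauchy_average_ge0.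
  exact: le_lt_trans (bounded_cauchy_average 0 phi0 M0 hM) (ltry _).
have hexp := cauchy_average_exp_integrable hl avg.
have cg : {within Rplus, continuous g} by exact: (primitive_continuous mN N0 fh hl hexp).
have [C [Cge0 gC]] := newman_estimate mN N0 fh hl hexp lF U0.
case: hp => [[q [-> q1 Ifin]]|[-> [M [M0 hM]]]]; last first.
  split=> //; split; first exact: continuous_strongly_measurable.
  apply/Lnorm_patch_infty_lty; exists (C * (M * pi + 1)); apply/aeW => t.
  rewrite Rplus_ge0 => t0; rewrite -lee_fin EFinM; apply: (le_trans (gC t t0)).
  apply: lee_wpmul2l; first by rewrite lee_fin.
  rewrite EFinD; apply: leeD; first exact: (bounded_cauchy_average t phi0 M0 hM).
  by rewrite lee_fin cauchy_kernel_le1.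
have dom := dominated_memLp_ge cg phi0 mphi q1 Ifin Cge0 gC.
split; first exact: dom.
move=> _; split; last exact: dom.
exact: (dominated_C0 cg phi0 mphi q1 Ifin gC).
Qed.
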